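(* Let $1\le N<\infty$, $\mathbb S=\{1,\dots,N\}$, $b:\mathbb R^n\times\mathbb S\to\mathbb R^n$ and $\sigma:\mathbb S\to\mathbb R^{n\times m}$ (additive noise). Assume the following. (1) There is $L>0$ such that $|b(x,i)-b(y,i)|\le L|x-y|$ for all $i\in\mathbb S$, $x,y\in\mathbb R^n$. (2) There exist $c_0>0$ and $\beta_1,\dots,\beta_N\in\mathbb R$ such that for all $i\in\mathbb S$ and $x,y\in\mathbb R^n$: $2\langle x,b(x,i)\rangle+\|\sigma(i)\|^2\le c_0+\beta_i|x|^2$ and $2\langle x-y,b(x,i)-b(y,i)\rangle\le\beta_i|x-y|^2$. (3) $\sum_{i=1}^N\mu_i\beta_i<0$, where $\mu$ is the stationary distribution of $\{\Lambda_t\}_{t\ge0}$. Let $p_0>0$ be such that $\eta_p>0$ for all $p\in(0,p_0)$, fix $p\in(0,1\wedge p_0)$, and let $\xi^{(p)}$, $\eta_p$ and $\alpha>0$ be as defined in the context. Then for every stepsize $\delta\in(0,1)$ with $$\delta<\frac1{16L^2}\wedge\Big(\frac{\eta_p}{\alpha}\Big)^{2/p},$$ the Euler-Maruyama chain $(\bar Y_{k\delta}^{x,i},\Lambda_{k\delta}^i)_{k\ge0}$ admits a unique invariant measure $\pi^\delta\in\mathcal P(\mathbb R^n\times\mathbb S)$.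
   Context: $\{W_t\}_{t\ge0}$ is an $m$-dimensional Brownian motion and $\{\Lambda_t\}_{t\ge0}$ is an independent continuous-time Markov chain on $\mathbb S$ with irreducible conservative $Q$-matrix $Q=(q_{ij})_{N\times N}$. Its unique stationary distribution is $\mu=(\mu_1,\dots,\mu_N)$, with all $\mu_i>0$. $\Lambda^i$ denotes the chain started at $i$. $\|\cdot\|$ is the Hilbert-Schmidt norm, $a\wedge b=\min\{a,b\}$, and $\mathcal P(\mathbb R^n\times\mathbb S)$ is the set of probability measures on $\mathbb R^n\times\mathbb S$. The Euler-Maruyama (EM) scheme for $dX_t=b(X_t,\Lambda_t)\,dt+\sigma(\Lambda_t)\,dW_t$ with stepsize $\delta\in(0,1)$ is $$\bar Y_{(k+1)\delta}^{x,i}=\bar Y_{k\delta}^{x,i}+b(\bar Y_{k\delta}^{x,i},\Lambda_{k\delta}^i)\delta+\sigma(\Lambda_{k\delta}^i)\,(W_{(k+1)\delta}-W_{k\delta}),\quad k\ge0,\quad \bar Y_0^{x,i}=x,\ \Lambda_0^i=i.$$ The pair $(\bar Y_{k\delta}^{x,i},\Lambda_{k\delta}^i)$ is a time-homogeneous Markov chain on $\mathbb R^n\times\mathbb S$ with transition kernel $P^\delta_{k\delta}(x,i;dy\times\{j\})$. A measure $\pi^\delta\in\mathcal P(\mathbb R^n\times\mathbb S)$ is invariant for it if $\pi^\delta(\Gamma\times\{i\})=\sum_{j=1}^N\int_{\mathbb R^n}P^\delta_{k\delta}(x,j;\Gamma\times\{i\})\,\pi^\delta(dx\times\{j\})$ for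 all $k\ge0$, Borel $\Gamma\subseteq\mathbb R^n$, $i\in\mathbb S$. For $p>0$ set $Q_p:=Q+\frac p2\,\mathrm{diag}(\beta_1,\dots,\beta_N)$ and $\eta_p:=-\max_{\gamma\in\mathrm{spec}(Q_p)}\mathrm{Re}\,\gamma$. Under assumption (3) a $p_0>0$ with $\eta_p>0$ for all $p\in(0,p_0)$ exists. By the Perron-Frobenius theorem there is an eigenvector $\xi^{(p)}=(\xi^{(p)}_1,\dots,\xi^{(p)}_N)$ with all entries strictly positive and $Q_p\xi^{(p)}=-\eta_p\xi^{(p)}$. Put $$\hat\xi_0:=\max_i\xi_i^{(p)},\quad \bar\xi_0:=\big(\min_i\xi_i^{(p)}\big)^{-1},\quad \beta_0:=\max_i|\beta_i|,\quad q_0:=\max_i(-q_{ii}),$$ $$\alpha:=p\Big\{\beta_0+4L^2(3+4\beta_0)+4^{(2+p)/2}\beta_0\big(4^{p/2}L^p+q_0\hat\xi_0\bar\xi_0\big)\Big\}.$$ *)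

(* Defs.v *)
From HB Require Import structures.
From mathcomp Require Import all_boot all_order all_algebra.
From mathcomp Require Import complex.
From mathcomp Require Import all_classical all_reals all_analysis.

Set Implicit Arguments.
Unset Strict Implicit.
Unset Printing Implicit Defensive.

Import Order.TTheory GRing.Theory Num.Theory.
Import numFieldNormedType.Exports.

Local Open Scope classical_set_scope.
Local Open Scope ring_scope.

(* Real vectors are columns 'cV[R]_n.  The library norm on matrices is the
   sup norm, hence the explicit Euclidean and Hilbert-Schmidt norms. *)
Section norms.
Context {R : realType}.

Definition dotp n (x y : 'cV[R]_n) : R := \sum_(k < n) x k 0 * y k 0.

Definition enorm n (x : 'cV[R]_n) : R := Num.sqrt (dotp x x).

Definition hsnorm n m (A : 'M[R]_(n, m)) : R :=
  Num.sqrt (\sum_(k < n) \sum_(l < m) A k l ^+ 2).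

End norms.

Definition borelV (R : realType) (n : nat) : measurableType _ :=
  g_sigma_algebraType (@open 'cV[R]_n).

(* The state space {1, ..., N} is 'I_N.+1 (so that N + 1 >= 1 is the number of
   states), with the discrete sigma-algebra. *)
Definition stateT (N : nat) : Type := 'I_N.+1.

HB.instance Definition _ N := Finite.copy (stateT N) 'I_N.+1.
HB.instance Definition _ N := isPointed.Build (stateT N) (@ord0 N).
HB.instance Definition _ N :=
  @isMeasurable.Build default_measure_display (stateT N)
    discrete_measurable discrete_measurable0
    discrete_measurableC discrete_measurableU.

Section processes.
Context {R : realType} {d : measure_display} {Omega : measurableType d}.
Variable P : probability Omega R.

(* sigma-algebra generated by the variables X t, t in I *)
Definition process_sigma d' (T : measurableType d') (X : R -> Omega -> T)
    (I : set R) : set (set Omega) :=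
  <<s [set A | exists t, I t /\ exists B, measurable B /\ A = X t @^-1` B] >>.

Definition history d' (T : measurableType d') (X : R -> Omega -> T) (t : R) :=
  process_sigma X `[0, t].

Definition independent_processes d1 (T1 : measurableType d1)
    d2 (T2 : measurableType d2)
    (X : R -> Omega -> T1) (Y : R -> Omega -> T2) : Prop :=
  forall A B, process_sigma X `[0, +oo[ A -> process_sigma Y `[0, +oo[ B ->
    P (A `&` B) = (P A * P B)%E.

Definition increment m (W : R -> Omega -> borelV R m) (s t : R) (w : Omega)
    : 'cV[R]_m := (W t w : 'cV[R]_m) - W s w.

Record is_brownian_motion m (W : R -> Omega -> borelV R m) : Prop := {
  bm_measurable : forall t, 0 <= t -> measurable_fun setT (W t) ;
  bm_start : {ae P, forall w, W 0 w = 0 :> 'cV[R]_m} ;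
  (* increment W s t has law N(0, (t - s) I_m); normal_prob takes the standard
     deviation as its second parameter *)
  bm_gaussian : forall s t, 0 <= s -> s < t ->
    forall B : 'I_m -> set R, (forall l, measurable (B l)) ->
    P [set w | forall l, B l ((increment W s t w) l 0)] =
    (\prod_(l < m) fine (normal_prob 0 (Num.sqrt (t - s)) (B l)))%:E ;
  bm_independent : forall s t, 0 <= s -> s < t ->
    forall (A : set Omega) (B : set (borelV R m)),
    history W s A -> measurable B ->
    P (A `&` [set w | B (increment W s t w)]) =
    (P A * P [set w | B (increment W s t w)])%E ;
  bm_continuous : {ae P, forall w,
    {within `[0, +oo[, continuous (fun t => W t w : 'cV[R]_m)}} }.

(* Lambda i is the chain started at i, so that P [Lambda i t = j] is the
   transition probability p_ij(t). *)
Record is_markov_chain N (Q : 'M[R]_N.+1)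
    (Lambda : 'I_N.+1 -> R -> Omega -> stateT N) : Prop := {
  mc_measurable : forall i t, 0 <= t -> measurable_fun setT (Lambda i t) ;
  mc_start : forall i, {ae P, forall w, Lambda i 0 w = i :> 'I_N.+1} ;
  mc_markov : forall i s t, 0 <= s -> 0 <= t -> forall A (j k : 'I_N.+1),
    history (Lambda i) s A ->
    P (A `&` [set w | Lambda i s w = j] `&` [set w | Lambda i (s + t) w = k]) =
    (P (A `&` [set w | Lambda i s w = j]) * P [set w | Lambda j t w = k])%E ;
  mc_rates : forall i j : 'I_N.+1,
    (fine (P [set w | Lambda i t w = j]) - (i == j)%:R) / t
      @[t --> 0^'+] --> Q i j ;
  mc_right_continuous : forall i, {ae P, forall w, forall t, 0 <= t ->
    exists2 e, 0 < e & forall s, t <= s -> s < t + e ->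
      Lambda i s w = Lambda i t w} }.

Record is_stationary_distribution N
    (Lambda : 'I_N.+1 -> R -> Omega -> stateT N) (mu : 'I_N.+1 -> R) : Prop := {
  sd_ge0 : forall i, 0 <= mu i ;
  sd_sum1 : \sum_i mu i = 1 ;
  sd_invariant : forall t, 0 <= t -> forall j : 'I_N.+1,
    (mu j)%:E =
    (\sum_(i < N.+1) (mu i)%:E * P [set w | Lambda i t w = j])%E }.

End processes.

Section rate_matrices.
Context {R : realType} {N : nat}.
Implicit Types (Q : 'M[R]_N.+1) (beta : 'I_N.+1 -> R) (xi : 'cV[R]_N.+1).

Definition is_conservative_Qmatrix Q : Prop :=
  (forall i j, i != j -> 0 <= Q i j) /\ (forall i, \sum_j Q i j = 0).

Definition irreducible_Qmatrix Q : Prop :=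
  forall i j, connect [rel k l | (k != l) && (0 < Q k l)] i j.

Definition Qp Q beta (p : R) : 'M[R]_N.+1 :=
  Q + (p / 2) *: diag_mx (\row_i beta i).

(* The spectrum is finite and nonempty, so that the sup is a max. *)
Definition etap Q beta (p : R) : R :=
  - sup [set complex.Re z | z in
      [set z : complex R | eigenvalue (map_mx (real_complex R) (Qp Q beta p)) z]].

Definition maxI (f : 'I_N.+1 -> R) : R := \big[Num.max/f ord0]_i f i.
Definition minI (f : 'I_N.+1 -> R) : R := \big[Num.min/f ord0]_i f i.

Definition alpha Q beta (L p : R) xi : R :=
  let xi0hat := maxI (fun i => xi i 0) in
  let xi0bar := (minI (fun i => xi i 0))^-1 in
  let beta0 := maxI (fun i => `|beta i|) in
  let q0 := maxI (fun i => - Q i i) in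
  p * (beta0 + 4 * L ^+ 2 * (3 + 4 * beta0)
       + 4 `^ ((2 + p) / 2) * beta0
         * (4 `^ (p / 2) * L `^ p + q0 * xi0hat * xi0bar)).

End rate_matrices.

Section euler_maruyama.
Context {R : realType} {d : measure_display} {Omega : measurableType d}.
Variables (P : probability Omega R) (n m N : nat).
Variables (b : 'cV[R]_n -> 'I_N.+1 -> 'cV[R]_n) (sigma : 'I_N.+1 -> 'M[R]_(n, m)).
Variables (W : R -> Omega -> borelV R m)
          (Lambda : 'I_N.+1 -> R -> Omega -> stateT N).
Variable delta : R.

Fixpoint em_scheme (x : 'cV[R]_n) (i : 'I_N.+1) (k : nat) (w : Omega)
    : 'cV[R]_n :=
  if k is k'.+1 then
    let y := em_scheme x i k' w in
    let j : 'I_N.+1 := Lambda i (k'%:R * delta) w in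
    y + delta *: b y j
      + sigma j *m increment W (k'%:R * delta) (k'.+1%:R * delta) w
  else x.

Definition em_kernel (k : nat) (x : 'cV[R]_n) (i : 'I_N.+1)
    (A : set (borelV R n * stateT N)) : \bar R :=
  P [set w | A (em_scheme x i k w, Lambda i (k%:R * delta) w)].

(* The integral of f against pi(dx * {j}) is the integral of z |-> f z.1
   against pi over R^n * {j}. *)
Definition em_invariant (pi : probability (borelV R n * stateT N)%type R)
    : Prop :=
  forall (k : nat) (Gamma : set (borelV R n)) (i : 'I_N.+1), measurable Gamma ->
    pi (Gamma `*` [set i]) =
    (\sum_(j < N.+1) \int[pi]_(z in setT `*` [set j])
       em_kernel k z.1 j (Gamma `*` [set i]))%E.

End euler_maruyama.

(* Main.v *)
Require Import Defs.
From HB Require Import structures.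
From mathcomp Require Import all_boot all_order all_algebra.
From mathcomp Require Import complex.
From mathcomp Require Import all_classical all_reals all_analysis.
From mathcomp Require Import ring lra measurable_realfun.

(** Two copies of the scheme driven by the same Brownian motion and the same chain
lose the noise in their difference, because it is additive. Hence one step
from the state [i] multiplies [|x - y| ^ p] by at most
[g i = (1 + beta_i delta + L ^ 2 delta ^ 2) ^ (p / 2)]. This may exceed 1 in some
states, but the eigenvector [xi] of [Q_p] compensates for it: the bound on
[delta] gives [g i * E xi(Lambda^i_delta) <= rho * xi_i] with [rho < 1]
([em_step_contraction], which rests on a first order expansion of the
transition semigroup, [ts_drift]). Consequently the transition operator [K] of
the scheme contracts by [rho] the constant [C] of the functions [h] with values
in [[0, 1]] such that [h (x, i) <= h (y, i) + C xi_i |x - y| ^ p]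
([em_op_holder]). These functions separate probability measures
([holder_separate]), and [K ^ k] is integration against the kernel of the scheme
([em_kernel_iter]), so that the question becomes one about the iterates of [K] on
them.

Uniqueness. The state marginal of an invariant measure [pi] is the only
stationary distribution [mu] of the positive matrix of transition
probabilities over one step. Since [K ^ k h] is nearly constant in its first
argument for large [k], the integral of [h] against [pi], which is that of
[K ^ k h], is the limit of [sum_i mu_i K ^ k h (0, i)], whatever [pi] is.

Existence. It remains to see that these limits are the integrals of some
probability measure. Compose the steps of the scheme in the reversed order, along
the stationary chain run backwards in time, from the origin. After [k] steps this
gives a point [Z_k] whose joint law with the initial state [s_0] of the
reversed chain is that of the scheme after [k] steps from the origin and the
stationary distribution ([backward_mean]). Going from [Z_k] to [Z_(k+1)] only
changes the argument of a composition that contracts by [rho ^ k] in the mean, so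
that the sum of the expectations of [|Z_(k+1) - Z_k| ^ p] converges, and [Z_k]
converges almost surely to some [Z]. The law of [(Z, s_0)] is invariant
([backward_limit_invariant]). *)

Set Implicit Arguments.
Unset Strict Implicit.
Unset Printing Implicit Defensive.

Import Order.TTheory GRing.Theory Num.Theory.
Import numFieldNormedType.Exports.

Local Open Scope classical_set_scope.
Local Open Scope ring_scope.

(** * Transition semigroups of finite Markov chains *)

Record transition_semigroup (R : realType) (N : nat) (Q : 'M[R]_N.+1)
    (pt : R -> 'I_N.+1 -> 'I_N.+1 -> R) : Prop := {
  ts_ge0 : forall t i j, 0 <= t -> 0 <= pt t i j ;
  ts_sum1 : forall t i, 0 <= t -> \sum_j pt t i j = 1 ;
  ts_start : forall i j, pt 0 i j = (i == j)%:R ;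
  ts_add : forall s t i k, 0 <= s -> 0 <= t ->
    pt (s + t) i k = \sum_j pt s i j * pt t j k ;
  ts_rate : forall i j, (pt t i j - (i == j)%:R) / t @[t --> 0^'+] --> Q i j }.

Section transition_semigroup.
Context {R : realType} {N : nat} (Q : 'M[R]_N.+1).
Variable pt : R -> 'I_N.+1 -> 'I_N.+1 -> R.
Hypothesis hpt : transition_semigroup Q pt.
Let S := 'I_N.+1.

Lemma ts_le1 t i j : 0 <= t -> pt t i j <= 1.
Proof.
move=> t0; rewrite -(ts_sum1 hpt i t0) (bigD1 j)//= lerDl.
by apply: sumr_ge0 => k _; exact: (ts_ge0 hpt).
Qed.

Lemma ts_rate_near e : 0 < e -> \forall t \near 0^'+, forall i j,
  `|pt t i j - (i == j)%:R - t * Q i j| <= e * t.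
Proof.
move=> e0; apply: filter_forall => i; apply: filter_forall => j.
have /cvgrPdist_le /(_ _ e0) := ts_rate hpt (i := i) (j := j).
apply: filterS2 (nbhs_right_gt 0) => t t0 h.
rewrite distrC -(ler_pM2r t0) in h; apply: le_trans h.
rewrite -[X in _ <= _ * X](gtr0_norm t0) -normrM mulrBl divfK ?(gt_eqF t0)//.
by rewrite (mulrC t).
Qed.

Lemma ts_small_step e T : 0 < e -> 0 < T -> exists m : nat, forall i j,
  `|pt (T / m.+1%:R) i j - (i == j)%:R - T / m.+1%:R * Q i j|
     <= e * (T / m.+1%:R).
Proof.
move=> e0 T0.
have [r /= r0 hr] := ts_rate_near e0.
have [m hm] : exists m : nat, T / m.+1%:R < r.
  exists (Num.truncn (T / r)); rewrite ltr_pdivrMr ?ltr0n// mulrC -ltr_pdivrMr//.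
  exact: Num.Theory.truncnS_gt.
exists m; apply: hr; last by rewrite /= divr_gt0.
by rewrite /= sub0r normrN gtr0_norm// divr_gt0.
Qed.

(** Iterating the one-step bound [1 - (q + e') h <= pt h i i] loses at most
[(q + e') h] per step, because the diagonal entries are at most 1; for a fine enough subdivision of
[[0, t]] into steps of length [h] this holds with [e' = e / t], whatever [e > 0]. *)
Lemma ts_stay q t i : - Q i i <= q -> 0 <= q -> 0 <= t -> 1 - q * t <= pt t i i.
Proof.
move=> Qq q0; rewrite le_eqVlt => /predU1P[<-|t0].
  by rewrite (ts_start hpt) eqxx mulr0 subr0.
apply/ler_addgt0Pr => e e0.
have [m hm] := ts_small_step (divr_gt0 e0 t0) t0.
set h := t / m.+1%:R in hm.
have h0 : 0 < h by rewrite divr_gt0.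
have step : 1 - (q + e / t) * h <= pt h i i.
  have := hm i i; rewrite eqxx mulr1n ler_norml => /andP[+ _].
  have : - Q i i * h <= q * h by rewrite ler_pM2r.
  lra.
have : 1 - (q + e / t) * (m.+1%:R * h) <= pt (m.+1%:R * h) i i.
  elim: (m.+1) => [|k IH]; first by rewrite !mul0r mulr0 subr0 (ts_start hpt) eqxx.
  have -> : k.+1%:R * h = k%:R * h + h by rewrite -natr1 mulrDl mul1r.
  have kh0 : 0 <= k%:R * h by rewrite mulr_ge0// ltW.
  rewrite (ts_add hpt _ _ kh0 (ltW h0)) (bigD1 i)//=.
  rewrite -[leLHS]addr0 lerD//; last first.
    by apply: sumr_ge0 => j _; rewrite mulr_ge0// (ts_ge0 hpt)// ltW.
  have p1 : pt (k%:R * h) i i <= 1 by rewrite ts_le1// mulr_ge0// ltW.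
  have p0 : 0 <= pt (k%:R * h) i i by rewrite (ts_ge0 hpt)// mulr_ge0// ltW.
  have c0 : 0 <= (q + e / t) * h by rewrite mulr_ge0 ?(ltW h0)// addr_ge0 ?divr_ge0 // ltW.
  have : pt (k%:R * h) i i * (1 - (q + e / t) * h)
      <= pt (k%:R * h) i i * pt h i i by rewrite ler_wpM2l.
  have : pt (k%:R * h) i i * ((q + e / t) * h) <= 1 * ((q + e / t) * h)
    by rewrite ler_wpM2r.
  lra.
have -> : m.+1%:R * h = t by rewrite /h mulrC divfK// pnatr_eq0.
rewrite mulrDl divfK ?(gt_eqF t0)//; lra.
Qed.

(** The infinitesimal drift bound integrates: splitting [[0, T]] into steps of
length [h = T / m], each step moves the mean of [f] by [h] times the mean of
[Q f] up to [o(h)]. *)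
Lemma ts_drift (f : S -> R) (i : S) (T B : R) : 0 < T ->
  (forall t, 0 <= t -> t <= T -> \sum_j pt t i j * (\sum_k Q j k * f k) <= B) ->
  \sum_j pt T i j * f j <= f i + T * B.
Proof.
move=> T0 hB; pose F := 1 + \sum_k `|f k|.
have F0 : 0 < F by rewrite ltr_pwDl// sumr_ge0.
apply/ler_addgt0Pr => e e0.
have eF0 : 0 < e / (T * F) by rewrite divr_gt0// mulr_gt0.
have [m hm] := ts_small_step eF0 T0.
set h := T / m.+1%:R in hm.
have h0 : 0 < h by rewrite divr_gt0.
have Th : T = m.+1%:R * h by rewrite /h mulrC divfK// pnatr_eq0.
have step j : \sum_k pt h j k * f k <= f j + h * (\sum_k Q j k * f k) + h * (e / T).
  have -> : f j = \sum_k (j == k)%:R * f k.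
    rewrite (bigD1 j)//= eqxx mul1r big1 ?addr0// => k.
    by rewrite eq_sym => /negbTE ->; rewrite mul0r.
  have F1 : h * (\sum_k (e / (T * F)) * `|f k|) <= h * (e / T).
    rewrite ler_pM2l// -mulr_sumr invfM mulrA -[leRHS]mulr1 -mulrA ler_pM2l ?divr_gt0//.
    by rewrite ler_pdivrMl// mulr1 /F lerDr.
  apply: le_trans (lerD (lexx _) F1).
  rewrite !mulr_sumr -!big_split/=; apply: ler_sum => k _.
  have := hm j k; have := normr_ge0 (f k); have := ler_norm ((pt h j k - (j == k)%:R - h * Q j k) * f k).
  rewrite normrM => h1 h2 h3.
  have := ler_wpM2r h2 h3; lra.
have ind k : (k <= m.+1)%N -> \sum_j pt (k%:R * h) i j * f j <= f i + k%:R * h * (B + e / T).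
  elim: k => [_|k IH km].
    rewrite !mul0r addr0 (bigD1 i)//= (ts_start hpt) eqxx mul1r big1 ?addr0// => j.
    by rewrite (ts_start hpt) eq_sym => /negbTE ->; rewrite mul0r.
  have kh0 : 0 <= k%:R * h by rewrite mulr_ge0// ltW.
  have -> : \sum_j pt (k.+1%:R * h) i j * f j =
      \sum_j pt (k%:R * h) i j * \sum_l pt h j l * f l.
    under [RHS]eq_bigr do rewrite mulr_sumr.
    rewrite exchange_big/=; apply: eq_bigr => j _.
    have -> : k.+1%:R * h = k%:R * h + h by rewrite -natr1 mulrDl mul1r.
    rewrite (ts_add hpt _ _ kh0 (ltW h0)) mulr_suml.
    by apply: eq_bigr => l _; rewrite mulrA.
  apply: (@le_trans _ _ (\sum_j pt (k%:R * h) i j *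
      (f j + h * (\sum_k Q j k * f k) + h * (e / T)))).
    by apply: ler_sum => j _; rewrite ler_wpM2l// (ts_ge0 hpt).
  under eq_bigr do rewrite !mulrDr.
  rewrite !big_split/= -mulr_suml (ts_sum1 hpt)// mul1r.
  have -> : \sum_j pt (k%:R * h) i j * (h * (\sum_k Q j k * f k)) =
     h * \sum_j pt (k%:R * h) i j * (\sum_k Q j k * f k).
    by rewrite mulr_sumr; apply: eq_bigr => j _; rewrite mulrCA.
  have := IH (ltnW km).
  have : k%:R * h <= T by rewrite Th ler_pM2r// ler_nat ltnW.
  move=> /(hB _ kh0); rewrite -(ler_pM2l h0).
  rewrite -[k.+1%:R]natr1; lra.
have := ind _ (leqnn _); rewrite -Th.
suff -> : f i + T * (B + e / T) = f i + T * B + e by [].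
by rewrite mulrDr [T * (e / T)]mulrC divfK ?gt_eqF// addrA.
Qed.

Lemma ts_pos_diag t i : 0 <= t -> 0 < pt t i i.
Proof.
rewrite le_eqVlt => /predU1P[<-|t0]; first by rewrite (ts_start hpt) eqxx.
pose q := `|Q i i| + 1.
have q0 : 0 < q by rewrite ltr_wpDl.
pose m := Num.truncn (t * q).
have h0 : 0 < t / m.+1%:R by rewrite divr_gt0.
have ph : 0 < pt (t / m.+1%:R) i i.
  apply: lt_le_trans (ts_stay (q := q) (t := t / m.+1%:R) _ _ _); rewrite ?(ltW q0) ?(ltW h0)//; last first.
    by rewrite /q -normrN (le_trans (ler_norm _))// lerDl.
  rewrite subr_gt0 mulrA ltr_pdivrMr// mul1r mulrC; exact: Num.Theory.truncnS_gt.
set h := t / m.+1%:R in h0 ph.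
have -> : t = m.+1%:R * h by rewrite mulrC divfK// pnatr_eq0.
elim: (m.+1) => [|k IH]; first by rewrite mul0r (ts_start hpt) eqxx.
have kh0 : 0 <= k%:R * h by rewrite mulr_ge0// ltW.
have -> : k.+1%:R * h = k%:R * h + h by rewrite -natr1 mulrDl mul1r.
rewrite (ts_add hpt _ _ kh0 (ltW h0)) (bigD1 i)//=.
rewrite ltr_pwDl ?mulr_gt0// sumr_ge0// => j _.
by rewrite mulr_ge0// (ts_ge0 hpt)// ltW.
Qed.

(** A jump along a positive rate happens with positive probability in a short
time, after which the chain may stay where it is. *)
Lemma ts_pos_edge t i j : 0 < t -> i != j -> 0 < Q i j -> 0 < pt t i j.
Proof.
move=> t0 ij Qij.
have Q2 : 0 < Q i j / 2 by rewrite divr_gt0.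
have [m /(_ i j)] := ts_small_step Q2 t0.
set h := t / m.+1%:R; rewrite (negbTE ij) subr0 => hm.
have h0 : 0 < h by rewrite divr_gt0.
have ht : h <= t by rewrite ler_pdivrMr// ler_peMr// ?(ltW t0)// ler1n.
have ph : 0 < pt h i j.
  move: hm; rewrite ler_norml => /andP[+ _].
  have : 0 < h * Q i j by rewrite mulr_gt0.
  lra.
rewrite -(subrK h t) addrC (ts_add hpt) ?subr_ge0 ?(ltW h0)// (bigD1 j)//=.
rewrite ltr_pwDl ?mulr_gt0 ?ts_pos_diag ?subr_ge0// sumr_ge0// => k _.
by rewrite mulr_ge0// (ts_ge0 hpt) ?subr_ge0 ?(ltW h0).
Qed.

(** Having positive transition probabilities at all positive times is a
transitive relation, by splitting the time interval in two. *)
Lemma ts_pos t i j : irreducible_Qmatrix Q -> 0 < t -> 0 < pt t i j.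
Proof.
move=> /(_ i j)/connectP[s + ->]; elim: s i t => /= [i t _ t0|k s IH i t].
  by rewrite ts_pos_diag// ltW.
move=> /andP[/andP[ik Qik] sp] t0.
have t2 : 0 < t / 2 by rewrite divr_gt0.
rewrite [t]splitr (ts_add hpt) ?(ltW t2)// (bigD1 k)//=.
apply: ltr_pwDl; first by rewrite mulr_gt0// ?IH//; exact: ts_pos_edge.
by apply: sumr_ge0 => l _; rewrite mulr_ge0// (ts_ge0 hpt)// ltW.
Qed.

End transition_semigroup.

(** A strictly positive stochastic matrix strictly contracts the l1 norm of
vectors of zero sum. *)
Lemma stationary_unique (R : realType) (N : nat)
    (p : 'I_N.+1 -> 'I_N.+1 -> R) (mu nu : 'I_N.+1 -> R) :
  (forall i j, 0 < p i j) -> (forall i, \sum_j p i j = 1) ->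
  \sum_i mu i = 1 -> \sum_i nu i = 1 ->
  (forall j, \sum_i mu i * p i j = mu j) ->
  (forall j, \sum_i nu i * p i j = nu j) -> mu =1 nu.
Proof.
move=> p0 p1 mu1 nu1 hmu hnu; pose d i := mu i - nu i.
have d0 : \sum_i d i = 0 by rewrite sumrB mu1 nu1 subrr.
have dp j : \sum_i d i * p i j = d j.
  by under eq_bigr do rewrite mulrBl; rewrite sumrB hmu hnu.
have [th th0 hth] : exists2 th, 0 < th & forall i j, th <= p i j.
  exists (\big[Num.min/1]_i \big[Num.min/1]_j p i j).
    elim/big_ind: _ => [//|x y x0 y0|i _]; first by rewrite lt_min x0.
    by elim/big_ind: _ => [//|x y x0 y0|//]; rewrite lt_min x0.
  by move=> i j; apply: le_trans (bigmin_le _ _ _) (bigmin_le _ _ _).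
have dle j : `|d j| <= \sum_i `|d i| * (p i j - th).
  have -> : d j = \sum_i d i * (p i j - th).
    under eq_bigr do rewrite mulrBr.
    by rewrite sumrB dp -mulr_suml d0 mul0r subr0.
  rewrite (le_trans (ler_norm_sum _ _ _))//; apply: ler_sum => i _.
  by rewrite normrM (ger0_norm (x := p i j - th)) ?subr_ge0.
pose D := \sum_i `|d i|.
have : D <= D * (1 - N.+1%:R * th).
  rewrite {1}/D; apply: (@le_trans _ _ (\sum_j \sum_i `|d i| * (p i j - th))).
    by apply: ler_sum => j _.
  rewrite exchange_big/= /D mulr_suml; apply: ler_sum => i _.
  by rewrite -mulr_sumr sumrB p1 sumr_const card_ord mulr_natl.
have Nth : 0 < N.+1%:R * th by rewrite mulr_gt0// ltr0n.
have D0 : 0 <= D by rewrite sumr_ge0.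
move=> h; have {h} D_eq0 : D = 0.
  apply/eqP; rewrite eq_le D0 andbT -(ler_pM2r Nth) mul0r; lra.
move=> i; apply/eqP; rewrite -subr_eq0 -/(d i) -normr_eq0; apply/eqP.
by have /psumr_eq0P := D_eq0; apply => // k _.
Qed.

(** * Decay of the mean weight over one step *)

Section contraction_rate.
Context {R : realType} {N : nat}.
Implicit Types f : 'I_N.+1 -> R.

Lemma le_maxI f i : f i <= maxI f.
Proof. exact: le_bigmax. Qed.

Lemma minI_le f i : minI f <= f i.
Proof. exact: bigmin_le. Qed.

Lemma minI_gt0 f : (forall i, 0 < f i) -> 0 < minI f.
Proof.
move=> f0; rewrite /minI; elim/big_ind: _ => // x y x0 y0.
by rewrite lt_min x0.
Qed.

Variables (Q : 'M[R]_N.+1) (beta : 'I_N.+1 -> R) (L p eta delta : R).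
Variable xi : 'cV[R]_N.+1.
Let q0 := maxI (fun i => - Q i i).
Let beta0 := maxI (fun i => `|beta i|).
Let kappa := maxI (fun i => xi i 0) * (minI (fun i => xi i 0))^-1.

Hypothesis hQ : is_conservative_Qmatrix Q.
Hypothesis hL : 0 < L.
Hypothesis hp : 0 < p.
Hypothesis hp1 : p < 1.
Hypothesis hxi : forall i, 0 < xi i 0.
Hypothesis heta : 0 < eta.
Hypothesis hQxi : Qp Q beta p *m xi = - eta *: xi.
Hypothesis hdelta0 : 0 < delta.
Hypothesis hdelta1 : delta < 1.
Hypothesis hdeltaL : delta < 1 / (16 * L ^+ 2).
Hypothesis hdeltaA : delta < (eta / alpha Q beta L p xi) `^ (2 / p).

Let q0_ge0 : 0 <= q0.
Proof.
apply: le_trans (le_maxI _ ord0); rewrite oppr_ge0.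
have [Q0 /(_ ord0)] := hQ; rewrite (bigD1 ord0)//= => /eqP.
rewrite addr_eq0 => /eqP ->; rewrite oppr_le0; apply: sumr_ge0 => j j0.
by rewrite Q0// eq_sym.
Qed.

Let beta0_ge i : `|beta i| <= beta0.
Proof. exact: (le_maxI (fun i => `|beta i|)). Qed.

Let beta0_ge0 : 0 <= beta0.
Proof. by rewrite (le_trans _ (beta0_ge ord0)). Qed.

Let kappa_ge0 : 0 <= kappa.
Proof.
rewrite mulr_ge0// ?invr_ge0; last by rewrite ltW// minI_gt0.
by rewrite (le_trans _ (le_maxI (fun i => xi i 0) ord0))// ltW.
Qed.

Let qk_ge0 : 0 <= q0 * kappa. Proof. exact: mulr_ge0. Qed.

Let xi_le i j : xi j 0 <= kappa * xi i 0.
Proof.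
rewrite (le_trans (le_maxI (fun i => xi i 0) j))// /kappa -mulrA ler_peMr//.
  by rewrite (le_trans _ (le_maxI (fun i => xi i 0) ord0))// ltW.
by rewrite ler_pdivlMl ?mulr1 ?minI_gt0// (minI_le (fun i => xi i 0)).
Qed.

Let Qxi j : \sum_k Q j k * xi k 0 = - (eta + p / 2 * beta j) * xi j 0.
Proof.
have := congr1 (fun A : 'cV[R]_N.+1 => A j 0) hQxi.
rewrite /Qp mulmxDl -scalemxAl mul_diag_mx !mxE => h.
by rewrite mulNr mulrDl -mulrA -[eta * _]opprK -mulNr -h; ring.
Qed.

(** Evaluating [Q xi] at a minimal entry of [xi], where it is nonnegative. *)
Let eta_le : eta <= p / 2 * beta0.
Proof.
pose i := [arg min_(i < ord0) xi i 0]%O.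
have imin j : xi i 0 <= xi j 0 by rewrite /i; case: arg_minP => // k _; exact.
have Qi0 : 0 <= \sum_k Q i k * xi k 0.
  have [Q0 Q1] := hQ.
  apply: (@le_trans _ _ ((\sum_k Q i k) * xi i 0)); first by rewrite Q1 mul0r.
  rewrite mulr_suml; apply: ler_sum => k _.
  by have [->//|ki] := eqVneq k i; rewrite ler_wpM2l// Q0// eq_sym.
have : eta + p / 2 * beta i <= 0.
  by rewrite -oppr_ge0 -(pmulr_lge0 _ (hxi i)) -Qxi.
have : p / 2 * - beta i <= p / 2 * beta0.
  by rewrite ler_pM2l ?divr_gt0// (le_trans _ (beta0_ge i))// -normrN ler_norm.
lra.
Qed.

(* The exponent [2 / p] is at least 1 and [delta < 1], so that the bound on
   [delta] implies the linear one. *)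
Let alpha_eta : alpha Q beta L p xi * delta < eta.
Proof.
move: hdeltaA; set A := alpha _ _ _ _ _ => hA.
have [A0|A0] := leP A 0; first by rewrite (le_lt_trans _ heta)// mulr_le0_ge0// ltW.
have p2 : 0 < p / 2 by rewrite divr_gt0.
rewrite mulrC -ltr_pdivlMr//.
apply: (@le_lt_trans _ _ (delta `^ (p / 2))).
  rewrite -[leLHS](powRr1 (ltW hdelta0)); apply: ger_powR.
    by rewrite hdelta0 ltW.
  by rewrite ler_pdivrMr// mul1r (le_trans (ltW hp1))// ler1n.
have eA : 0 <= eta / A by rewrite divr_ge0 ?ltW.
have -> : eta / A = ((eta / A) `^ (2 / p)) `^ (p / 2).
  rewrite -powRrM (_ : 2 / p * (p / 2) = 1) ?powRr1//.
  by field; rewrite gt_eqF.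
rewrite gt0_ltr_powR// nnegrE ?powR_ge0//; exact: ltW.
Qed.

Let alpha_ge1 : 4 * p * beta0 * q0 * kappa <= alpha Q beta L p xi.
Proof.
rewrite /alpha -/q0 -/beta0 -[q0 * _ * _]mulrA -/kappa.
have c4 : 4 <= 4 `^ ((2 + p) / 2) :> R.
  rewrite -{1}[4]powRr1//; apply: ler_powR; move: hp; lra.
have : 4 * (beta0 * (q0 * kappa)) <= 4 `^ ((2 + p) / 2) * beta0 * (4 `^ (p / 2) * L `^ p + q0 * kappa).
  rewrite -mulrA; apply: ler_pM => //; first exact: mulr_ge0.
  by rewrite ler_wpM2l// lerDr mulr_ge0 ?powR_ge0.
have : 0 <= beta0 + 4 * L ^+ 2 * (3 + 4 * beta0).
  by rewrite addr_ge0// mulr_ge0//; [exact/mulr_ge0/sqr_ge0|exact/addr_ge0/mulr_ge0].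
move=> h1 h2; have := lerD h1 h2; rewrite add0r -(ler_pM2l hp); lra.
Qed.

Let alpha_ge2 : 12 * p * L ^+ 2 <= alpha Q beta L p xi.
Proof.
rewrite /alpha -/q0 -/beta0 -[q0 * _ * _]mulrA -/kappa.
have : 0 <= 4 `^ ((2 + p) / 2) * beta0 * (4 `^ (p / 2) * L `^ p + q0 * kappa).
  apply: mulr_ge0; first by rewrite mulr_ge0 ?powR_ge0.
  by rewrite addr_ge0// mulr_ge0 ?powR_ge0.
have : 0 <= L ^+ 2 * beta0 by rewrite mulr_ge0 ?sqr_ge0.
move: beta0_ge0 => h0 h1 h2.
have -> : 12 * p * L ^+ 2 = p * (12 * L ^+ 2) by ring.
rewrite ler_pM2l//; lra.
Qed.

Variable pt : R -> 'I_N.+1 -> 'I_N.+1 -> R.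
Hypothesis hpt : transition_semigroup Q pt.

(** Over one step the mean of [xi] decreases at the rate [eta + (p / 2) beta i]
frozen at the initial state, up to an error of order [delta ^ 2] due to the
jumps of the chain before time [delta]. *)
Let mean_xi i : \sum_j pt delta i j * xi j 0
  <= xi i 0 * (1 - delta * (eta + p / 2 * beta i) + eta * delta / 2).
Proof.
pose M := p * beta0 * (kappa * xi i 0).
have M0 : 0 <= M.
  by apply: mulr_ge0; apply: mulr_ge0 => //; exact: ltW.
pose la j := (eta + p / 2 * beta j) * xi j 0.
have laM j : `|la j| <= M.
  rewrite normrM (ger0_norm (ltW (hxi j))) ler_pM ?(ltW (hxi j))//.
  rewrite (le_trans (ler_normD _ _))// (gtr0_norm heta) normrM.
  rewrite (gtr0_norm (x := p / 2)) ?divr_gt0//.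
  have : p / 2 * `|beta j| <= p / 2 * beta0 by rewrite ler_pM2l ?divr_gt0.
  move: eta_le; lra.
have drift t : 0 <= t -> t <= delta ->
    \sum_j pt t i j * (\sum_k Q j k * xi k 0) <= - la i + 2 * M * q0 * delta.
  move=> t0 tdelta.
  under eq_bigr do rewrite Qxi.
  have -> : \sum_j pt t i j * (- (eta + p / 2 * beta j) * xi j 0) =
      - la i + \sum_j pt t i j * (la i - la j).
    under [X in _ = _ + X]eq_bigr do rewrite mulrBr.
    rewrite sumrB -mulr_suml (ts_sum1 hpt)// mul1r addKr.
    by rewrite -sumrN; apply: eq_bigr => j _; rewrite mulNr mulrN.
  rewrite lerD2l (bigD1 i)//= subrr mulr0 add0r.
  apply: (@le_trans _ _ (\sum_(j | j != i) pt t i j * (2 * M))).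
    apply: ler_sum => j _; rewrite ler_wpM2l ?(ts_ge0 hpt)//.
    have := laM i; have := laM j; rewrite !ler_norml => /andP[? ?] /andP[? ?]; lra.
  rewrite -mulr_suml mulrC -[leRHS]mulrA; apply: ler_wpM2l; first exact: mulr_ge0.
  have -> : \sum_(j | j != i) pt t i j = 1 - pt t i i.
    have := ts_sum1 hpt i t0; rewrite (bigD1 i)//= => <-.
    by rewrite addrAC subrr add0r.
  have := ts_stay hpt (le_maxI (fun i => - Q i i) i) q0_ge0 t0.
  have : q0 * t <= q0 * delta by rewrite ler_wpM2l.
  rewrite -/q0; lra.
have := ts_drift hpt hdelta0 drift.
have : 2 * M * q0 * delta <= xi i 0 * (eta / 2).
  have -> : 2 * M * q0 * delta = xi i 0 * (4 * p * beta0 * q0 * kappa * delta / 2).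
    by rewrite /M; field.
  rewrite ler_pM2l// ler_pM2r// ltW// (le_lt_trans _ alpha_eta)//.
  by rewrite ler_pM2r.
rewrite -(ler_pM2l hdelta0) /la; lra.
Qed.

(** With [a = p beta_i delta / 2] and up to small errors, the two factors are
[1 + a] and [(1 - eta delta - a) xi_i]: the first order effects of [beta_i] cancel
and leave [1 - a ^ 2 - (1 + a) eta delta]. The bound on [delta] makes the errors
at most a fraction of [eta delta]. The lower bound on [beta_i], which dissipativity and
the Lipschitz condition impose as soon as there are two distinct points, keeps
the factor [1 + a] away from 0. *)
Lemma contraction_rate : exists2 rho, 0 < rho < 1 & forall i,
  - (2 * L) <= beta i ->
  (1 + p / 2 * (beta i * delta + L ^+ 2 * delta ^+ 2)) *
    \sum_j pt delta i j * xi j 0 <= rho * xi i 0.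
Proof.
have etad : 0 < eta * delta by rewrite mulr_gt0.
(* The value 1 / 2 only serves to keep the rate positive. *)
exists (Num.max (1 / 2) (1 - eta * delta / 4)).
  by rewrite lt_max gt_max; lra.
move=> i bL; pose a := p / 2 * beta i * delta.
pose e := p / 2 * (L ^+ 2 * delta ^+ 2).
have e0 : 0 <= e by rewrite !mulr_ge0 ?sqr_ge0// ltW.
have e1 : e <= eta * delta / 24.
  have : 12 * p * L ^+ 2 * delta <= eta.
    by rewrite ltW// (le_lt_trans _ alpha_eta)// ler_pM2r.
  rewrite -(ler_pM2r hdelta0) /e; lra.
have Ld : L * delta <= 1 / 4.
  have LL : 0 < 16 * L ^+ 2 by rewrite mulr_gt0// exprn_gt0.
  have h1 : L ^+ 2 * delta <= 1 / 16 by move: hdeltaL; rewrite ltr_pdivlMr//; lra.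
  have h2 : L ^+ 2 * delta * delta <= 1 / 16 * 1.
    by rewrite ler_pM ?mulr_ge0 ?sqr_ge0// ltW.
  rewrite -(@ler_pXn2r _ 2) ?nnegrE ?mulr_ge0 ?(ltW hL) ?(ltW hdelta0)//.
  rewrite exprMn; lra.
have a0 : - (1 / 4) <= a.
  have : p / 2 * delta * - (2 * L) <= p / 2 * delta * beta i.
    by rewrite ler_pM2l// mulr_gt0// divr_gt0.
  have : p * (L * delta) <= 1 * (L * delta).
    by rewrite ler_pM2r ?mulr_gt0// ltW.
  rewrite /a; lra.
have -> : 1 + p / 2 * (beta i * delta + L ^+ 2 * delta ^+ 2) = 1 + a + e.
  by rewrite /a /e; ring.
apply: (@le_trans _ _ ((1 + a + e) * (xi i 0 * (1 - eta * delta - a + eta * delta / 2)))).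
  rewrite ler_wpM2l//; first lra.
  apply: le_trans (mean_xi i) _; rewrite ler_pM2l// /a; lra.
rewrite mulrCA mulrC ler_pM2r// le_max; apply/orP; right.
have ea : e * (1 - a) <= e * (5 / 4) by rewrite ler_wpM2l//; lra.
have ed : eta * delta * (3 / 4) <= eta * delta * (1 + a + e).
  by rewrite ler_pM2l//; lra.
have := sqr_ge0 a; lra.
Qed.

End contraction_rate.

(** * Discrete Markov chains on the unit interval *)

Section markov_chain_on_unit_interval.
Context {R : realType} {N : nat}.
Variables (mu : 'I_N.+1 -> R) (q : 'I_N.+1 -> 'I_N.+1 -> R).
Hypothesis mu_ge0 : forall i, 0 <= mu i.
Hypothesis mu_sum1 : \sum_i mu i = 1.
Hypothesis q_ge0 : forall i j, 0 <= q i j.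
Hypothesis q_sum1 : forall i, \sum_j q i j = 1.
Let S := 'I_N.+1.
Implicit Types (w t : seq S) (u : R).

(* Words list the visited states with the most recent one first. *)
Let next t (a : S) : R := if t is b :: _ then q b a else mu a.

Fixpoint word_prob w : R :=
  if w is a :: t then word_prob t * next t a else 1.

Let endpoint lo t (k : nat) : R :=
  lo + \sum_(b < N.+1 | (b < k)%N) word_prob (b :: t).

Fixpoint word_left w : R :=
  if w is a :: t then endpoint (word_left t) t a else 0.

Let cell w := `[word_left w, word_left w + word_prob w[%classic : set R.

Let next_ge0 t a : 0 <= next t a.
Proof. by case: t => [|b t] /=. Qed.

Let next_sum1 t : \sum_a next t a = 1.
Proof. by case: t => [|b t] /=. Qed.

Let word_prob_ge0 w : 0 <= word_prob w.
Proof. by elim: w => //= a t IH; rewrite mulr_ge0. Qed.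

(* The indicator function of a cell, in a form whose sum over the most recent
   state telescopes. *)
Let ind w u : R := (word_left w <= u)%R%:R - (word_left w + word_prob w <= u)%R%:R.

Let indE w u : ind w u = (u \in cell w)%:R.
Proof.
rewrite /ind mem_setE /cell in_itv/= [u < _]ltNge.
have [h|h] := leP (word_left w + word_prob w) u.
  by rewrite (le_trans _ h) ?lerDl// subrr.
by rewrite subr0 andbT.
Qed.

Let ind_sum t u : \sum_a ind (a :: t) u = ind t u.
Proof.
pose e k : R := (endpoint (word_left t) t k <= u)%R%:R.
rewrite (eq_bigr (fun a : S => e a - e a.+1)); last first.
  move=> a _; rewrite /ind /e /=; congr (_ - (_ <= _)%R%:R).
  rewrite /endpoint -addrA; congr (_ + _).
  rewrite [RHS](bigD1 a)//= addrC; congr (_ + _).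
  by apply: eq_bigl => b; rewrite ltnS ltn_neqAle andbC.
transitivity (\sum_(0 <= k < N.+1) (e k - e k.+1)); first by rewrite big_mkord.
rewrite (eq_bigr (fun k => - e k.+1 - - e k)); last first.
  by move=> k _; rewrite opprK addrC.
rewrite telescope_sumr// opprK addrC /e /ind /endpoint.
have -> : \sum_(b < N.+1 | (b < 0)%N) word_prob (b :: t) = 0 by rewrite big1.
have -> : \sum_(b < N.+1 | (b < N.+1)%N) word_prob (b :: t) = word_prob t.
  rewrite (eq_bigl predT) => [|b]; last by rewrite ltn_ord.
  by rewrite -mulr_sumr next_sum1 mulr1.
by rewrite addr0.
Qed.

Let cell_ex t u : u \in cell t -> exists a, u \in cell (a :: t).
Proof.
move=> ut; apply: contrapT => h; have := ind_sum t u.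
rewrite [ind t u]indE ut big1 => [/eqP|a _].
  by rewrite eq_sym oner_eq0.
by rewrite indE; case: (boolP (_ \in _)) => // ha; case: h; exists a.
Qed.

Let cell_tail a t u : u \in cell (a :: t) -> u \in cell t.
Proof.
move=> ua; have := ind_sum t u; rewrite (bigD1 a)//= !indE ua.
case: (_ \in cell t) => // /eqP; rewrite paddr_eq0// ?oner_eq0//.
by apply: sumr_ge0 => b _; rewrite indE.
Qed.

Let cell_inj a b t u : u \in cell (a :: t) -> u \in cell (b :: t) -> a = b.
Proof.
move=> ua ub; apply/eqP/negPn/negP => ab; have := ind_sum t u.
rewrite (bigD1 a)//= (bigD1 b) 1?eq_sym//= !indE ua ub (cell_tail ua) /= mulr1n.
have : 0 <= \sum_(i | (i != a) && (i != b)) ind (i :: t) u.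
  by apply: sumr_ge0 => i _; rewrite indE.
lra.
Qed.

Let word := fix word (k : nat) u : seq S := if k is k'.+1 then
  odflt ord0 [pick a | u \in cell (a :: word k' u)] :: word k' u else [::].

Let word_cell k u : u \in `[0, 1[%classic -> u \in cell (word k u).
Proof.
move=> u01; elim: k => [|k IH] /=.
  by move: u01; rewrite !mem_setE /cell /= add0r.
by case: pickP => //= h; have [a ua] := cell_ex IH; have := h a; rewrite /= ua.
Qed.

Let cellE w u : u \in cell w <-> u \in `[0, 1[%classic /\ word (size w) u = w.
Proof.
split; last by case=> h e; rewrite -e; exact: word_cell.
elim: w => [|a t IH] ua /=.
  by split=> //; move: ua; rewrite !mem_setE /cell /= add0r.
have [u01 ->] := IH (cell_tail ua); split => //; congr (_ :: _).
by case: pickP => [b ub|/(_ a)/=]; [exact: cell_inj ub ua|rewrite ua].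
Qed.

Let P : probability (measurableTypeR R) R := uniform_prob (@ltr01 R).

Let P_sub01 (A : set R) : measurable A -> A `<=` `[0, 1]%classic ->
  P A = lebesgue_measure A.
Proof.
move=> mA A01; rewrite /P/= /uniform_prob integral_uniform_pdf setIidl//.
rewrite (eq_integral (fun=> 1%E)) ?integral_cst ?mul1e// => x.
by rewrite inE => /A01; rewrite /= in_itv/= /uniform_pdf => ->; rewrite subr0 invr1.
Qed.

Let cell01 w : cell w `<=` `[0, 1[%classic.
Proof. by move=> u /mem_set/cellE[/set_mem]. Qed.

Let P_cell w : P (cell w) = (word_prob w)%:E.
Proof.
rewrite P_sub01; last 2 first.
- exact: measurable_itv.
- by move=> u /cell01; rewrite /= !in_itv/= => /andP[-> /ltW].
rewrite /cell lebesgue_measure_itv/= lte_fin ltrDl.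
case: ltP => h; first by rewrite -EFinB addrAC subrr add0r.
by congr EFin; apply/eqP; rewrite eq_le h word_prob_ge0.
Qed.

Let P01C : P (~` `[0, 1[%classic) = 0%E.
Proof.
rewrite probability_setC; last exact: measurable_itv.
have := P_cell [::]; rewrite /cell /= add0r => ->.
by rewrite subee.
Qed.

Let state (k : nat) (u : measurableTypeR R) : stateT N :=
  if u \in `[0, 1[%classic then head ord0 (word k.+1 u) else ord0.

Let m01 : measurable (`[0, 1[%classic : set R).
Proof. exact: measurable_itv. Qed.

Let measurable_state k : measurable_fun setT (state k).
Proof.
move=> _ Y _; rewrite setTI.
rewrite [X in measurable X](_ : _ =
  (\bigcup_(w in [set w | size w = k.+1 /\ Y (head ord0 w)]) cell w) `|`
  (if ord0 \in Y then ~` `[0, 1[%classic else set0)).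
  apply: measurableU; last by case: ifP => // _; exact: measurableC.
  rewrite bigcup_mkcond; apply: countable_bigcupT_measurable => // w.
  by case: ifP => // _; exact: measurable_itv.
apply/seteqP; split => u /=; rewrite /state.
  case: ifPn => u01 Yu.
    left; exists (word k.+1 u); last by apply: set_mem; exact: word_cell.
    by split => //; elim: {Yu} k => //= k ->.
  right; move: Yu => /mem_set ->; move: u01; rewrite notin_setE; exact.
case=> [[w [sw Yw] /mem_set/cellE[u01]]|].
  by rewrite u01 sw => ->.
case: ifP => // /set_mem Y0 /= hu; rewrite ifN// notin_setE; exact.
Qed.

Let path_word (v : nat -> S) := fix path_word (k : nat) : seq S :=
  if k is k'.+1 then v k' :: path_word k' else [::].

Let path_word_prob v k : word_prob (path_word v k.+1) =
  mu (v 0) * \prod_(l < k) q (v l) (v l.+1).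
Proof.
elim: k => [|k IH]; first by rewrite /= mul1r big_ord0 mulr1.
by rewrite big_ord_recr mulrA -IH /=.
Qed.

Let path_event v k u : u \in `[0, 1[%classic ->
  (forall l, (l < k)%N -> state l u = v l) <-> word k u = path_word v k.
Proof.
move=> u01; elim: k => [|k IH]; first by split.
split => [h|/= [h1 /IH h2] l].
  have /IH wk : forall l, (l < k)%N -> state l u = v l.
    by move=> l lk; apply: h; exact: leqW.
  rewrite /= wk; congr (_ :: _); have := h _ (leqnn _).
  by rewrite /state u01 /= wk.
by rewrite ltnS leq_eqVlt => /predU1P[->|/h2//]; rewrite /state u01.
Qed.

Let size_path_word v k : size (path_word v k) = k.
Proof. by elim: k => //= k ->. Qed.

(** A Markov chain with prescribed initial law and transition matrix lives on
the unit interval: the points whose first states spell a given word form a cell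
of a nested family of partitions into intervals, and the length of each cell is
the probability of its word. *)
Lemma markov_chain_existence : exists (P : probability (measurableTypeR R) R)
    (s : nat -> measurableTypeR R -> stateT N),
  (forall k, measurable_fun setT (s k)) /\
  forall (v : nat -> 'I_N.+1) k,
    P [set u | forall l, (l <= k)%N -> s l u = v l] =
    (mu (v 0) * \prod_(l < k) q (v l) (v l.+1))%:E.
Proof.
exists P, state; split => // v k.
set E := [set u | _].
have mE : measurable E.
  rewrite [X in measurable X](_ : _ =
      \bigcap_(l in [set l | (l < k.+1)%N]) (state l @^-1` [set v l])).
    apply: bigcap_measurable; first by exists 0%N.
    move=> l _; rewrite -[X in measurable X]setTI; exact: measurable_state.
  by apply/seteqP; split => u h l; exact: h.
have EC : E `&` `[0, 1[%classic = cell (path_word v k.+1).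
  apply/seteqP; split => [u [Eu u01]|u uc].
    apply: set_mem; apply/cellE; split; first exact: mem_set.
    by rewrite size_path_word; apply/(path_event _ _ (mem_set u01)) => l; exact: Eu.
  have /mem_set/cellE[u01 e] := uc; split; last exact: set_mem.
  by rewrite size_path_word in e; have /path_event h := e => l; exact: h.
rewrite -path_word_prob -P_cell -EC (measureDI _ mE m01).
rewrite (subset_measure0 _ _ _ P01C) ?add0e//.
  exact: measurableD.
exact: measurableC.
Qed.

End markov_chain_on_unit_interval.

(** * Borel sets of a Euclidean space *)

Section borel_vectors.
Context {R : realType}.

Lemma measurable_open n (U : set 'cV[R]_n) :
  open U -> measurable (U : set (borelV R n)).
Proof. by move=> oU; exact: sub_sigma_algebra. Qed.

Lemma rat_ball_basis n (U : set 'cV[R]_n) : open U ->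
  U = \bigcup_(qr in [set qr : 'cV[rat]_n * rat |
        ball (map_mx ratr qr.1 : 'cV[R]_n) (ratr qr.2 : R) `<=` U])
      ball (map_mx ratr qr.1 : 'cV[R]_n) (ratr qr.2 : R).
Proof.
move=> oU; apply/seteqP; split => [x Ux|x [qr /= h /h]//].
have /nbhs_ballP[e /= e0 heU] : nbhs x U by exact: open_nbhs_nbhs.
have e2 : 0 < e / 2 by rewrite divr_gt0.
have [r re] : exists r : rat, (0 : R) < ratr r < e / 2.
  by have [r] := rat_in_itvoo e2; rewrite in_itv/=; exists r.
have /andP[r0 re2] := re.
have qex (k : 'I_n) : exists q : rat, x k 0 - ratr r < ratr q < x k 0 + ratr r.
  have : x k 0 - ratr r < x k 0 + ratr r by rewrite ltrBlDr -addrA ltrDl addr_gt0.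
  by move=> /rat_in_itvoo[q]; rewrite in_itv/=; exists q.
have [q hq] := choice qex.
exists (\col_k q k, r) => /=.
  move=> y [_ hy]; apply: heU; split => // i j; rewrite (ord1 j).
  have := hy i 0; have := hq i; rewrite /ball/= !mxE => /andP[h1 h2].
  rewrite !ltr_norml => /andP[h3 h4]; apply/andP; split; lra.
split => // i j; rewrite (ord1 j) /ball/= !mxE.
have /andP[h1 h2] := hq i; rewrite ltr_norml; apply/andP; split; lra.
Qed.

Lemma measurable_coord n (k : 'I_n) :
  measurable_fun setT (fun x : borelV R n => (x : 'cV[R]_n) k 0).
Proof.
apply: (measurability _ (RGenOInfty.measurableE R)) => //.
move=> _ [_ [a ->] <-]; rewrite setTI; apply: measurable_open.
have /continuousP := @coord_continuous R n 1 k 0; apply.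
by rewrite set_itvoy; exact: open_gt.
Qed.

(** The Borel sets of [R^n] are generated by the coordinates, because [R^n] has
a countable base of rational balls, which for the sup norm are boxes. *)
Lemma measurable_borelV d (T : measurableType d) n (f : T -> borelV R n) :
  (forall k, measurable_fun setT (fun x => (f x : 'cV[R]_n) k 0)) ->
  measurable_fun setT f.
Proof.
move=> mf; apply: (@measurability _ _ _ (borelV R n) _ _ (@open 'cV[R]_n)) => // _ [U oU <-].
rewrite setTI (rat_ball_basis oU) preimage_bigcup.
rewrite bigcup_mkcond; apply: countable_bigcupT_measurable => // qr.
case: ifPn => // _.
have [r0|r0] := boolP (0 < ratr qr.2 :> R); last first.
  rewrite [X in measurable X](_ : _ = set0)//; apply/seteqP; split => // x [].
  by rewrite (negbTE r0).
rewrite [X in measurable X](_ : _ = \bigcap_(k in [set: 'I_n])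
    ((fun x => (f x : 'cV[R]_n) k 0) @^-1` ball (ratr (qr.1 k 0) : R) (ratr qr.2 : R))).
  apply: fin_bigcap_measurable => // k _; rewrite -[X in measurable X]setTI.
  by apply: mf => //; exact: measurable_ball.
apply/seteqP; split => [x [_ h] k _|x h]; first by have := h k 0; rewrite mxE.
by split => // i j; rewrite (ord1 j) mxE; exact: h.
Qed.

Lemma continuous_measurable_borelV n m (f : 'cV[R]_n -> 'cV[R]_m) :
  continuous f -> measurable_fun setT (f : borelV R n -> borelV R m).
Proof.
move=> cf; apply: (@measurability _ _ _ (borelV R m) _ _ (@open 'cV[R]_m)) => // _ [U oU <-].
by rewrite setTI; apply: measurable_open; move/continuousP : cf; exact.
Qed.

Lemma continuous_measurable_real n (f : 'cV[R]_n -> R) :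
  continuous f -> measurable_fun setT (f : borelV R n -> R).
Proof.
move=> cf; apply: (measurability _ (RGenOInfty.measurableE R)) => //.
move=> _ [_ [a ->] <-]; rewrite setTI; apply: measurable_open.
by move/continuousP : cf; apply; rewrite set_itvoy; exact: open_gt.
Qed.

(** The second factor is finite and discrete, so that measurability can be
checked on each slice. *)
Lemma measurable_slices d d' (T : measurableType d) (T' : measurableType d') N
    (f : T -> stateT N -> T') :
  (forall i, measurable_fun setT (f ^~ i)) ->
  measurable_fun setT (fun z : T * stateT N => f z.1 z.2).
Proof.
move=> mf _ Y mY; rewrite setTI.
rewrite [X in measurable X](_ : _ = \bigcup_(i in [set: 'I_N.+1])
    ((f ^~ i @^-1` Y) `*` [set i])).
  apply: fin_bigcup_measurable => // i _; apply: measurableX => //.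
  by rewrite -[X in measurable X]setTI; exact: mf.
apply/seteqP; split => [[x i] /= h|[x i] [j _ [/= h ->]]//].
by exists i => //.
Qed.

End borel_vectors.

(** * Laws of random variables and independence *)

Section laws.
Context {R : realType}.

Definition law d d' (T : measurableType d) (T' : measurableType d')
    (P : probability T R) (f : T -> T') (mf : measurable_fun setT f) :
    probability T' R :=
  distribution P (mfun_Sub (mem_set mf)).

Lemma integral_law d d' (T : measurableType d) (T' : measurableType d')
    (P : probability T R) (f : T -> T') (mf : measurable_fun setT f)
    (h : T' -> \bar R) :
  measurable_fun setT h -> (forall y, 0 <= h y)%E ->
  (\int[law P mf]_y h y = \int[P]_x h (f x))%E.
Proof. by move=> mh h0; rewrite /law ge0_integral_distribution. Qed.

(** Independence of two maps makes their joint law a product measure; Tonelli's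
theorem then lets one of them be integrated with the other one frozen. *)
Lemma integral_independent d d1 d2 (T : measurableType d)
    (T1 : measurableType d1) (T2 : measurableType d2) (P : probability T R)
    (X : T -> T1) (Y : T -> T2)
    (mX : measurable_fun setT X) (mY : measurable_fun setT Y)
    (phi : T1 * T2 -> \bar R) :
  (forall A B, measurable A -> measurable B ->
    P (X @^-1` A `&` Y @^-1` B) = P (X @^-1` A) * P (Y @^-1` B))%E ->
  measurable_fun setT phi -> (forall z, 0 <= phi z)%E ->
  (\int[P]_w phi (X w, Y w) = \int[P]_w \int[P]_w' phi (X w, Y w'))%E /\
  (\int[P]_w phi (X w, Y w) = \int[P]_w' \int[P]_w phi (X w, Y w'))%E.
Proof.
move=> indep mphi phi0.
have mXY : measurable_fun setT (fun w => (X w, Y w)) by exact: measurable_fun_pair.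
have -> : (\int[P]_w phi (X w, Y w) =
    \int[(law P mX \x law P mY)%E]_z phi z)%E.
  rewrite -(integral_law P mXY)//; apply: eq_measure_integral => A mA _.
  apply/esym; apply: (product_measure_unique (m' := law P mXY)) => //.
split.
  rewrite fubini_tonelli1// integral_law//.
  - apply: eq_integral => w _; rewrite /fubini_F integral_law//.
    by apply: measurableT_comp => //; exact: pair1_measurable.
  - exact: measurable_fun_fubini_tonelli_F.
  - by move=> x; exact: integral_ge0.
rewrite fubini_tonelli2// integral_law//.
- apply: eq_integral => w _; rewrite /fubini_G integral_law//.
  by apply: measurableT_comp => //; exact: pair2_measurable.
- exact: measurable_fun_fubini_tonelli_G.
- by move=> x; exact: integral_ge0.
Qed.

Lemma integral_partition d (T : measurableType d) (I : finType)
    (P : {measure set T -> \bar R}) (X : T -> I) (f : T -> \bar R) :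
  (forall v, measurable (X @^-1` [set v])) ->
  measurable_fun setT f -> (forall x, 0 <= f x)%E ->
  (\int[P]_x f x = \sum_v \int[P]_(x in X @^-1` [set v]) f x)%E.
Proof.
move=> mX mf f0.
have UX : \big[setU/set0]_(v <- index_enum I) (X @^-1` [set v]) = setT.
  rewrite -bigcup_seq; apply/seteqP; split => // x _; exists (X x) => //=.
  exact: mem_index_enum.
rewrite -UX ge0_integral_bigsetU//.
- exact: index_enum_uniq.
- apply/trivIsetP => i j _ _ ij; rewrite -preimage_setI set1I.
  by case: ifPn => [/set_mem ji|_]; [rewrite ji eqxx in ij|rewrite preimage_set0].
- by rewrite UX.
Qed.
End laws.

(** * First moment of the normal law *)

Section normal_moment.
Context {R : realType}.
Notation leb := (@lebesgue_measure R).

(** The density of [N(0, s^2)] is at most [C exp(- |x|)] times the density of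
[N(0, (2 s)^2)]: in the exponent, [|x| <= 3 x^2 / (8 s^2) + s^2]. *)
Lemma normal_pdf_exp_decay (s : R) : s != 0 -> exists2 C : R, 0 <= C & forall x,
  normal_pdf 0 s x <= C * expR (- `|x|) * normal_pdf 0 (2 * s) x.
Proof.
move=> s0; have s20 : 2 * s != 0 by rewrite mulf_neq0.
have p0 := normal_peak_gt0 s20.
exists (expR (s ^+ 2) * (normal_peak s / normal_peak (2 * s))).
  by rewrite mulr_ge0 ?expR_ge0 ?divr_ge0 ?normal_peak_ge0.
move=> x; rewrite !normal_pdfE// /normal_fun !subr0.
have -> : expR (s ^+ 2) * (normal_peak s / normal_peak (2 * s)) * expR (- `|x|) *
   (normal_peak (2 * s) * expR (- x ^+ 2 / ((2 * s) ^+ 2 *+ 2))) =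
   normal_peak s * (expR (s ^+ 2) * expR (- `|x|) * expR (- x ^+ 2 / ((2 * s) ^+ 2 *+ 2))).
  by field; rewrite gt_eqF.
rewrite ler_wpM2l ?normal_peak_ge0// -!expRD ler_expR.
have s2 : 0 < s ^+ 2 by rewrite exprn_even_gt0.
set y := `|x|; have -> : x ^+ 2 = y ^+ 2 by rewrite -real_normK// num_real.
have -> : - y ^+ 2 / (s ^+ 2 *+ 2) = - (y ^+ 2 / s ^+ 2) / 2.
  by field; rewrite ?s0.
have -> : - y ^+ 2 / ((2 * s) ^+ 2 *+ 2) = - (y ^+ 2 / s ^+ 2) / 8.
  by field; rewrite ?s0.
have : 0 <= (y / s - 4 / 3 * s) ^+ 2 by rewrite sqr_ge0.
have -> : (y / s - 4 / 3 * s) ^+ 2 = y ^+ 2 / s ^+ 2 - 8 / 3 * y + 16 / 9 * s ^+ 2.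
  by field; rewrite ?s0.
lra.
Qed.

Lemma normal_tail (s : R) : s != 0 -> exists2 C : R, 0 <= C & forall r,
  (normal_prob 0 s [set x | (r < `|x|)%R] <= (C * expR (- r))%:E)%E.
Proof.
move=> s0; have [C C0 hC] := normal_pdf_exp_decay s0; exists C => // r.
have mA : measurable [set x : R | r < `|x|].
  rewrite -[X in measurable X]setTI.
  rewrite (_ : [set x : R | r < `|x|] = Num.norm @^-1` `]r, +oo[); last by rewrite set_itvoy.
  exact: (@normr_measurable R setT measurableT).
have Cr0 : 0 <= C * expR (- r) by rewrite mulr_ge0 ?expR_ge0.
apply: (@le_trans _ _ (\int[leb]_(x in [set x | (r < `|x|)%R])
   ((C * expR (- r))%:E * (normal_pdf 0 (2 * s) x)%:E))%E).
  apply: ge0_le_integral => //.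
  - by move=> x _; rewrite lee_fin normal_pdf_ge0.
  - by apply/measurable_EFinP/measurable_funTS; exact: measurable_normal_pdf.
  - by apply/measurable_EFinP/measurable_funM => //; apply/measurable_funTS;
      exact: measurable_normal_pdf.
  - move=> x /= rx; rewrite -EFinM lee_fin (le_trans (hC x))//.
    rewrite ler_wpM2r ?normal_pdf_ge0// ler_wpM2l// ler_expR lerN2; exact: ltW.
rewrite ge0_integralZl//; last 2 first.
- by apply/measurable_EFinP/measurable_funTS; exact: measurable_normal_pdf.
- by move=> x _; rewrite lee_fin normal_pdf_ge0.
rewrite -[leRHS]mule1 lee_wpmul2l// -/(normal_prob 0 (2 * s) _).
exact: probability_le1.
Qed.

(** The first moment is the integral of the tail, which decays exponentially. *)
Lemma normal_abs_moment d (T : measurableType d) (P : probability T R)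
    (X : T -> R) (s : R) : s != 0 -> measurable_fun setT X ->
  (forall B, measurable B -> P (X @^-1` B) = normal_prob 0 s B) ->
  (\int[P]_w (`|X w|)%:E < +oo)%E.
Proof.
move=> s0 mX XE; have [C C0 hC] := normal_tail s0.
have maX : measurable_fun setT (fun w => `|X w|) by exact: measurableT_comp.
have := @ge0_expectation_ccdf _ _ _ P (mfun_Sub (mem_set maX)).
rewrite expectation_def /= => -> //.
apply: (@le_lt_trans _ _ C%:E); last by rewrite ltry.
apply: (@le_trans _ _ (\int[leb]_(r in `[0%R, +oo[) (C%:E * (exponential_pdf 1 r)%:E))%E).
  apply: ge0_le_integral => //.
  - by apply: measurable_funTS; exact: ccdf_measurable.
  - by apply: measurable_funTS; apply/measurable_EFinP/measurable_funM => //;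
      exact: measurable_exponential_pdf.
  - move=> r /=; rewrite in_itv/= andbT => r0.
    rewrite exponential_pdfE// -EFinM mul1r mulN1r.
    apply: le_trans (hC r); rewrite -XE.
      by rewrite /ccdf /distribution /pushforward /= set_itvoy.
    rewrite -[X in measurable X]setTI.
    rewrite (_ : [set x : R | r < `|x|] = Num.norm @^-1` `]r, +oo[); last by rewrite set_itvoy.
    exact: (@normr_measurable R setT measurableT).
rewrite ge0_integralZl//; last 2 first.
- by apply/measurable_funTS/measurable_EFinP; exact: measurable_exponential_pdf.
- by move=> r _; rewrite lee_fin exponential_pdf_ge0.
rewrite -[leRHS]mule1 lee_wpmul2l// -(integral_exponential_pdf (@ltr01 R)).
apply: ge0_subset_integral => //.
  by apply/measurable_EFinP; exact: measurable_exponential_pdf.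
by move=> r _; rewrite lee_fin exponential_pdf_ge0.
Qed.

End normal_moment.

(** * Increments of Brownian motion *)

(** The sample space with the coarser sigma-algebra generated by the process at
the times in [I]; it turns adaptedness into plain measurability. *)
Definition past {R : realType} {d : measure_display} {Omega : measurableType d}
    {d'} {T : measurableType d'} (X : R -> Omega -> T) (I : set R) :=
  g_sigma_algebraType
    [set A | exists t, I t /\ exists B, measurable B /\ A = X t @^-1` B].

Section brownian_increments.
Context {R : realType} {d : measure_display} {Omega : measurableType d}.
Variables (P : probability Omega R) (m : nat) (W : R -> Omega -> borelV R m).
Hypothesis hW : is_brownian_motion P W.

Lemma measurable_past_value (I : set R) t : I t ->
  measurable_fun setT (W t : past W I -> borelV R m).
Proof.
move=> It _ B mB; rewrite setTI; apply: sub_sigma_algebra.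
by exists t; split => //; exists B.
Qed.

Lemma measurable_past_increment (I : set R) s t : I s -> I t ->
  measurable_fun setT (increment W s t : past W I -> borelV R m).
Proof.
move=> Is It; apply: measurable_borelV => k.
rewrite (_ : (fun _ => _) = fun w : past W I =>
  (W t w : 'cV[R]_m) k 0 - (W s w : 'cV[R]_m) k 0); last first.
  by apply/funext => w; rewrite /increment !mxE.
by apply: measurable_funB; apply: (measurableT_comp (measurable_coord k));
  exact: measurable_past_value.
Qed.

Lemma measurable_into_past (I : set R) : (forall t, I t -> 0 <= t) ->
  measurable_fun setT (id : Omega -> past W I).
Proof.
move=> I0; apply: (@measurability _ _ _ (past W I) _ _ [set A |
  exists t, I t /\ exists B, measurable B /\ A = W t @^-1` B]) => //.
move=> _ [_ [t [It [B [mB ->]]]] <-].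
by have := bm_measurable hW (I0 t It); apply.
Qed.

Lemma measurable_past_sub (I J : set R) d' (T : measurableType d') (f : Omega -> T) :
  I `<=` J -> measurable_fun setT (f : past W I -> T) ->
  measurable_fun setT (f : past W J -> T).
Proof.
move=> IJ mf; apply: (@measurableT_comp _ _ _ (past W J) (past W I) _ f setT id) => //.
apply: (@measurability _ _ _ (past W I) _ _ [set A |
  exists t, I t /\ exists B, measurable B /\ A = W t @^-1` B]) => //.
move=> _ [_ [t [It [B [mB ->]]]] <-]; rewrite setTI preimage_id.
by apply: sub_sigma_algebra; exists t; split; [exact: IJ|exists B].
Qed.

Lemma measurable_increment s t : 0 <= s -> 0 <= t ->
  measurable_fun setT (increment W s t : Omega -> borelV R m).
Proof.
move=> s0 t0; have h := @measurable_past_increment `[0, +oo[%classic s t.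
apply: (measurableT_comp (h _ _)); rewrite /= ?in_itv/= ?s0 ?t0//.
by apply: measurable_into_past => r /=; rewrite in_itv/= andbT.
Qed.

Let boxes : set (set (borelV R m)) := [set A | exists B : 'I_m -> set R,
  (forall l, measurable (B l)) /\
  A = [set x | forall l, B l ((x : 'cV[R]_m) l 0)]].

Let boxes_measurable : boxes `<=` measurable.
Proof.
move=> _ [B [mB ->]].
rewrite (_ : [set x : borelV R m | forall l : 'I_m, B l ((x : 'cV[R]_m) l 0)] =
  \bigcap_(l in [set: 'I_m]) ((fun x : borelV R m => (x : 'cV[R]_m) l 0) @^-1` B l)).
  apply: fin_bigcap_measurable => // l _; rewrite -[X in measurable X]setTI.
  exact: measurable_coord.
by apply/seteqP; split => x h l; [move=> _; exact: h|exact: h].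
Qed.

Let boxes_generate (A : set (borelV R m)) : measurable A -> <<s boxes >> A.
Proof.
move=> mA; have : measurable_fun setT (id : g_sigma_algebraType boxes -> borelV R m).
  apply: measurable_borelV => l _ Y mY; rewrite setTI; apply: sub_sigma_algebra.
  exists (fun l' => if l' == l then Y else setT); split => [l'|].
    by case: ifP.
  apply/seteqP; split => x /=; first by move=> Yx l'; case: eqP => // ->.
  by move=> /(_ l); rewrite eqxx.
by move=> /(_ measurableT _ mA); rewrite setTI.
Qed.

Let increment_law s t (s0 : 0 <= s) (t0 : 0 <= t) :=
  law P (measurable_increment s0 t0).

(** Boxes form a pi-system generating the Borel sets, and the probability that
an increment lies in a box depends only on the length of the time interval. *)
Lemma increment_stationary s t s' t' : 0 <= s -> s < t -> 0 <= s' -> s' < t' ->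
  t - s = t' - s' -> forall A : set (borelV R m), measurable A ->
  P (increment W s t @^-1` A) = P (increment W s' t' @^-1` A).
Proof.
move=> s0 st s0' st' e A mA.
have t0 : 0 <= t by rewrite (le_trans s0)// ltW.
have t0' : 0 <= t' by rewrite (le_trans s0')// ltW.
have setTB : boxes setT by exists (fun=> setT); split => //; apply/seteqP; split.
have := @g_sigma_algebra_measure_unique _ R _ boxes boxes_measurable (fun=> setT)
  (fun=> setTB) _ (increment_law s0 t0) (increment_law s0' t0') _ _ _ A.
apply; rewrite ?bigcup_const//.
- move=> _ _ [B1 [mB1 ->]] [B2 [mB2 ->]].
  exists (fun l => B1 l `&` B2 l); split; first by move=> l; exact: measurableI.
  apply/seteqP; split => x /=; first by move=> [h1 h2] l.
  by move=> h; split => l; have [] := h l.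
- move=> _ [B [mB ->]].
  have := bm_gaussian hW s0 st mB; rewrite e -(bm_gaussian hW s0' st' mB).
  exact.
- move=> k; apply: (@le_lt_trans _ _ 1%E); last by rewrite ltry.
  by have := probability_le1 (increment_law s0 t0) measurableT; apply.
- exact: boxes_generate mA.
Qed.

Lemma integral_increment s t s' t' (h : borelV R m -> \bar R) :
  0 <= s -> s < t -> 0 <= s' -> s' < t' -> t - s = t' - s' ->
  measurable_fun setT h -> (forall x, 0 <= h x)%E ->
  (\int[P]_w h (increment W s t w) = \int[P]_w h (increment W s' t' w))%E.
Proof.
move=> s0 st s0' st' e mh h0.
have t0 : 0 <= t by rewrite (le_trans s0)// ltW.
have t0' : 0 <= t' by rewrite (le_trans s0')// ltW.
rewrite -(integral_law P (measurable_increment s0 t0))//.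
rewrite -(integral_law P (measurable_increment s0' t0'))//.
apply: eq_measure_integral => A mA _; exact: increment_stationary.
Qed.

(** The increment over [[s, t]] is independent of the past of [s], and can be
replaced by an independent copy of any increment of the same length. *)
Lemma integral_past_increment s t s' t' (phi : past W `[0, s] * borelV R m -> \bar R) :
  0 <= s -> s < t -> 0 <= s' -> s' < t' -> t - s = t' - s' ->
  measurable_fun setT phi -> (forall z, 0 <= phi z)%E ->
  (\int[P]_w phi (w, increment W s t w) =
   \int[P]_w \int[P]_w' phi (w, increment W s' t' w'))%E /\
  (\int[P]_w phi (w, increment W s t w) =
   \int[P]_w' \int[P]_w phi (w, increment W s' t' w'))%E.
Proof.
move=> s0 st s0' st' e mphi phi0.
have t0 : 0 <= t by rewrite (le_trans s0)// ltW.
have mid : measurable_fun setT (id : Omega -> past W `[0, s]).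
  by apply: measurable_into_past => r /=; rewrite in_itv/= => /andP[].
have [|->] := integral_independent (P := P) mid (measurable_increment s0 t0) _ mphi phi0.
  move=> A B mA mB; exact: (bm_independent hW s0 st).
move=> h; split.
  apply: eq_integral => w _.
  have mw : measurable_fun setT (fun g => phi (w, g)).
    exact: (measurableT_comp mphi (pair1_measurable _)).
  exact: (integral_increment s0 st s0' st' e mw (fun g => phi0 (w, g))).
rewrite h.
have mF : measurable_fun setT (fun g => \int[P]_w phi (w, g))%E.
  have := measurable_fun_fubini_tonelli_G (m1 := law P mid) phi mphi phi0.
  congr (measurable_fun _ _); apply/funext => g; rewrite /fubini_G.
  have mg : measurable_fun setT (fun w => phi (w, g)).
    exact: (measurableT_comp mphi (pair2_measurable _)).
  exact: (integral_law P mid mg (fun w => phi0 (w, g))).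
apply: (integral_increment s0 st s0' st' e mF) => g.
by apply: integral_ge0 => w _; exact: phi0.
Qed.

Lemma increment_abs_moment s t (l : 'I_m) : 0 <= s -> s < t ->
  (\int[P]_w (`|increment W s t w l 0|)%:E < +oo)%E.
Proof.
move=> s0 st; have t0 : 0 <= t by rewrite (le_trans s0)// ltW.
apply: (normal_abs_moment (s := Num.sqrt (t - s))).
- by rewrite gt_eqF// sqrtr_gt0 subr_gt0.
- exact: (measurableT_comp (measurable_coord l) (measurable_increment s0 t0)).
- move=> B mB.
  have mB' : forall l', measurable (if l' == l then B else setT).
    by move=> l'; case: ifP.
  have := bm_gaussian hW s0 st mB'.
  rewrite (bigD1 l)//= eqxx big1 ?mulr1 => [|l' /negbTE ->]; last first.
    by rewrite probability_setT.
  rewrite fineK ?fin_num_measure// => <-; congr (P _).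
  apply/seteqP; split => w /=; first by move=> Bw l'; case: eqP => // ->.
  by move=> /(_ l); rewrite eqxx.
Qed.

End brownian_increments.

(** * The transition operator of the scheme *)

Section em_operator.
Context {R : realType} {d : measure_display} {Omega : measurableType d}.
Variables (P : probability Omega R) (n m N : nat) (W : R -> Omega -> borelV R m).
Variables (Q : 'M[R]_N.+1) (Lambda : 'I_N.+1 -> R -> Omega -> stateT N).
Variables (b : 'cV[R]_n -> 'I_N.+1 -> 'cV[R]_n) (sigma : 'I_N.+1 -> 'M[R]_(n, m)).
Variable delta : R.
Hypothesis hW : is_brownian_motion P W.
Hypothesis hLambda : is_markov_chain P Q Lambda.
Hypothesis hindep : forall i, independent_processes P W (Lambda i).
Hypothesis delta_gt0 : 0 < delta.
Hypothesis mb : forall i, measurable_fun setT (b ^~ i : borelV R n -> borelV R n).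
Notation S := 'I_N.+1.

Definition em_step (x : borelV R n) (i : S) (g : borelV R m) : borelV R n :=
  (x : 'cV[R]_n) + delta *: b x i + sigma i *m (g : 'cV[R]_m).

Definition noise (k : nat) (w : Omega) : borelV R m :=
  increment W (k%:R * delta) (k.+1%:R * delta) w.

Definition trans_prob (t : R) (i j : S) : R := fine (P [set w | Lambda i t w = j]).

Definition em_mean (i : S) (h : borelV R n -> \bar R) (x : borelV R n) : \bar R :=
  (\int[P]_w h (em_step x i (noise 0 w)))%E.

(** The one-step transition operator. The Brownian increment and the jump of the
chain during the step are independent, hence the product form. *)
Definition em_op (h : borelV R n * stateT N -> \bar R) (z : borelV R n * stateT N) :
    \bar R :=
  (\sum_(j < N.+1) (trans_prob delta z.2 j)%:E *
     em_mean z.2 (fun y => h (y, j)) z.1)%E.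

Lemma time_ge0 k : 0 <= k%:R * delta.
Proof. by rewrite mulr_ge0// ltW. Qed.

Lemma time_lt k : k%:R * delta < k.+1%:R * delta.
Proof. by rewrite ltr_pM2r// ltr_nat. Qed.

Lemma time_le k l : (k <= l)%N -> k%:R * delta <= l%:R * delta.
Proof. by move=> kl; rewrite ler_pM2r// ler_nat. Qed.

Lemma time_step k : k.+1%:R * delta - k%:R * delta = 1%:R * delta - 0%:R * delta.
Proof. by rewrite -natr1; ring. Qed.

Lemma measurable_em_step i :
  measurable_fun setT (fun z : borelV R n * borelV R m => em_step z.1 i z.2).
Proof.
apply: measurable_borelV => k.
rewrite (_ : (fun _ => _) = fun z : borelV R n * borelV R m =>
  (z.1 : 'cV[R]_n) k 0 + delta * (b z.1 i) k 0 +
  \sum_(l < m) sigma i k l * (z.2 : 'cV[R]_m) l 0); last first.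
  by apply/funext => z; rewrite /em_step !mxE.
apply: measurable_funD; first apply: measurable_funD.
- exact: (measurableT_comp (measurable_coord k) measurable_fst).
- apply: measurable_funM => //.
  apply: (measurableT_comp (measurable_coord k)).
  exact: (measurableT_comp (mb i) measurable_fst).
- apply: measurable_sum => l; apply: measurable_funM => //.
  exact: (measurableT_comp (measurable_coord l) measurable_snd).
Qed.

Lemma measurable_noise k : measurable_fun setT (noise k).
Proof. exact: (measurable_increment hW (time_ge0 k) (time_ge0 k.+1)). Qed.

Section nonnegative_functions.
Variable i : S.
Variable h : borelV R n -> \bar R.
Hypothesis mh : measurable_fun setT h.
Hypothesis h0 : forall x, (0 <= h x)%E.

Lemma em_mean_ge0 x : (0 <= em_mean i h x)%E.
Proof. by apply: integral_ge0 => w _; exact: h0. Qed.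

Lemma measurable_em_mean : measurable_fun setT (em_mean i h).
Proof.
have mhs : measurable_fun setT
    (fun z : borelV R n * borelV R m => h (em_step z.1 i z.2)).
  exact: (measurableT_comp mh (measurable_em_step i)).
have := measurable_fun_fubini_tonelli_F (m2 := law P (measurable_noise 0)) _ mhs
  (fun z => h0 _).
congr (measurable_fun _ _); apply/funext => x; rewrite /fubini_F /em_mean.
rewrite (integral_law P (measurable_noise 0) (h := fun g => h (em_step x i g)))//.
exact: (measurableT_comp mhs (pair1_measurable x)).
Qed.

Lemma em_mean_noise k x :
  (\int[P]_w h (em_step x i (noise k w)))%E = em_mean i h x.
Proof.
apply: (integral_increment hW (time_ge0 k) (time_lt k) (time_ge0 0) (time_lt 0)
  (time_step k) (h := fun g => h (em_step x i g))) => //.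
exact: (measurableT_comp (measurableT_comp mh (measurable_em_step i))
  (pair1_measurable x)).
Qed.

End nonnegative_functions.

Section operator.
Variable h : borelV R n * stateT N -> \bar R.
Hypothesis mh : measurable_fun setT h.
Hypothesis h0 : forall z, (0 <= h z)%E.

Lemma trans_prob_ge0 t i j : 0 <= trans_prob t i j.
Proof. exact: fine_ge0. Qed.

Lemma measurable_slice j : measurable_fun setT (fun y => h (y, j)).
Proof. exact: (measurableT_comp mh (pair2_measurable j)). Qed.

Lemma em_op_ge0 z : (0 <= em_op h z)%E.
Proof.
apply: sume_ge0 => j _; rewrite mule_ge0 ?lee_fin ?trans_prob_ge0//.
exact: em_mean_ge0.
Qed.

Lemma measurable_em_op : measurable_fun setT (em_op h).
Proof.
apply: (measurable_slices (f := fun x i => em_op h (x, i))) => i.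
apply: emeasurable_sum => j; apply: emeasurable_funM => //=.
by apply: measurable_em_mean => // ; exact: measurable_slice.
Qed.

End operator.

(** The scheme along a fixed trajectory of the chain depends on the noise
only. *)
Fixpoint frozen (v : nat -> S) (x : borelV R n) (k : nat) (w : Omega) : borelV R n :=
  if k is k'.+1 then em_step (frozen v x k' w) (v k') (noise k' w) else x.

Lemma measurable_past_noise k t : k.+1%:R * delta <= t ->
  measurable_fun setT (noise k : past W `[0, t] -> borelV R m).
Proof.
move=> kt; apply: measurable_past_increment; rewrite /= in_itv/= time_ge0//=.
by rewrite (le_trans _ kt)// ltW// time_lt.
Qed.

Lemma measurable_past_frozen v x k t : k%:R * delta <= t ->
  measurable_fun setT (frozen v x k : past W `[0, t] -> borelV R n).
Proof.
elim: k => [_|k IH kt] /=; first exact: measurable_cst.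
have mk := IH (le_trans (ltW (time_lt k)) kt).
exact: (measurableT_comp (measurable_em_step (v k))
  (measurable_fun_pair mk (measurable_past_noise kt))).
Qed.

Lemma frozen_step v x k (h : borelV R n -> \bar R) :
  measurable_fun setT h -> (forall y, 0 <= h y)%E ->
  (\int[P]_w h (frozen v x k.+1 w) = \int[P]_w em_mean (v k) h (frozen v x k w))%E.
Proof.
move=> mh h0.
have mphi : measurable_fun setT (fun z : past W `[0, k%:R * delta] * borelV R m =>
    h (em_step (frozen v x k z.1) (v k) z.2)).
  have mF := measurableT_comp (measurable_past_frozen v x (lexx (k%:R * delta)))
    (@measurable_fst _ _ (past W `[0, k%:R * delta]) (borelV R m)).
  exact: (measurableT_comp mh (measurableT_comp (measurable_em_step (v k))
    (measurable_fun_pair mF measurable_snd))).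
have [+ _] := integral_past_increment hW (time_ge0 k) (time_lt k) (time_ge0 0)
  (time_lt 0) (time_step k) mphi (fun z => h0 _).
exact.
Qed.

(** Independence of the Brownian motion and the chain, applied to the Boolean
indicator of an event of the chain. *)
Lemma integral_path_event i (B : set Omega) (f : past W `[0, +oo[ -> \bar R) :
  process_sigma (Lambda i) `[0, +oo[ B -> measurable B ->
  measurable_fun setT f -> (forall w, 0 <= f w)%E ->
  (\int[P]_(w in B) f w = P B * \int[P]_w f w)%E.
Proof.
move=> sB mB mf f0.
have mid : measurable_fun setT (id : Omega -> past W `[0, +oo[).
  by apply: (measurable_into_past hW) => t /=; rewrite in_itv/= andbT.
have mf' : measurable_fun setT (f : Omega -> \bar R).
  exact: (measurableT_comp mf mid).
pose phi (z : past W `[0, +oo[ * bool) : \bar R := (if z.2 then f z.1 else 0)%E.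
have mphi : measurable_fun setT phi.
  exact: (measurable_fun_ifT (@measurable_snd _ _ (past W `[0, +oo[) bool)
    (measurableT_comp mf measurable_fst) (measurable_cst _)).
have phi0 z : (0 <= phi z)%E by rewrite /phi; case: ifP.
have mBb : measurable_fun setT (fun w => w \in B).
  apply: (measurable_fun_bool true); rewrite setTI.
  by rewrite (_ : _ @^-1` _ = B)//; apply/seteqP; split => w /=; [exact: set_mem|exact: mem_set].
have [|_ e] := integral_independent (P := P) mid mBb _ mphi phi0.
  move=> A C mA _.
  have sC : process_sigma (Lambda i) `[0, +oo[ ((fun w => w \in B) @^-1` C).
    pose LT : measurableType _ := past (Lambda i) `[0, +oo[.
    have mBL : @measurable _ LT B := sB.
    have mt := @measurableT _ LT.
    have [CT|CT] := pselect (C true); have [CF|CF] := pselect (C false).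
    - rewrite (_ : _ @^-1` C = setT); first exact: mt.
      by apply/seteqP; split => // w _ /=; case: (w \in B).
    - rewrite (_ : _ @^-1` C = B)//.
      by apply/seteqP; split => w /=; case: (boolP (w \in B)); rewrite ?inE ?notin_setE; tauto.
    - rewrite (_ : _ @^-1` C = ~` B); first exact: (measurableC mBL).
      by apply/seteqP; split => w /=; case: (boolP (w \in B)); rewrite ?inE ?notin_setE; tauto.
    - rewrite (_ : _ @^-1` C = set0); first exact: (@measurable0 _ LT).
      by apply/seteqP; split => w //=; case: (w \in B).
  exact: (hindep mA sC).
have -> : (\int[P]_(w in B) f w = \int[P]_w phi (w, w \in B))%E.
  rewrite integral_mkcond; apply: eq_integral => w _.
  by rewrite patchE.
rewrite e.
have h w' : (\int[P]_w phi (w, w' \in B) = (\int[P]_w f w) * (\1_B w')%:E)%E.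
  rewrite /phi indicE/=; case: (w' \in B); first by rewrite mule1.
  by rewrite integral0 mule0.
under eq_integral do rewrite h.
rewrite ge0_integralZl//.
- by rewrite integral_indic// setIT muleC.
- exact/measurable_EFinP.
- exact: integral_ge0.
Qed.

Definition path_event i (v : nat -> S) (k : nat) : set Omega :=
  [set w | forall l, (l <= k)%N -> Lambda i (l%:R * delta) w = v l].

Lemma path_event_past i v k t : k%:R * delta <= t ->
  @measurable _ (past (Lambda i) `[0, t]) (path_event i v k).
Proof.
move=> kt; rewrite (_ : path_event i v k =
    \bigcap_(l in [set l | (l < k.+1)%N]) (Lambda i (l%:R * delta) @^-1` [set v l])).
  apply: bigcap_measurable; first by exists 0%N.
  move=> l /= lk; apply: sub_sigma_algebra; exists (l%:R * delta); split.
    by rewrite /= in_itv/= time_ge0/= (le_trans _ kt)// time_le.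
  by exists [set v l].
by apply/seteqP; split => w h l; exact: h.
Qed.

Lemma process_sigma_sub i (I J : set R) :
  I `<=` J -> process_sigma (Lambda i) I `<=` process_sigma (Lambda i) J.
Proof.
move=> IJ; apply: smallest_sub; first exact: smallest_sigma_algebra.
move=> _ [t [It [B [mB ->]]]]; apply: sub_sigma_algebra.
by exists t; split; [exact: IJ|exists B].
Qed.

Lemma path_event_sigma i v k : process_sigma (Lambda i) `[0, +oo[ (path_event i v k).
Proof.
apply: (@process_sigma_sub i `[0, k%:R * delta]%classic); last exact: path_event_past.
by move=> r /=; rewrite !in_itv/= => /andP[->].
Qed.

Lemma measurable_process_sigma i A : process_sigma (Lambda i) `[0, +oo[ A -> measurable A.
Proof.
move: A; apply: smallest_sub; first exact: sigma_algebra_measurable.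
move=> _ [t [t0 [B [mB ->]]]]; rewrite -[X in measurable X]setTI.
have t1 : 0 <= t by move: t0; rewrite /= in_itv/= andbT.
by have := mc_measurable hLambda i t1; apply.
Qed.

Lemma measurable_state_event i t j : 0 <= t -> measurable [set w | Lambda i t w = j].
Proof.
move=> t0; rewrite -[X in measurable X]setTI.
by apply: (mc_measurable hLambda i t0 measurableT (Y := [set j])).
Qed.

Lemma state_event_sigma i t j : 0 <= t ->
  process_sigma (Lambda i) `[0, +oo[ [set w | Lambda i t w = j].
Proof.
move=> t0; apply: sub_sigma_algebra; exists t; split; first by rewrite /= in_itv/= andbT.
by exists [set j].
Qed.

Lemma path_event_step i v k j :
  P (path_event i v k `&` [set w | Lambda i (k.+1%:R * delta) w = j]) =
  (P (path_event i v k) * (trans_prob delta (v k) j)%:E)%E.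
Proof.
have := mc_markov hLambda (time_ge0 k) (ltW delta_gt0) (A := path_event i v k)
  (v k) j (@path_event_past i v k _ (lexx (k%:R * delta))).
have -> : path_event i v k `&` [set w | Lambda i (k%:R * delta) w = v k] =
    path_event i v k.
  by apply/seteqP; split => w; [case|move=> h; split => //; exact: h].
have -> : k%:R * delta + delta = k.+1%:R * delta by rewrite -natr1 mulrDl mul1r.
move=> ->; rewrite /trans_prob fineK// fin_num_measure//.
exact: measurable_state_event (ltW delta_gt0).
Qed.

Let scheme x i k w : borelV R n := em_scheme b sigma W Lambda delta x i k w.

Lemma scheme_frozen x i v k w :
  (forall l, (l < k)%N -> Lambda i (l%:R * delta) w = v l) ->
  scheme x i k w = frozen v x k w.
Proof.
elim: k => [//|k IH] h; rewrite /scheme /= -/(scheme x i k w) IH => [|l lk].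
  by rewrite h.
by apply: h; exact: leqW.
Qed.

Lemma measurable_scheme i k :
  measurable_fun setT (fun z : borelV R n * Omega => scheme z.1 i k z.2).
Proof.
elim: k => [|k IH]; first exact: measurable_fst.
have m1 := measurableT_comp (measurable_noise k) (@measurable_snd _ _ (borelV R n) Omega).
have m2 := measurableT_comp (mc_measurable hLambda i (time_ge0 k))
  (@measurable_snd _ _ (borelV R n) Omega).
have ms := measurable_slices (fun j => measurable_em_step j).
exact: (measurableT_comp ms (measurable_fun_pair (measurable_fun_pair IH m1) m2)).
Qed.

Lemma measurable_scheme_state i k : measurable_fun setT
  (fun z : borelV R n * Omega =>
    (scheme z.1 i k z.2, Lambda i (k%:R * delta) z.2) : borelV R n * stateT N).
Proof.
apply: measurable_fun_pair; first exact: measurable_scheme.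
exact: (measurableT_comp (mc_measurable hLambda i (time_ge0 k))
  (@measurable_snd _ _ (borelV R n) Omega)).
Qed.

Let chain_path i k (w : Omega) : {ffun 'I_k.+1 -> S} :=
  [ffun l : 'I_k.+1 => Lambda i ((l : nat)%:R * delta) w : S].

Let chain_pathE i k (v : {ffun 'I_k.+1 -> S}) :
  chain_path i k @^-1` [set v] = path_event i (fun l => v (inord l)) k.
Proof.
apply/seteqP; split => w /=.
  by move=> <- l lk; rewrite ffunE inordK.
by move=> h; apply/ffunP => l; rewrite ffunE h -1?ltnS// inord_val.
Qed.

(** The one-step Markov property of the scheme: on the event that the chain
follows a given trajectory, the scheme is a function of the noise, which is
independent of the chain. *)
Lemma em_markov_step x i k (h : borelV R n * stateT N -> \bar R) :
  measurable_fun setT h -> (forall z, 0 <= h z)%E ->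
  (\int[P]_w h (scheme x i k.+1 w, Lambda i (k.+1%:R * delta) w) =
   \int[P]_w em_op h (scheme x i k w, Lambda i (k%:R * delta) w))%E.
Proof.
move=> mh h0.
have msl k' : measurable_fun setT (fun w =>
    (scheme x i k' w, Lambda i (k'%:R * delta) w) : borelV R n * stateT N).
  exact: (measurableT_comp (measurable_scheme_state i k')
    (pair1_measurable (x : borelV R n))).
have mpath (v : {ffun 'I_k.+1 -> S}) : measurable (chain_path i k @^-1` [set v]).
  by rewrite chain_pathE; apply: (@measurable_process_sigma i); exact: path_event_sigma.
pose X w := (chain_path i k w, Lambda i (k.+1%:R * delta) w : S).
have XE v j : X @^-1` [set (v, j)] = chain_path i k @^-1` [set v] `&`
    [set w | Lambda i (k.+1%:R * delta) w = j].
  by apply/seteqP; split => w /=; rewrite /X; [case=> -> ->|case=> -> ->].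
have mX vj : measurable (X @^-1` [set vj]).
  by case: vj => v j; rewrite XE; apply: measurableI => //; exact: (measurable_state_event i j (time_ge0 k.+1)).
rewrite (integral_partition P mX); [|exact: (measurableT_comp mh (msl k.+1))|by []].
rewrite [RHS](integral_partition P mpath); last 2 first.
- exact: (measurableT_comp (measurable_em_op mh h0) (msl k)).
- by move=> w; exact: em_op_ge0.
transitivity (\sum_v \sum_(j < N.+1) \int[P]_(w in X @^-1` [set (v, j)])
  h (scheme x i k.+1 w, Lambda i (k.+1%:R * delta) w))%E.
  by rewrite pair_bigA; apply: eq_bigr => -[v j] _.
apply: eq_bigr => v _; pose vx (l : nat) := v (inord l).
pose E := path_event i vx k.
have EE : chain_path i k @^-1` [set v] = E by exact: chain_pathE.
have mE : measurable E by rewrite -EE.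
have mpf k' : measurable_fun setT (frozen vx x k' : past W `[0, +oo[ -> borelV R n).
  apply: (measurable_past_sub _ (measurable_past_frozen vx x (lexx (k'%:R * delta)))).
  by move=> r /=; rewrite !in_itv/= => /andP[->].
have mmean j : measurable_fun setT (em_mean (vx k) (fun y => h (y, j))).
  by apply: measurable_em_mean => //; exact: measurable_slice.
have mean0 j y : (0 <= em_mean (vx k) (fun y => h (y, j)) y)%E.
  by apply: em_mean_ge0 => ?; exact: h0.
have -> : (\int[P]_(w in chain_path i k @^-1` [set v])
      em_op h (scheme x i k w, Lambda i (k%:R * delta) w) =
    \int[P]_(w in E) (\sum_(j < N.+1) (trans_prob delta (vx k) j)%:E *
      em_mean (vx k) (fun y => h (y, j)) (frozen vx x k w)))%E.
  rewrite EE; apply: eq_integral => w /set_mem Ew.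
  rewrite (@scheme_frozen x i vx) => [|l lk]; last by apply: Ew; exact: ltnW.
  by rewrite (Ew k).
have mfz k' : measurable_fun setT (frozen vx x k').
  apply: (measurableT_comp (mpf k')); apply: (measurable_into_past hW) => t /=.
  by rewrite in_itv/= andbT.
rewrite ge0_integral_sum//; last 2 first.
- move=> j; apply: measurable_funTS; apply: emeasurable_funM => //.
  exact: (measurableT_comp (mmean j) (mfz k)).
- by move=> j w _; rewrite mule_ge0// lee_fin trans_prob_ge0.
apply: eq_bigr => j _.
rewrite ge0_integralZl//; last 2 first.
- by apply: measurable_funTS; exact: (measurableT_comp (mmean j) (mfz k)).
- by rewrite lee_fin trans_prob_ge0.
rewrite XE EE.
set E' := _ `&` _.
have sE' : process_sigma (Lambda i) `[0, +oo[ E'.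
  apply: (@measurableI _ (past (Lambda i) `[0, +oo[)); first exact: (@path_event_sigma i vx k).
  exact: (@state_event_sigma i _ j (time_ge0 k.+1)).
have mE' : measurable E' by exact: measurable_process_sigma sE'.
have -> : (\int[P]_(w in E') h (scheme x i k.+1 w, Lambda i (k.+1%:R * delta) w) =
    \int[P]_(w in E') h (frozen vx x k.+1 w, j))%E.
  apply: eq_integral => w /set_mem[Ew wj].
  by rewrite (@scheme_frozen x i vx) ?wj// => l lk; exact: Ew.
rewrite (integral_path_event sE' mE' (f := fun w => h (frozen vx x k.+1 w, j)))//; last first.
  exact: (measurableT_comp (measurable_slice mh j) (mpf k.+1)).
rewrite (integral_path_event (@path_event_sigma i vx k) mE
  (f := fun w => em_mean (vx k) (fun y => h (y, j)) (frozen vx x k w)))//; last first.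
  exact: (measurableT_comp (mmean j) (mpf k)).
rewrite path_event_step (frozen_step _ _ _ (measurable_slice mh j))//.
by rewrite [(P _ * _)%E]muleC muleA.
Qed.

Lemma em_kernel_iter x i k (h : borelV R n * stateT N -> \bar R) :
  measurable_fun setT h -> (forall z, 0 <= h z)%E ->
  (\int[P]_w h (scheme x i k w, Lambda i (k%:R * delta) w) =
   iter k em_op h (x, i))%E.
Proof.
elim: k h => [|k IH] h mh h0; last first.
  rewrite em_markov_step// IH ?iterSr//; first exact: measurable_em_op.
  by move=> z; exact: em_op_ge0.
rewrite /scheme /= mul0r.
rewrite (ge0_ae_eq_integral (g := fun=> h (x, i)))//.
- by rewrite integral_cst// [X in (_ * X)%E](probability_setT P) mule1.
- exact: (measurableT_comp (measurableT_comp mh (pair1_measurable (x : borelV R n)))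
    (mc_measurable hLambda i (lexx 0))).
- have := mc_start hLambda i; apply: filterS => w h1 _; congr h.
  by rewrite h1.
Qed.

End em_operator.

(** * Contraction of one step *)

Section euclidean_norm.
Context {R : realType}.

Lemma dotp_ge0 n (x : 'cV[R]_n) : 0 <= dotp x x.
Proof. by apply: sumr_ge0 => k _; rewrite -expr2 sqr_ge0. Qed.

Lemma enorm_ge0 n (x : 'cV[R]_n) : 0 <= enorm x.
Proof. exact: sqrtr_ge0. Qed.

Lemma sqr_enorm n (x : 'cV[R]_n) : enorm x ^+ 2 = dotp x x.
Proof. by rewrite sqr_sqrtr// dotp_ge0. Qed.

Lemma dotp_lin n (u v : 'cV[R]_n) (c : R) :
  dotp (u + c *: v) (u + c *: v) = dotp u u + 2 * c * dotp u v + c ^+ 2 * dotp v v.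
Proof.
rewrite /dotp !mulr_sumr -!big_split/=; apply: eq_bigr => k _.
by rewrite !mxE; ring.
Qed.

Lemma coord_le_enorm n (x : 'cV[R]_n) k : `|x k 0| <= enorm x.
Proof.
rewrite -(@ler_pXn2r _ 2) ?nnegrE ?enorm_ge0// sqr_enorm real_normK ?num_real//.
by rewrite /dotp (bigD1 k)//= expr2 lerDl sumr_ge0// => j _; rewrite -expr2 sqr_ge0.
Qed.

Lemma enorm_le_sum n (x : 'cV[R]_n) : enorm x <= \sum_k `|x k 0|.
Proof.
rewrite -(@ler_pXn2r _ 2) ?nnegrE ?enorm_ge0 ?sumr_ge0// sqr_enorm.
rewrite /dotp expr2 mulr_suml; apply: ler_sum => k _.
rewrite -expr2 -real_normK ?num_real// expr2 ler_wpM2l//.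
by rewrite (bigD1 k)//= lerDl sumr_ge0.
Qed.

Lemma norm_le_enorm n (x : 'cV[R]_n) : `|x| <= enorm x.
Proof.
rewrite [leLHS]mx_normrE; apply: bigmax_le; first exact: enorm_ge0.
by move=> [k j] _ /=; rewrite (ord1 j) coord_le_enorm.
Qed.

Lemma enorm_le_norm n (x : 'cV[R]_n) : enorm x <= n%:R * `|x|.
Proof.
rewrite (le_trans (enorm_le_sum x))//.
apply: (@le_trans _ _ (\sum_(k < n) `|x|)); last by rewrite sumr_const card_ord mulr_natl.
apply: ler_sum => k _; rewrite [leRHS]mx_normrE.
exact: (le_bigmax _ (fun ij => `|x ij.1 ij.2|) (k, 0)).
Qed.

Lemma enormN n (x : 'cV[R]_n) : enorm (- x) = enorm x.
Proof.
congr Num.sqrt; apply: eq_bigr => k _; by rewrite !mxE mulrNN.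
Qed.

Lemma enorm_dim0 n (x : 'cV[R]_n) : n = 0%N -> enorm x = 0.
Proof. by move=> n0; subst n; rewrite /enorm /dotp big_ord0 sqrtr0. Qed.

Lemma enorm_lipschitz_continuous n m (f : 'cV[R]_n -> 'cV[R]_m) (L : R) :
  (forall x y, enorm (f x - f y) <= L * enorm (x - y)) -> continuous f.
Proof.
move=> fL x; apply/(@cvgrPdist_le _ _ _ _ (nbhs_filter x)) => e e0.
have L1 : 0 < `|L| * n%:R + 1 by rewrite ltr_wpDl// mulr_ge0.
have nb : \forall y \near x, ball x (e / (`|L| * n%:R + 1)) y.
  by apply: nbhsx_ballx; rewrite divr_gt0.
near=> y.
have : ball x (e / (`|L| * n%:R + 1)) y by near: y.
rewrite -ball_normE /= => /ltW; rewrite ler_pdivlMr// => h; apply: le_trans h.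
rewrite (le_trans (norm_le_enorm _))// (le_trans (fL _ _))//.
rewrite (@le_trans _ _ (`|L| * (n%:R * `|x - y|)))//.
  rewrite (@le_trans _ _ (`|L| * enorm (x - y)))//.
    by rewrite ler_wpM2r ?enorm_ge0// ler_norm.
  by rewrite ler_wpM2l// enorm_le_norm.
by rewrite mulrA mulrDr mulr1 [`|x - y| * _]mulrC lerDl.
Unshelve. all: by end_near. Qed.

End euclidean_norm.

(** Concavity of [c |-> c ^ r]. *)
Lemma powR_bernoulli (R : realType) (c r : R) : 0 <= c -> 0 < r -> r < 1 ->
  c `^ r <= 1 + r * (c - 1).
Proof.
move=> c0 r0 r1; have r1' : 0 < 1 - r by rewrite subr_gt0.
have e : r^-1^-1 + (1 - r)^-1^-1 = 1 by rewrite !invrK addrC subrK.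
have i0 : 0 < r^-1 by rewrite invr_gt0.
have i1 : 0 < (1 - r)^-1 by rewrite invr_gt0.
have := conjugate_powR (powR_ge0 c r) ler01 i0 i1 e.
rewrite !invrK mulr1 powR1 mul1r -powRrM mulfV ?(gt_eqF r0)// powRr1//; lra.
Qed.

Lemma min1_le_powR (R : realType) (a p : R) : 0 <= a -> 0 < p -> p < 1 ->
  Num.min 1 a <= a `^ p.
Proof.
move=> a0 p0 p1; have [a1|a1] := leP 1 a; last first.
  have [->|an0] := eqVneq a 0; first exact: powR_ge0.
  rewrite -[leLHS](powRr1 a0); apply: ger_powR; last exact: ltW.
  by rewrite lt_neqAle eq_sym an0 a0 ltW.
apply: (@le_trans _ _ (1 `^ p)); first by rewrite powR1.
by apply: ge0_ler_powR; rewrite ?nnegrE// ltW.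
Qed.

(** The approximation is [min 1 (k dist (x, ~ U))], written as [1 - psi k x] with
[psi k x] the supremum of [max 0 (1 - k |x - y|)] over [y] outside [U]. The value 0
is added to the set of which the supremum is taken so that it is never empty. *)
Lemma open_lipschitz_approx (R : realType) n (U : set 'cV[R]_n) : open U ->
  exists phi : nat -> 'cV[R]_n -> R, [/\ forall k x, 0 <= phi k x <= 1,
    forall k x y, phi k x <= phi k y + k%:R * `|x - y| &
    forall x, phi k x @[k --> \oo] --> (\1_U x : R)].
Proof.
move=> oU.
pose B k x : set R := [set t | t = 0 \/
  exists2 y : 'cV[R]_n, ~ U y & t = Num.max 0 (1 - k%:R * `|x - y|)].
have B1 k x : ubound (B k x) 1.
  by move=> _ [->|[y _ ->]]//; rewrite ge_max ler01/= gerBl mulr_ge0.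
have B0 k x : B k x !=set0 by exists 0; left.
have hB k x : has_ubound (B k x) by exists 1.
pose psi k x := sup (B k x).
have psi0 k x : 0 <= psi k x by apply: ub_le_sup => //; left.
have psi1 k x : psi k x <= 1 by exact: ge_sup.
have psiL k x y : psi k x <= psi k y + k%:R * `|x - y|.
  apply: ge_sup => // _ [->|[z Uz ->]]; first by rewrite addr_ge0// mulr_ge0.
  rewrite ge_max; apply/andP; split; first by rewrite addr_ge0// mulr_ge0.
  have : Num.max 0 (1 - k%:R * `|y - z|) <= psi k y.
    by apply: ub_le_sup => //; right; exists z.
  rewrite ge_max => /andP[_].
  have : k%:R * `|y - z| <= k%:R * (`|x - y| + `|x - z|).
    by rewrite ler_wpM2l// [`|x - y|]distrC; exact: ler_distD.
  lra.
exists (fun k x => 1 - psi k x); split.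
- by move=> k x; rewrite subr_ge0 psi1 gerBl psi0.
- by move=> k x y; have := psiL k y x; rewrite distrC; lra.
move=> x; rewrite indicE; case: (boolP (x \in U)) => [/set_mem Ux|/negP Ux].
  have /nbhs_ballP[r /= r0 hr] : nbhs x U by exact: open_nbhs_nbhs.
  apply: cvg_near_cst; near=> k.
  suff -> : psi k x = 0 by rewrite subr0.
  apply/eqP; rewrite eq_le psi0 andbT; apply: ge_sup => // _ [->//|[y Uy ->]].
  rewrite ge_max lexx/= subr_le0.
  have rxy : r <= `|x - y|.
    rewrite leNgt; apply/negP => h; apply: Uy; apply: hr.
    by rewrite -ball_normE.
  apply: (@le_trans _ _ (k%:R * r)); last by rewrite ler_wpM2l.
  rewrite -ler_pdivrMr// div1r; near: k; exact: nbhs_infty_ger.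
apply: cvg_near_cst; apply: nearW => k.
suff -> : psi k x = 1 by rewrite subrr.
apply/eqP; rewrite eq_le psi1/=; apply: ub_le_sup => //; right; exists x.
  by move=> h; apply: Ux; exact: mem_set.
by rewrite subrr normr0 mulr0 subr0; apply/esym/max_r.
Unshelve. all: by end_near. Qed.

Section step_contraction.
Context {R : realType} {n m N : nat}.
Variables (b : 'cV[R]_n -> 'I_N.+1 -> 'cV[R]_n) (sigma : 'I_N.+1 -> 'M[R]_(n, m)).
Variables (delta L p : R) (beta : 'I_N.+1 -> R).
Hypothesis delta0 : 0 < delta.
Hypothesis hL : 0 < L.
Hypothesis p0 : 0 < p.
Hypothesis p1 : p < 1.
Hypothesis hLip : forall i x y, enorm (b x i - b y i) <= L * enorm (x - y).
Hypothesis hdiss : forall i x y,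
  2 * dotp (x - y) (b x i - b y i) <= beta i * enorm (x - y) ^+ 2.

Let step_diff x y i g : em_step b sigma delta x i g - em_step b sigma delta y i g =
  ((x : 'cV[R]_n) - y) + delta *: (b x i - b y i).
Proof. by apply/matrixP => k l; rewrite /em_step !mxE; ring. Qed.

Let sqr_lip i x y : dotp (b x i - b y i) (b x i - b y i) <= L ^+ 2 * dotp (x - y) (x - y).
Proof.
rewrite -!sqr_enorm -exprMn; apply: lerXn2r; rewrite ?nnegrE ?enorm_ge0//.
by rewrite mulr_ge0 ?enorm_ge0// ltW.
Qed.

Let c i := 1 + (beta i * delta + L ^+ 2 * delta ^+ 2).

Let sqr_step x y i g : enorm (em_step b sigma delta x i g - em_step b sigma delta y i g) ^+ 2
  <= c i * enorm ((x : 'cV[R]_n) - y) ^+ 2.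
Proof.
rewrite step_diff !sqr_enorm dotp_lin.
have := hdiss i x y; have := sqr_lip i x y; rewrite sqr_enorm /c => h1 h2.
have := ler_wpM2l (sqr_ge0 delta) h1; have := ler_wpM2l (ltW delta0) h2; lra.
Qed.

(** The quadratic form [|L (x - y) + (b x i - b y i)|^2] is nonnegative. *)
Let beta_ge (x y : 'cV[R]_n) i : 0 < enorm (x - y) -> - (2 * L) <= beta i.
Proof.
move=> xy; have D0 : 0 < dotp (x - y) (x - y) by rewrite -sqr_enorm exprn_gt0.
have := dotp_ge0 (b x i - b y i + L *: (x - y)); rewrite dotp_lin.
have -> : dotp (b x i - b y i) (x - y) = dotp (x - y) (b x i - b y i).
  by apply: eq_bigr => k _; rewrite mulrC.
have := hdiss i x y; have := sqr_lip i x y; rewrite sqr_enorm => h1 h2 h3.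
rewrite -(ler_pM2r D0) -(ler_pM2l hL).
have := ler_wpM2l (ltW hL) h2; lra.
Qed.

(** One step of the scheme is Lipschitz in its starting point, for the [p]-th
power of the distance, with a constant that depends on the state only: the noise
is additive and cancels. *)
Lemma em_step_contraction (Q : 'M[R]_N.+1) (eta : R) (xi : 'cV[R]_N.+1)
    (pt : R -> 'I_N.+1 -> 'I_N.+1 -> R) :
  is_conservative_Qmatrix Q -> (forall i, 0 < xi i 0) -> 0 < eta ->
  Qp Q beta p *m xi = - eta *: xi -> delta < 1 -> delta < 1 / (16 * L ^+ 2) ->
  delta < (eta / alpha Q beta L p xi) `^ (2 / p) -> transition_semigroup Q pt ->
  exists2 rho, 0 < rho < 1 & exists g : 'I_N.+1 -> R, [/\ forall i, 0 <= g i,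
    forall x y i w, enorm (em_step b sigma delta x i w - em_step b sigma delta y i w) `^ p <=
      g i * enorm ((x : 'cV[R]_n) - y) `^ p &
    forall i, g i * \sum_j pt delta i j * xi j 0 <= rho * xi i 0].
Proof.
move=> hQ xi0 eta0 hQxi d1 dL dA hpt.
have [rho rho01 hrho] := contraction_rate hQ hL p0 p1 xi0 eta0 hQxi delta0 d1 dL dA hpt.
exists rho => //.
(* In dimension 0 there are no two distinct points to bound [beta] from below. *)
have [n0|n0] := posnP n.
  exists (fun=> 0); split => // [x y i w|i].
    by rewrite mul0r enorm_dim0// powR0// gt_eqF.
  by rewrite mul0r mulr_ge0// ltW//; case/andP: rho01.
have [x [y xy]] : exists x y : 'cV[R]_n, 0 < enorm (x - y).
  exists (const_mx 1), 0; apply: lt_le_trans (coord_le_enorm _ (Ordinal n0)).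
  by rewrite !mxE subr0 normr1.
have c0 i : 0 <= c i.
  have /(le_trans (sqr_ge0 _)) := sqr_step x y i (0 : 'cV[R]_m).
  by rewrite pmulr_lge0// exprn_gt0.
exists (fun i => c i `^ (p / 2)); split => [i|x' y' i w|i].
- exact: powR_ge0.
- have e2 (t : R) : 0 <= t -> t `^ p = (t ^+ 2) `^ (p / 2).
    by move=> t0; rewrite -powR_mulrn// -powRrM; congr (_ `^ _); field.
  rewrite !e2 ?enorm_ge0// -powRM ?sqr_ge0//.
  apply: ge0_ler_powR; last exact: sqr_step.
  + by rewrite divr_ge0// ltW.
  + by rewrite nnegrE sqr_ge0.
  + by rewrite nnegrE mulr_ge0 ?sqr_ge0.
- apply: le_trans (hrho i (beta_ge i xy)).
  rewrite ler_wpM2r//.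
    apply: sumr_ge0 => j _; rewrite mulr_ge0 ?(ltW (xi0 j))//.
    by rewrite (ts_ge0 hpt)// ltW.
  rewrite (le_trans (powR_bernoulli (c0 i) _ _))//.
  + by rewrite divr_gt0.
  + by rewrite ltr_pdivrMr// mul1r (lt_le_trans p1)// ler1n.
  + by rewrite /c addrAC subrr add0r.
Qed.

End step_contraction.

(** * The chain as a semigroup *)

Lemma measure_partition (R : realType) d (T : measurableType d) (I : finType)
    (P : {measure set T -> \bar R}) (X : T -> I) (B : set T) :
  (forall v, measurable (X @^-1` [set v])) -> measurable B ->
  (P B = \sum_v P (B `&` X @^-1` [set v]))%E.
Proof.
move=> mX mB; have := integral_partition P mX (f := fun x => (\1_B x)%:E).
rewrite integral_indic// setIT => ->//; last exact/measurable_EFinP.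
by apply: eq_bigr => v _; rewrite integral_indic.
Qed.

Section chain_semigroup.
Context {R : realType} {d : measure_display} {Omega : measurableType d}.
Variables (P : probability Omega R) (N : nat) (Q : 'M[R]_N.+1).
Variable Lambda : 'I_N.+1 -> R -> Omega -> stateT N.
Hypothesis hLambda : is_markov_chain P Q Lambda.
Notation pt := (trans_prob P Lambda).

Let mL i t j : 0 <= t -> measurable [set w | Lambda i t w = j].
Proof. exact: (measurable_state_event hLambda). Qed.

Lemma trans_probE t i j : 0 <= t -> P [set w | Lambda i t w = j] = (pt t i j)%:E.
Proof. by move=> t0; rewrite /trans_prob fineK// fin_num_measure//; exact: mL. Qed.

Lemma chain_semigroup : transition_semigroup Q pt.
Proof.
have mX i t : 0 <= t -> forall v, measurable ((Lambda i t : Omega -> 'I_N.+1) @^-1` [set v]).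
  by move=> t0 v; exact: mL.
split.
- by move=> t i j _; exact: trans_prob_ge0.
- move=> t i t0; have := measure_partition P (mX i t t0) measurableT.
  rewrite [X in X = _](probability_setT P) (eq_bigr (fun j => (pt t i j)%:E)).
    by rewrite sumEFin => -[<-].
  by move=> j _; rewrite -trans_probE// setTI.
- move=> i j; apply: EFin_inj; rewrite -trans_probE//.
  have := @ge0_ae_eq_integral _ _ _ P setT
    (fun w => (\1_[set w | Lambda i 0 w = j] w)%:E) (fun=> (i == j)%:R%:E).
  rewrite integral_indic//; last exact: mL.
  rewrite setIT integral_cst// [X in (_ * X)%E](probability_setT P) mule1 => ->//.
    by apply/measurable_EFinP/measurable_indic; exact: mL.
  have := mc_start hLambda i; apply: filterS => w h _.
  rewrite indicE; suff -> : (w \in [set w | Lambda i 0 w = j]) = (i == j) by [].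
  by apply/idP/eqP; rewrite inE /= h.
- move=> s t i k s0 t0; have st0 : 0 <= s + t by exact: addr_ge0.
  apply: EFin_inj; rewrite -trans_probE//.
  rewrite (measure_partition P (mX i s s0) (mL i k st0)) -sumEFin.
  apply: eq_bigr => j _.
  have := mc_markov hLambda s0 t0 j k (A := setT)
    (@measurableT _ (past (Lambda i) `[0, s])).
  by rewrite !setTI => e; rewrite setIC EFinM -!trans_probE//; exact: e.
- by move=> i j; exact: mc_rates hLambda i j.
Qed.

Lemma stationary_trans_prob (mu : 'I_N.+1 -> R) t j :
  is_stationary_distribution P Lambda mu -> 0 <= t ->
  \sum_i mu i * pt t i j = mu j.
Proof.
move=> hmu t0; apply: EFin_inj; rewrite (sd_invariant hmu t0 j) -sumEFin.
by apply: eq_bigr => i _; rewrite EFinM trans_probE.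
Qed.

End chain_semigroup.

Lemma bounded_convergence (R : realType) d (T : measurableType d)
    (P : probability T R) (f_ : nat -> T -> \bar R) (f : T -> \bar R) :
  (forall k, measurable_fun setT (f_ k)) -> measurable_fun setT f ->
  (forall k x, (0 <= f_ k x <= 1)%E) ->
  {ae P, forall x, f_ k x @[k --> \oo] --> f x} ->
  (\int[P]_x f_ k x)%E @[k --> \oo] --> (\int[P]_x f x)%E.
Proof.
move=> mf_ mf f01 f1; have [] // := @dominated_convergence _ _ _ P setT measurableT f_ f (fun=> 1%E) mf_ mf.
- by apply: filterS f1 => x h _.
- exact: finite_measure_integrable_cst.
- by apply: aeW => x k _; have /andP[h0 h1] := f01 k x; rewrite gee0_abs.
Qed.

(** * Hölder test functions *)

Section holder_functions.
Context {R : realType} {n N : nat}.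
Variables (xi : 'cV[R]_N.+1) (p : R).
Hypothesis xi0 : forall i, 0 < xi i 0.
Hypothesis p0 : 0 < p.
Hypothesis p1 : p < 1.

(** Test functions: their modulus of continuity is measured by the distance that
the scheme contracts in the mean. *)
Definition holder (C : R) (h : borelV R n * stateT N -> \bar R) : Prop :=
  [/\ measurable_fun setT h, forall z, (0 <= h z <= 1)%E &
    forall (x y : 'cV[R]_n) (i : 'I_N.+1),
      (h (x, i) <= h (y, i) + (C * xi i 0 * enorm (x - y) `^ p)%:E)%E].

Lemma measurable_norm_lipschitz (phi : 'cV[R]_n -> R) (k : R) : 0 <= k ->
  (forall x y, phi x <= phi y + k * `|x - y|) ->
  measurable_fun setT (phi : borelV R n -> R).
Proof.
move=> k0 hphi; apply: continuous_measurable_real => x.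
apply/(@cvgrPdist_le _ _ _ _ (nbhs_filter x)) => e e0.
have k1 : 0 < k + 1 by rewrite ltr_wpDl.
have nb : \forall y \near x, ball x (e / (k + 1)) y.
  by apply: nbhsx_ballx; rewrite divr_gt0.
near=> y.
have : ball x (e / (k + 1)) y by near: y.
rewrite -ball_normE /= => /ltW; rewrite ler_pdivlMr// => h.
have h1 := hphi x y; have := hphi y x; rewrite distrC => h2.
have xy := normr_ge0 (x - y).
rewrite ler_norml; apply/andP; split; lra.
Unshelve. all: by end_near. Qed.

Let rects : set (set (borelV R n * stateT N)) :=
  [set A | exists U D, open (U : set 'cV[R]_n) /\ A = U `*` D].

Let rects_measurable : rects `<=` measurable.
Proof.
by move=> _ [U [D [oU ->]]]; apply: measurableX => //; exact: measurable_open.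
Qed.

Let rects_generate (A : set (borelV R n * stateT N)) : measurable A -> <<s rects >> A.
Proof.
move=> mA; have : measurable_fun setT
    (id : g_sigma_algebraType rects -> borelV R n * stateT N).
  apply/measurable_fun_pairP; split.
    apply: (@measurability _ _ _ (borelV R n) _ _ (@open 'cV[R]_n)) => // _ [U oU <-].
    rewrite setTI; apply: sub_sigma_algebra; exists U, setT; split => //.
    by apply/seteqP; split => z //= [].
  move=> _ D mD; rewrite setTI; apply: sub_sigma_algebra; exists setT, D.
  by split; [exact: openT|apply/seteqP; split => z //= []].
by move=> /(_ measurableT _ mA); rewrite setTI.
Qed.

(** Open rectangles form a generating pi-system, and the indicator function of
each of them is a bounded limit of Hölder functions: a function with values in
[[0, 1]] that is [k]-Lipschitz is also Hölder, since [min 1 t <= t ^ p]. *)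
Lemma holder_separate (pi1 pi2 : probability (borelV R n * stateT N)%type R) :
  (forall C h, 0 <= C -> holder C h ->
    (\int[pi1]_z h z = \int[pi2]_z h z)%E) ->
  forall A, measurable A -> pi1 A = pi2 A.
Proof.
move=> hpi A mA.
have rT : rects setT by exists setT, setT; split; [exact: openT|rewrite setXTT].
have := @g_sigma_algebra_measure_unique _ R _ rects rects_measurable (fun=> setT)
  (fun=> rT) _ pi1 pi2 _ _ _ A.
apply; rewrite ?bigcup_const//.
- move=> _ _ [U [D [oU ->]]] [V [E [oV ->]]]; exists (U `&` V), (D `&` E).
  by split; [exact: openI|rewrite setXI].
- move=> _ [U [D [oU ->]]].
  have [phi [phi01 phiL phicvg]] := open_lipschitz_approx oU.
  pose f_ k (z : borelV R n * stateT N) : \bar R :=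
    if z.2 \in D then (phi k z.1)%:E else 0%E.
  pose f (z : borelV R n * stateT N) : \bar R := (\1_(U `*` D) z)%:E.
  have mphi k : measurable_fun setT (phi k : borelV R n -> R).
    by apply: (measurable_norm_lipschitz (k := k%:R)) => //; exact: phiL.
  have mf_ k : measurable_fun setT (f_ k).
    apply: (measurable_slices (f := fun x i => f_ k (x, i))) => i.
    by rewrite /f_ /=; case: (i \in D) => //; exact/measurable_EFinP.
  have mf : measurable_fun setT f.
    apply/measurable_EFinP/measurable_indic; apply: rects_measurable.
    by exists U, D.
  have f01 k z : (0 <= f_ k z <= 1)%E.
    rewrite /f_; case: ifP => _; last by rewrite lexx lee01.
    by rewrite !lee_fin; exact: phi01.
  have fcvg z : f_ k z @[k --> \oo] --> f z.
    have zE : (z \in U `*` D) = (z.1 \in U) && (z.2 \in D).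
      by apply/idP/andP; rewrite !inE.
    rewrite /f_ /f indicE zE; case: (z.2 \in D); rewrite ?andbT ?andbF.
      apply: cvg_EFin; first by apply: nearW.
      by have := phicvg z.1; rewrite indicE.
    exact: cvg_cst.
  have lim (pi : probability (borelV R n * stateT N)%type R) :
      (\int[pi]_z f_ k z)%E @[k --> \oo] --> pi (U `*` D).
    rewrite -[X in _ --> X](_ : \int[pi]_z f z = _)%E; last first.
      rewrite integral_indic ?setIT//; apply: rects_measurable.
      by exists U, D.
    by apply: bounded_convergence => //; apply: aeW.
  have hf k : holder (k%:R `^ p * (minI (fun i => xi i 0))^-1) (f_ k).
    split => // x y i; rewrite /f_ /=; case: ifP => _; last first.
      by rewrite add0e lee_fin mulr_ge0 ?powR_ge0// mulr_ge0 ?mulr_ge0 ?powR_ge0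
        ?(ltW (xi0 _))// invr_ge0 ltW// minI_gt0.
    rewrite -EFinD lee_fin.
    apply: (@le_trans _ _ (phi k y + Num.min 1 (k%:R * enorm (x - y)))).
      have [_|_] := leP 1 (k%:R * enorm (x - y)).
        have := phi01 k x; have := phi01 k y; lra.
      rewrite (le_trans (phiL k x y))// lerD2l ler_wpM2l//; exact: norm_le_enorm.
    rewrite lerD2l (le_trans (min1_le_powR _ p0 p1))// ?mulr_ge0 ?enorm_ge0//.
    rewrite powRM ?enorm_ge0// ler_wpM2r ?powR_ge0// -mulrA ler_peMr ?powR_ge0//.
    by rewrite ler_pdivlMl ?mulr1 ?minI_gt0//; exact: (minI_le (fun i => xi i 0)).
  apply/(cvg_unique _ (lim pi1)).
    exact: ereal_hausdorff.
  apply: cvg_trans (lim pi2); apply: near_eq_cvg; apply: nearW => k.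
  apply/esym; apply: hpi (hf k); rewrite mulr_ge0 ?powR_ge0// invr_ge0 ltW// minI_gt0//.
- by move=> k; rewrite [X in (X < _)%E](probability_setT pi1) ltry.
- exact: rects_generate mA.
Qed.

End holder_functions.

(** * Almost sure convergence *)

(** If the [p]-th powers of the increments are summable with [p < 1], then so
are the increments: the powers are bounded by their sum [s], and
[t = (t ^ p) (t ^ p) ^ (1 / p - 1) <= s ^ (1 / p - 1) t ^ p]. *)
Lemma summable_powers_cvg (R : realType) n (z : nat -> 'cV[R]_n) (B : nat -> R) (p : R) :
  0 < p -> p < 1 -> (forall k, 0 <= B k) -> (\sum_(k <oo) (B k)%:E < +oo)%E ->
  (forall k, enorm (z k.+1 - z k) `^ p <= B k) ->
  forall l, cvgn (fun k => z k l 0).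
Proof.
move=> p0 p1 B0 Bfin hz l.
have BE k : (0 <= (B k)%:E)%E by rewrite lee_fin.
have sfin : (\sum_(k <oo) (B k)%:E)%E \is a fin_num.
  by rewrite ge0_fin_numE// nneseries_ge0.
pose s := fine (\sum_(k <oo) (B k)%:E)%E.
have seriesB k : series B k <= s.
  rewrite -lee_fin fineK// seriesEnat/= -sumEFin.
  by apply: (@nneseries_lim_ge _ (fun k => (B k)%:E) xpredT 0%N).
have Bs k : B k <= s.
  apply: le_trans (seriesB k.+1); rewrite seriesEnat/= big_nat_recr//= lerDr.
  by rewrite sumr_ge0.
have s0 : 0 <= s by exact: le_trans (B0 0%N) (Bs 0%N).
have cvgB : cvgn (series B).
  apply: nondecreasing_is_cvgn; last by exists s => _ [k _ <-].
  by apply/nondecreasing_series => k _ _.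
have cvgM : cvgn (series (fun k => s `^ (p^-1 - 1) * B k)).
  have -> : series (fun k => s `^ (p^-1 - 1) * B k) = (fun k => s `^ (p^-1 - 1) * series B k).
    by apply/funext => k; rewrite !seriesEnat/= mulr_sumr.
  by apply: is_cvgM => //; exact: is_cvg_cst.
have incr k : `|z k.+1 l 0 - z k l 0| <= s `^ (p^-1 - 1) * B k.
  apply: (@le_trans _ _ (enorm (z k.+1 - z k))).
    by have := coord_le_enorm (z k.+1 - z k) l; rewrite !mxE.
  set t := enorm _ in hz *; have t0 : 0 <= t by exact: enorm_ge0.
  have -> : t = (t `^ p) `^ (p^-1).
    by rewrite -powRrM mulfV ?(gt_eqF p0)// powRr1.
  have pV : 0 < p^-1 - 1 by rewrite subr_gt0 invf_gt1.
  apply: (@le_trans _ _ (B k `^ (p^-1))).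
    apply: ge0_ler_powR; rewrite ?nnegrE ?powR_ge0 ?invr_ge0 ?(ltW p0)//.
    exact: hz.
  have -> : B k `^ p^-1 = B k `^ (p^-1 - 1) * B k.
    have [->|Bk] := eqVneq (B k) 0; first by rewrite mulr0 powR0// invr_eq0 gt_eqF.
    rewrite -[X in _ = _ * X](powRr1 (B0 k)) -powRD ?subrK//.
    by rewrite Bk implybT.
  rewrite ler_wpM2r//; apply: ge0_ler_powR; rewrite ?nnegrE//; exact: ltW.
have -> : (fun k => z k l 0) = (fun k => z 0%N l 0 + series (telescope (fun k => z k l 0)) k).
  by apply/funext => k; exact: (eq_sum_telescope (fun k => z k l 0)).
apply: is_cvgD; first exact: is_cvg_cst.
apply: normed_cvg; apply: (series_le_cvg _ _ incr) => //.
by move=> k; rewrite mulr_ge0 ?powR_ge0.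
Qed.

Lemma powR_le_1D (R : realType) (r p : R) : 0 <= r -> 0 < p -> p < 1 -> r `^ p <= 1 + r.
Proof.
move=> r0 p0 p1; have [r1|/ltW r1] := leP r 1.
  apply: (@le_trans _ _ (1 `^ p)); last by rewrite powR1 lerDl.
  by apply: ge0_ler_powR; rewrite ?nnegrE// ltW.
by rewrite (le_trans (y := r)) ?lerDr// -[leRHS]powRr1// ler_powR// ltW.
Qed.

(** The expectation of the sum is the sum of the expectations, which is dominated
by a geometric series; a function with finite integral is finite almost
everywhere. *)
Lemma ae_summable (R : realType) d (T : measurableType d) (P : probability T R)
    (f : nat -> T -> \bar R) (a r : R) : 0 <= a -> 0 < r -> r < 1 ->
  (forall k, measurable_fun setT (f k)) -> (forall k x, (0 <= f k x)%E) ->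
  (forall k, (\int[P]_x f k x <= (a * r ^+ k)%:E)%E) ->
  {ae P, forall x, (\sum_(k <oo) f k x < +oo)%E}.
Proof.
move=> a0 r0 r1 mf f0 hf.
have ms : measurable_fun setT (fun x => \sum_(k <oo) f k x)%E.
  by apply: ge0_emeasurable_sum => //.
have s0 x : (0 <= \sum_(k <oo) f k x)%E by apply: nneseries_ge0.
have fin : (\int[P]_x (\sum_(k <oo) f k x) < +oo)%E.
  rewrite integral_nneseries//.
  apply: (@le_lt_trans _ _ (\sum_(k <oo) (a * r ^+ k)%:E)%E).
    apply: lee_nneseries => k; last by move=> _; exact: hf.
    by move=> _ _; apply: integral_ge0.
  apply: (@le_lt_trans _ _ (a * (1 - r)^-1)%:E); last exact: ltry.
  apply: lime_le.
    by apply: is_cvg_nneseries => k _ _; rewrite lee_fin mulr_ge0// exprn_ge0// ltW.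
  apply: nearW => k; rewrite sumEFin lee_fin.
  have := @geometric_le_lim R k a r a0 r0; rewrite ger0_norm ?(ltW r0)// => /(_ r1).
  by rewrite seriesEnat.
have hi : P.-integrable setT (fun x => \sum_(k <oo) f k x)%E.
  apply/integrableP; split => //.
  by under eq_integral do rewrite gee0_abs//.
have := integrable_ae measurableT hi.
apply: filterS => x /(_ Logic.I).
by rewrite ge0_fin_numE.
Qed.

(** The limit is taken to be the upper limit of each coordinate, which is
measurable and defined everywhere. *)
Lemma ae_coordinate_limit (R : realType) d (T : measurableType d) (P : probability T R)
    n (z : nat -> T -> borelV R n) :
  (forall k, measurable_fun setT (z k)) ->
  {ae P, forall x, forall l : 'I_n, cvgn (fun k => (z k x : 'cV[R]_n) l 0)} ->
  exists2 y : T -> borelV R n, measurable_fun setT y &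
    {ae P, forall x, forall l : 'I_n,
      (fun k => (z k x : 'cV[R]_n) l 0) @ \oo --> (y x : 'cV[R]_n) l 0}.
Proof.
move=> mz hz.
pose y (x : T) : borelV R n :=
  (\col_l fine (limn_esup (fun k => ((z k x : 'cV[R]_n) l 0)%:E))) : 'cV[R]_n.
exists y.
  apply: measurable_borelV => l.
  rewrite (_ : (fun _ => _) = fun x => fine (limn_esup (fun k => ((z k x : 'cV[R]_n) l 0)%:E))).
    apply: (measurableT_comp (@fine_measurable R setT measurableT)).
    apply: measurable_fun_limn_esup => k.
    by apply/measurable_EFinP; exact: (measurableT_comp (measurable_coord l) (mz k)).
  by apply/funext => x; rewrite mxE.
apply: filterS hz => x hx l; rewrite mxE.
have hl := hx l; rewrite is_cvg_limn_esupE; last first.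
  apply/cvg_ex; exists ((limn (fun k => (z k x : 'cV[R]_n) l 0)))%:E.
  by apply: cvg_EFin; [exact: nearW|exact: hl].
rewrite (_ : limn _ = (limn (fun k => (z k x : 'cV[R]_n) l 0))%:E) //.
by apply/cvg_lim => //; apply: cvg_EFin; [exact: nearW|exact: hl].
Qed.

Lemma holder_cvg (R : realType) n N (xi : 'cV[R]_N.+1) (p C : R)
    (h : borelV R n * stateT N -> \bar R) (z : nat -> 'cV[R]_n) (y : 'cV[R]_n) (i : 'I_N.+1) :
  (forall j, 0 < xi j 0) -> 0 < p -> 0 <= C -> holder xi p C h ->
  (forall l, (fun k => z k l 0) @ \oo --> y l 0) ->
  h (z k, i) @[k --> \oo] --> h (y, i).
Proof.
move=> xi0 p0 C0 [_ h01 hmod] hz.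
pose r k : R := \sum_l `|z k l 0 - y l 0|.
have r0 k : 0 <= r k by exact: sumr_ge0.
have rlim : r k @[k --> \oo] --> 0.
  have -> : 0 = \sum_(l < n) `|y l 0 - y l 0| :> R.
    by rewrite big1// => l _; rewrite subrr normr0.
  apply: (@cvg_big R 'I_n +%R 0 xpredT (@add_continuous R) nat \oo (index_enum 'I_n)
    (fun l k => `|z k l 0 - y l 0|)) => l _; apply: cvg_norm; apply: cvgB; [exact: hz|exact: cvg_cst].
have hE x : h x = (fine (h x))%:E.
  have /andP[a c] := h01 x; rewrite fineK// ge0_fin_numE//.
  by rewrite (le_lt_trans c)// ltry.
have close k : `|fine (h (y, i)) - fine (h (z k, i))| <= C * xi i 0 * r k `^ p.
  have key u v : enorm (u - v) <= r k ->
      fine (h (u, i)) - fine (h (v, i)) <= C * xi i 0 * r k `^ p.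
    move=> uv; have := hmod u v i; rewrite (hE (u, i)) (hE (v, i)) -EFinD lee_fin -lerBlDl.
    move=> /le_trans; apply; rewrite ler_wpM2l//.
      by rewrite mulr_ge0// ltW.
    by apply: ge0_ler_powR; rewrite ?nnegrE ?enorm_ge0// ltW.
  have zy : enorm (z k - y) <= r k.
    by apply: le_trans (enorm_le_sum _) _; apply: ler_sum => l _; rewrite !mxE.
  rewrite ler_norml key ?andbT; last by rewrite -opprB enormN.
  by rewrite lerNl opprB key.
rewrite (hE (y, i)) (_ : (fun _ => _) = fun k => (fine (h (z k, i)))%:E); last first.
  by apply/funext => k; exact: hE.
apply: cvg_EFin; first exact: nearW.
apply/cvgrPdist_lt => e e0 /=.
pose c := C * xi i 0 + 1.
have c0 : 0 < c by rewrite ltr_wpDl// mulr_ge0// ltW.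
have ec : 0 < e / c by exact: divr_gt0.
have d0 : 0 < (e / c) `^ p^-1 by exact: powR_gt0.
move/cvgrPdist_lt : rlim => /(_ _ d0); apply: filterS => k.
rewrite sub0r normrN ger0_norm// => rk.
apply: le_lt_trans (close k) _.
apply: (@le_lt_trans _ _ (c * r k `^ p)).
  by rewrite ler_wpM2r ?powR_ge0// /c lerDl.
rewrite -ltr_pdivlMl// mulrC.
have -> : e / c = ((e / c) `^ p^-1) `^ p.
  by rewrite -powRrM mulVf ?gt_eqF// powRr1// ltW.
by rewrite gt0_ltr_powR// nnegrE// ltW.
Qed.

(** * Invariant measures *)

Section invariant_measures.
Context {R : realType} {d : measure_display} {Omega : measurableType d}.
Variables (P : probability Omega R) (n m N : nat) (W : R -> Omega -> borelV R m).
Variables (Q : 'M[R]_N.+1) (Lambda : 'I_N.+1 -> R -> Omega -> stateT N).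
Variables (b : 'cV[R]_n -> 'I_N.+1 -> 'cV[R]_n) (sigma : 'I_N.+1 -> 'M[R]_(n, m)).
Variable delta : R.
Hypothesis hW : is_brownian_motion P W.
Hypothesis hLambda : is_markov_chain P Q Lambda.
Hypothesis hindep : forall i, independent_processes P W (Lambda i).
Hypothesis delta_gt0 : 0 < delta.
Hypothesis mb : forall i, measurable_fun setT (b ^~ i : borelV R n -> borelV R n).
Variables (rho p : R) (g : 'I_N.+1 -> R) (xi : 'cV[R]_N.+1).
Hypothesis xi0 : forall i, 0 < xi i 0.
Hypothesis p0 : 0 < p.
Hypothesis p1 : p < 1.
Hypothesis rho0 : 0 < rho.
Hypothesis rho1 : rho < 1.
Hypothesis g0 : forall i, 0 <= g i.
Hypothesis g_step : forall x y i w,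
  enorm (em_step b sigma delta x i w - em_step b sigma delta y i w) `^ p <=
    g i * enorm ((x : 'cV[R]_n) - y) `^ p.
Notation pt := (trans_prob P Lambda).
Hypothesis g_xi : forall i, g i * \sum_j pt delta i j * xi j 0 <= rho * xi i 0.
Notation S := 'I_N.+1.
Notation T := (borelV R n * stateT N)%type.
Notation K := (em_op P W Lambda b sigma delta).
Notation holder := (holder xi p).

Let hpt : transition_semigroup Q pt := chain_semigroup hLambda.
Let pt0 i j : 0 <= pt delta i j. Proof. exact: trans_prob_ge0. Qed.
Let pt1 i : \sum_j pt delta i j = 1. Proof. exact: (ts_sum1 hpt i (ltW delta_gt0)). Qed.

(** The mean of the weight [xi] contracts with factor [rho] along the coupling
that drives two copies of the scheme by the same noise and the same chain. *)
Lemma em_op_holder C h : 0 <= C -> holder C h -> holder (C * rho) (K h).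
Proof.
move=> C0 [mh h01 hmod].
have h0 z : (0 <= h z)%E by have /andP[] := h01 z.
have h1 z : (h z <= 1)%E by have /andP[] := h01 z.
have K0 z : (0 <= K h z)%E by exact: em_op_ge0.
have mstep i x : measurable_fun setT (fun w => em_step b sigma delta x i (noise W delta 0 w)).
  exact: (measurableT_comp (measurableT_comp (measurable_em_step sigma delta mb i)
    (pair1_measurable x)) (measurable_noise hW delta_gt0 0)).
have mhs i j x : measurable_fun setT
    (fun w => h (em_step b sigma delta x i (noise W delta 0 w), j)).
  exact: (measurableT_comp (measurable_slice mh j) (mstep i x)).
split.
- exact: (measurable_em_op Lambda sigma hW delta_gt0 mb mh h0).
- move=> z; rewrite K0/=.
  apply: (@le_trans _ _ (\sum_(j < N.+1) (pt delta z.2 j)%:E)%E).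
    apply: lee_sum => j _; rewrite -[leRHS]mule1 lee_wpmul2l ?lee_fin//.
    apply: (@le_trans _ _ (\int[P]_w 1)%E).
      by apply: ge0_le_integral => //; exact: mhs.
    by rewrite integral_cst// [X in (_ * X)%E](probability_setT P) mule1.
  by rewrite sumEFin pt1.
- move=> x y i; rewrite /K /=.
  pose e := enorm (x - y) `^ p.
  have e0 : 0 <= e by exact: powR_ge0.
  have c0 j : 0 <= C * xi j 0 * (g i * e) by rewrite !mulr_ge0// ltW.
  apply: (@le_trans _ _ (\sum_(j < N.+1) ((pt delta i j)%:E *
      em_mean P W b sigma delta i (fun y => h (y, j)) y +
      (pt delta i j * (C * xi j 0 * (g i * e)))%:E))%E).
    apply: lee_sum => j _.
    rewrite EFinM -ge0_muleDr ?lee_fin//; last by exact: em_mean_ge0.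
    rewrite lee_wpmul2l ?lee_fin// /em_mean.
    rewrite -[X in (_ + X)%E]mule1 -[X in (_ * X)%E](probability_setT P) -integral_cst//.
    rewrite -ge0_integralD//; last by move=> w _; rewrite lee_fin.
    apply: ge0_le_integral => //.
    + by apply: emeasurable_funD => //; exact: mhs.
    + move=> w _; rewrite /cst /=; apply: le_trans (hmod _ _ _) _.
      by apply: leeD2l; rewrite lee_fin ler_wpM2l// ?g_step// mulr_ge0// ltW.
  rewrite big_split/=; apply: leeD2l; rewrite sumEFin lee_fin.
  have -> : \sum_j pt delta i j * (C * xi j 0 * (g i * e)) =
      C * (g i * \sum_j pt delta i j * xi j 0) * e.
    rewrite !(mulr_sumr, mulr_suml); apply: eq_bigr => j _; ring.
  by rewrite ler_wpM2r// -[leRHS]mulrA ler_wpM2l.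
Qed.

Lemma iter_em_op_holder C h k : 0 <= C -> holder C h ->
  holder (C * rho ^+ k) (iter k K h).
Proof.
move=> C0 hh; elim: k => [|k IH]; first by rewrite expr0 mulr1.
rewrite exprSr mulrA iterS; apply: em_op_holder => //.
by rewrite mulr_ge0// exprn_ge0// ltW.
Qed.

Lemma iter_em_op_measurable h k : measurable_fun setT h -> (forall z, (0 <= h z)%E) ->
  measurable_fun setT (iter k K h) /\ forall z, (0 <= iter k K h z)%E.
Proof.
move=> mh h0; elim: k => [|k IH]; first by split.
have [mI I0] := IH; rewrite iterS; split.
  exact: (measurable_em_op Lambda sigma hW delta_gt0 mb mI I0).
by move=> z; exact: em_op_ge0.
Qed.

Let flow k (z : Omega * T) : T :=
  (em_scheme b sigma W Lambda delta z.2.1 z.2.2 k z.1,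
   Lambda z.2.2 (k%:R * delta) z.1).

Let measurable_flow k : measurable_fun setT (flow k).
Proof.
have h := measurable_slices (fun i =>
  measurable_scheme_state sigma hW hLambda delta_gt0 mb i k).
have h2 : measurable_fun setT (fun z : Omega * T => ((z.2.1, z.1), z.2.2)).
  apply: measurable_fun_pair; first apply: measurable_fun_pair.
  - exact: (measurableT_comp measurable_fst (@measurable_snd _ _ Omega T)).
  - exact: (@measurable_fst _ _ Omega T).
  - exact: (measurableT_comp measurable_snd (@measurable_snd _ _ Omega T)).
exact: (measurableT_comp h h2).
Qed.

(* The law after [k] steps of the chain started from [pi]. *)
Let evolve (pi : probability T R) k : probability T R :=
  law (P \x pi)%E (measurable_flow k).

Let integral_evolve pi k h : measurable_fun setT h -> (forall z, (0 <= h z)%E) ->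
  (\int[evolve pi k]_z h z = \int[pi]_z iter k K h z)%E.
Proof.
move=> mh h0; rewrite /evolve integral_law//.
rewrite (fubini_tonelli2 (fun z => h (flow k z)))//; last first.
  exact: (measurableT_comp mh (measurable_flow k)).
apply: eq_integral => -[x i] _; rewrite /fubini_G /flow /=.
exact: (em_kernel_iter sigma hW hLambda hindep delta_gt0 mb x i k mh h0).
Qed.

Let evolveE pi k A : measurable A ->
  evolve pi k A = (\sum_(j < N.+1) \int[pi]_(z in setT `*` [set j])
    em_kernel P b sigma W Lambda delta k z.1 j A)%E.
Proof.
move=> mA; pose h (z : T) : \bar R := (\1_A z)%:E.
have mh : measurable_fun setT h by apply/measurable_EFinP/measurable_indic.
have h0 z : (0 <= h z)%E by rewrite lee_fin.
have [mI I0] := iter_em_op_measurable k mh h0.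
have -> : evolve pi k A = (\int[evolve pi k]_z h z)%E.
  by rewrite integral_indic// setIT.
rewrite integral_evolve// (integral_partition pi (X := fun z : T => z.2 : S))//; last first.
  move=> j; rewrite -[X in measurable X]setTI.
  exact: (@measurable_snd _ _ (borelV R n) (stateT N)).
apply: eq_bigr => j _.
have -> : (fun z : T => z.2 : S) @^-1` [set j] = setT `*` [set j].
  by apply/seteqP; split => -[x i] //= [].
apply: eq_integral => -[x i] /set_mem[_ /= ->].
rewrite -(em_kernel_iter sigma hW hLambda hindep delta_gt0 mb x j k mh h0).
rewrite /h integral_indic ?setIT//.
have := measurableT_comp (measurable_scheme_state sigma hW hLambda delta_gt0 mb j k)
  (pair1_measurable x).
by move=> /(_ measurableT A mA); rewrite setTI.
Qed.

Lemma em_invariant_integral pi : em_invariant P b sigma W Lambda delta pi ->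
  forall h k, measurable_fun setT h -> (forall z, (0 <= h z)%E) ->
  (\int[pi]_z h z = \int[pi]_z iter k K h z)%E.
Proof.
move=> hpi h k mh h0; rewrite -integral_evolve//.
apply: eq_measure_integral => A mA _.
have mX j : measurable ((fun z : T => z.2 : S) @^-1` [set j]).
  by rewrite -[X in measurable X]setTI; exact: (@measurable_snd _ _ (borelV R n) (stateT N)).
rewrite (measure_partition pi mX mA) (measure_partition (evolve pi k) mX mA).
apply: eq_bigr => j _.
have -> : A `&` (fun z : T => z.2 : S) @^-1` [set j] = ysection A (j : stateT N) `*` [set j].
  apply/seteqP; split => -[x i] /=.
    by move=> [Ax <-]; split => //; rewrite ysectionE.
  by move=> [+ ->]; rewrite ysectionE.
have mAj : measurable (ysection A (j : stateT N)) by exact: measurable_ysection.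
have mAX : measurable (ysection A (j : stateT N) `*` [set (j : stateT N)] : set T) by exact: measurableX.
exact: etrans (hpi k _ j mAj) (esym (evolveE pi k mAX)).
Qed.

(** Two measures that agree on Hölder functions are equal. *)
Lemma em_invariant_of_holder (pi : probability T R) :
  (forall C h k, 0 <= C -> holder C h ->
    (\int[pi]_z h z = \int[pi]_z iter k K h z)%E) ->
  em_invariant P b sigma W Lambda delta pi.
Proof.
move=> hpi k G i mG.
have mGi : measurable (G `*` [set i] : set T) by exact: measurableX.
apply: etrans (evolveE pi k mGi).
apply: (holder_separate xi0 p0 p1) => // C h C0 hh.
have [mh h01 _] := hh.
rewrite (hpi C h k C0 hh) integral_evolve// => z.
by have /andP[] := h01 z.
Qed.

Variable mu : 'I_N.+1 -> R.
Hypothesis mu_sum1 : \sum_i mu i = 1.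
Hypothesis mu_stat : forall j, \sum_i mu i * pt delta i j = mu j.
Hypothesis pt_pos : forall i j, 0 < pt delta i j.

Let slab (j : S) : set T := setT `*` [set (j : stateT N)].

Let measurable_slab j : measurable (slab j).
Proof. exact: measurableX. Qed.

Let slabE j : (fun z : T => z.2 : S) @^-1` [set j] = slab j.
Proof. by apply/seteqP; split => -[x i] //= []. Qed.

Let integral_slabs (pi : probability T R) (f : T -> \bar R) :
  measurable_fun setT f -> (forall z, (0 <= f z)%E) ->
  (\int[pi]_z f z = \sum_(j < N.+1) \int[pi]_(z in slab j) f z)%E.
Proof.
move=> mf f0; rewrite (integral_partition pi (X := fun z : T => z.2 : S))//.
  by apply: eq_bigr => j _; rewrite slabE.
by move=> j; rewrite slabE.
Qed.

(** The state marginal of an invariant measure is stationary for the transition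
matrix of the chain over one step, whose entries are all positive. *)
Lemma state_marginal pi : em_invariant P b sigma W Lambda delta pi ->
  forall i, pi (slab i) = (mu i)%:E.
Proof.
move=> hpi i; pose nu j := fine (pi (slab j)).
have nuE j : pi (slab j) = (nu j)%:E by rewrite fineK// fin_num_measure.
rewrite nuE; congr EFin.
apply: (@stationary_unique _ _ (pt delta)) => //.
- apply: EFin_inj; rewrite -sumEFin -(probability_setT pi).
  rewrite (measure_partition pi (X := fun z : T => z.2 : S) _ measurableT).
    by apply: eq_bigr => j _; rewrite setTI slabE; exact/esym/nuE.
  by move=> j; rewrite slabE.
- move=> j; apply: EFin_inj; rewrite -nuE -sumEFin.
  pose h (z : T) : \bar R := (\1_(slab j) z)%:E.
  have mh : measurable_fun setT h by apply/measurable_EFinP/measurable_indic.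
  have h0 z : (0 <= h z)%E by rewrite lee_fin.
  have -> : pi (slab j) = (\int[pi]_z h z)%E by rewrite integral_indic// setIT.
  rewrite (em_invariant_integral hpi 1 mh h0) /=.
  have Kh z : K h z = (pt delta z.2 j)%:E.
    rewrite /K (bigD1 j)//= big1 ?adde0 => [|k kj].
      rewrite [X in (_ * X)%E](_ : _ = 1%E) ?mule1// /em_mean.
      rewrite (eq_integral (fun=> 1%E)) => [|w _].
        by rewrite integral_cst// [X in (_ * X)%E](probability_setT P) mule1.
      by rewrite /h indicE mem_set.
    rewrite [X in (_ * X)%E](_ : _ = 0%E) ?mule0// /em_mean.
    rewrite integral0_eq// => w _; rewrite /h indicE memNset//=.
    by move=> [_ /= kj']; rewrite kj' eqxx in kj.
  have [mK K0] := iter_em_op_measurable 1 mh h0.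
  rewrite integral_slabs//; apply: eq_bigr => k _.
  rewrite (eq_integral (fun=> (pt delta k j)%:E)) => [|z /set_mem[_ /= zk]].
    by rewrite integral_cst// EFinM muleC; congr (_ * _)%E; exact/esym/nuE.
  by rewrite Kh zk.
Qed.

Notation origin := ((0%R : 'cV[R]_n) : borelV R n).

Let radius (x : borelV R n) : R := \sum_(k < n) `|(x : 'cV[R]_n) k 0|.

Let measurable_radius : measurable_fun setT radius.
Proof.
by apply: measurable_sum => k; apply: measurableT_comp => //; exact: measurable_coord.
Qed.

(* The bound on the distance between the values of [iter k K h] at a point and at
   the origin with the same state; the truncation at 1 makes it integrable for
   every probability measure. *)
Let gap C k (z : T) : \bar R := (Num.min 1 (C * rho ^+ k * xi z.2 0 * radius z.1 `^ p))%:E.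

Let gap01 C k z : 0 <= C -> (0 <= gap C k z <= 1)%E.
Proof.
move=> C0; rewrite !lee_fin ge_min lexx/= andbT le_min ler01/=.
by rewrite !mulr_ge0 ?powR_ge0 ?exprn_ge0// ltW.
Qed.

Let measurable_gap C k : measurable_fun setT (gap C k).
Proof.
apply: (measurable_slices (f := fun x i => gap C k (x, i))) => i.
apply/measurable_EFinP; apply: measurable_minr => //.
apply: measurable_funM => //=.
by apply: (measurableT_comp (measurable_powR p)); exact: measurable_radius.
Qed.

Let gap_cvg (pi : probability T R) C : 0 <= C ->
  (\int[pi]_z gap C k z)%E @[k --> \oo] --> 0%E.
Proof.
move=> C0; rewrite -(integral0 pi setT).
apply: bounded_convergence => //; first by move=> k z; exact: gap01.
apply: aeW => z; apply: cvg_EFin; first exact: nearW.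
pose c := C * xi z.2 0 * radius z.1 `^ p.
have c0 : 0 <= c by rewrite !mulr_ge0 ?powR_ge0// ltW.
apply: (@squeeze_cvgr _ _ _ _ (fun=> 0) (fun k => c * rho ^+ k)).
- apply: nearW => k; have := gap01 k z C0; rewrite !lee_fin => /andP[-> _]/=.
  by rewrite ge_min; apply/orP; right; rewrite /c; lra.
- exact: cvg_cst.
- rewrite -[X in _ --> X](mulr0 c); apply: cvgM; first exact: cvg_cst.
  by apply: cvg_expr; rewrite gtr0_norm.
Qed.

Let iter_near_origin C h k z : 0 <= C -> holder C h ->
  (iter k K h z <= iter k K h (origin, z.2) + gap C k z)%E /\
  (iter k K h (origin, z.2) <= iter k K h z + gap C k z)%E.
Proof.
move=> C0 hh; have [_ h01 hmod] := iter_em_op_holder k C0 hh.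
have Ck : 0 <= C * rho ^+ k * xi z.2 0 by rewrite !mulr_ge0 ?exprn_ge0// ltW.
have rad (v : 'cV[R]_n) : enorm v = enorm (z.1 : 'cV[R]_n) ->
    enorm v `^ p <= radius z.1 `^ p.
  move=> ->; apply: ge0_ler_powR; rewrite ?nnegrE ?enorm_ge0 ?(ltW p0)//.
    exact: sumr_ge0.
  exact: enorm_le_sum.
have key x y : enorm ((x : 'cV[R]_n) - y) = enorm (z.1 : 'cV[R]_n) ->
    (iter k K h (x, z.2) <= iter k K h (y, z.2) + gap C k z)%E.
  move=> exy; rewrite /gap; have [_|_] := leP 1 (C * rho ^+ k * xi z.2 0 * radius z.1 `^ p).
    have /andP[_ h1] := h01 (x, z.2 : S); have /andP[h2 _] := h01 (y, z.2 : S).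
    by rewrite (le_trans h1)// leeDr.
  apply: le_trans (hmod _ _ _) _; apply: leeD2l; rewrite lee_fin ler_wpM2l//.
  exact: rad.
case: z key {Ck rad} => x i key; split; apply: key; first by rewrite subr0.
by rewrite sub0r enormN.
Qed.

Let integral_origin (pi : probability T R) h k :
  em_invariant P b sigma W Lambda delta pi -> (forall z, (0 <= h z)%E) ->
  measurable_fun setT h ->
  (\int[pi]_z iter k K h (origin, z.2) =
   \sum_(i < N.+1) (mu i)%:E * iter k K h (origin, i : stateT N))%E.
Proof.
move=> hpi h0 mh; have [mI I0] := iter_em_op_measurable k mh h0.
rewrite integral_slabs//; last first.
  by apply: (measurable_slices (f := fun _ i => iter k K h (origin, i))).
apply: eq_bigr => i _.
rewrite (eq_integral (fun=> iter k K h (origin, i : stateT N))).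
  rewrite integral_cst// muleC; congr (_ * _)%E; exact: state_marginal.
by move=> z /set_mem[_ /= ->].
Qed.

(** By invariance and contraction, the integral of a Hölder function is the limit
of its integrals along the scheme started at the origin with the stationary
state, and these do not depend on the invariant measure. *)
Lemma em_invariant_unique pi1 pi2 :
  em_invariant P b sigma W Lambda delta pi1 ->
  em_invariant P b sigma W Lambda delta pi2 ->
  forall A, measurable A -> pi1 A = pi2 A.
Proof.
move=> h1 h2; apply: (holder_separate xi0 p0 p1) => C h C0 hh.
have [mh h01 _] := hh.
have h0 z : (0 <= h z)%E by have /andP[] := h01 z.
suff le_of (pi pi' : probability T R) : em_invariant P b sigma W Lambda delta pi ->
    em_invariant P b sigma W Lambda delta pi' ->
    (\int[pi]_z h z <= \int[pi']_z h z)%E.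
  by apply/eqP; rewrite eq_le !le_of.
move=> hpi hpi'.
have bound k : (\int[pi]_z h z <=
    \int[pi']_z h z + (\int[pi]_z gap C k z + \int[pi']_z gap C k z))%E.
  have [mI I0] := iter_em_op_measurable k mh h0.
  have mO : measurable_fun setT (fun z : T => iter k K h (origin, z.2)).
    by apply: (measurable_slices (f := fun _ i => iter k K h (origin, i))).
  have mg := measurable_gap C k.
  have gp z : (0 <= gap C k z)%E by have /andP[] := gap01 k z C0.
  rewrite (em_invariant_integral hpi k mh h0) (em_invariant_integral hpi' k mh h0).
  apply: (@le_trans _ _ (\int[pi]_z (iter k K h (origin, z.2) + gap C k z))%E).
    apply: ge0_le_integral => //; first exact: emeasurable_funD.
    by move=> z _; have [] := iter_near_origin k z C0 hh.
  rewrite ge0_integralD// integral_origin// -(integral_origin k hpi')//.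
  rewrite addeA [leRHS]addeAC; apply: leeD2r.
  rewrite -ge0_integralD//; apply: ge0_le_integral => //; first exact: emeasurable_funD.
  by move=> z _; have [] := iter_near_origin k z C0 hh.
have fin : (\int[pi']_z h z)%E \is a fin_num.
  rewrite ge0_fin_numE ?integral_ge0//.
  apply: (@le_lt_trans _ _ (\int[pi']_z 1)%E).
    by apply: ge0_le_integral => // z _; have /andP[] := h01 z.
  by rewrite integral_cst// [X in (_ * X)%E](probability_setT pi') mule1 ltry.
have lim : (\int[pi']_z h z + (\int[pi]_z gap C k z + \int[pi']_z gap C k z))%E
    @[k --> \oo] --> (\int[pi']_z h z)%E.
  rewrite -[X in _ --> X]adde0; apply: cvgeD.
  - by rewrite fin_num_adde_defr.
  - exact: cvg_cst.
  - by rewrite -[X in _ --> X]adde0; apply: cvgeD => //; exact: gap_cvg.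
rewrite -(cvg_lim _ lim)//; apply: lime_ge.
  by apply/cvg_ex; eexists; exact: lim.
exact: nearW.
Qed.

(** * The scheme run backwards *)

Lemma stationary_gt0 i : (forall j, 0 <= mu j) -> 0 < mu i.
Proof.
move=> mu0; have [j muj] : exists j, 0 < mu j.
  apply: contrapT => h; have : \sum_j mu j <= 0.
    apply: sumr_le0 => j _; rewrite leNgt; apply/negP => muj.
    by apply: h; exists j.
  by rewrite mu_sum1 leNgt ltr01.
rewrite -mu_stat (bigD1 j)//= ltr_pwDl ?mulr_gt0//.
by apply: sumr_ge0 => k _; rewrite mulr_ge0.
Qed.

Section backward_iteration.
Hypothesis mu_ge0 : forall i, 0 <= mu i.

Let mu_gt0 i : 0 < mu i. Proof. exact: stationary_gt0. Qed.

(** The composition of the first [k] steps of the scheme in reversed order: the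
noise [G 0] is applied last.  Unlike the scheme itself, its values at successive
times differ by a contracted quantity only. *)
Fixpoint backward (v : nat -> S) (G : nat -> borelV R m) (k : nat) (x : borelV R n) :
    borelV R n :=
  if k is k'.+1 then backward v G k' (em_step b sigma delta x (v k'.+1) (G k')) else x.

Lemma measurable_backward dE (E : measurableType dE) (st : nat -> E -> stateT N)
    (G : nat -> E -> borelV R m) k :
  (forall l, (l <= k)%N -> measurable_fun setT (st l)) ->
  (forall l, (l < k)%N -> measurable_fun setT (G l)) ->
  measurable_fun setT (fun z : borelV R n * E => backward (st ^~ z.2) (G ^~ z.2) k z.1).
Proof.
elim: k => [|k IH] mst mG; first exact: measurable_fst.
have mk : measurable_fun setT (fun z : borelV R n * E =>
    backward (st ^~ z.2) (G ^~ z.2) k z.1).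
  by apply: IH => l lk; [apply: mst|apply: mG]; exact: leqW.
have m1 := measurableT_comp (mG k (ltnSn k)) (@measurable_snd _ _ (borelV R n) E).
have m2 := measurableT_comp (mst k.+1 (leqnn _)) (@measurable_snd _ _ (borelV R n) E).
have ms := measurable_slices (fun j => measurable_em_step sigma delta mb j).
have m3 := measurableT_comp ms (measurable_fun_pair
  (measurable_fun_pair (@measurable_fst _ _ (borelV R n) E) m1) m2).
exact: (measurableT_comp mk (measurable_fun_pair m3 (@measurable_snd _ _ (borelV R n) E))).
Qed.

Lemma backward_ext v v' G k x : (forall l, (l <= k)%N -> v l = v' l) ->
  backward v G k x = backward v' G k x.
Proof.
elim: k x => //= k IH x vv'; rewrite vv'// IH// => l lk.
by apply: vv'; exact: leqW.
Qed.

Lemma backward_contraction v G k x y :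
  enorm ((backward v G k x : 'cV[R]_n) - backward v G k y) `^ p <=
  (\prod_(l < k) g (v l.+1)) * enorm ((x : 'cV[R]_n) - y) `^ p.
Proof.
elim: k x y => [|k IH] x y /=; first by rewrite big_ord0 mul1r.
apply: le_trans (IH _ _) _; rewrite big_ord_recr/= -mulrA ler_wpM2l//.
by apply: prodr_ge0 => l _.
Qed.

(* The transition matrix of the stationary chain run backwards in time: the state
   that precedes [j] is [i] with probability [q j i]. *)
Let q j i := mu i * pt delta i j / mu j.

Let q_ge0 j i : 0 <= q j i.
Proof. by rewrite divr_ge0// mulr_ge0. Qed.

Let q_sum1 j : \sum_i q j i = 1.
Proof. by rewrite -mulr_suml mu_stat divff// gt_eqF. Qed.

Let q_mu j i : q j i * mu j = mu i * pt delta i j.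
Proof. by rewrite /q divfK// gt_eqF. Qed.

Variables (dU : measure_display) (U : measurableType dU) (PU : probability U R).
Variable s : nat -> U -> stateT N.
Hypothesis ms : forall k, measurable_fun setT (s k).
Hypothesis s_law : forall (v : nat -> S) k,
  PU [set u | forall l, (l <= k)%N -> s l u = v l] =
  (mu (v 0) * \prod_(l < k) q (v l) (v l.+1))%:E.

Let path k (u : U) : {ffun 'I_k.+1 -> S} := [ffun l : 'I_k.+1 => s (l : nat) u : S].

Let along k (v : {ffun 'I_k.+1 -> S}) (l : nat) : S := v (inord l).

Let along_path k u l : (l <= k)%N -> along (path k u) l = s l u.
Proof. by move=> lk; rewrite /along ffunE inordK. Qed.

Let pathE k (v : {ffun 'I_k.+1 -> S}) :
  path k @^-1` [set v] = [set u | forall l, (l <= k)%N -> s l u = along v l].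
Proof.
apply/seteqP; split => u /=.
  by move=> <- l lk; rewrite along_path.
by move=> h; apply/ffunP => l; rewrite ffunE h -1?ltnS// /along inord_val.
Qed.

Let measurable_state k i : measurable [set u | s k u = i].
Proof. by rewrite -[X in measurable X]setTI; exact: (ms k measurableT (Y := [set i])). Qed.

Let measurable_path k v : measurable (path k @^-1` [set v]).
Proof.
rewrite (_ : _ @^-1` _ = \bigcap_(l in [set l | (l < k.+1)%N]) [set u | s l u = along v l]).
  by apply: bigcap_measurable; [exists 0%N|move=> l _; exact: measurable_state].
by rewrite pathE; apply/seteqP; split => u h l; exact: h.
Qed.

Let path_step k v i : PU (path k @^-1` [set v] `&` [set u | s k.+1 u = i]) =
  (PU (path k @^-1` [set v]) * (q (along v k) i)%:E)%E.
Proof.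
pose w l := if (l <= k)%N then along v l else i.
have -> : path k @^-1` [set v] `&` [set u | s k.+1 u = i] =
    [set u | forall l, (l <= k.+1)%N -> s l u = w l].
  rewrite pathE; apply/seteqP; split => u /=.
    move=> [h1 h2] l; rewrite /w leq_eqVlt => /predU1P[->|].
      by rewrite ltnn.
    by rewrite ltnS => lk; rewrite lk; exact: h1.
  move=> h; split => [l lk|]; last by rewrite h// /w ltnn.
  by rewrite h 1?leqW// /w lk.
rewrite pathE !s_law -EFinM; congr EFin.
rewrite big_ord_recr/= mulrA /w leqnn ltnn; congr (_ * _ * _).
by apply: eq_bigr => l _; rewrite ltn_ord (ltnW (ltn_ord l)).
Qed.

Let integral_path k (B : set U) (phi : {ffun 'I_k.+1 -> S} -> \bar R) :
  measurable B -> (forall v, (0 <= phi v)%E) ->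
  (\int[PU]_(u in B) phi (path k u) =
   \sum_v phi v * PU (path k @^-1` [set v] `&` B))%E.
Proof.
move=> mB phi0.
rewrite integral_mkcond.
have patchE' u : ((phi \o path k) \_ B) u = (phi (path k u) * (\1_B u)%:E)%E.
  by rewrite patchE indicE; case: (u \in B); rewrite ?mule1 ?mule0.
have mphi : measurable_fun setT ((phi \o path k) \_ B).
  have mp : measurable_fun setT (phi \o path k).
    move=> _ Y mY; rewrite setTI.
    rewrite (_ : _ @^-1` Y = \bigcup_(v in phi @^-1` Y) (path k @^-1` [set v])).
      apply: fin_bigcup_measurable => [|v _]; last exact: measurable_path.
      exact: finite_finset.
    apply/seteqP; split => u /=; first by move=> Yu; exists (path k u).
    by move=> [v Yv /= ->].
  by apply/(measurable_restrictT _ mB); exact: measurable_funTS.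
rewrite (integral_partition PU (@measurable_path k))//; last first.
  by move=> u; rewrite patchE'; rewrite mule_ge0// lee_fin.
apply: eq_bigr => v _; have mpv := measurable_path v.
rewrite (eq_integral (fun u => phi v * (\1_B u)%:E)%E) => [|u /set_mem /= <-]; last first.
  exact: patchE'.
rewrite ge0_integralZl//; last exact/measurable_EFinP/measurable_funTS/measurable_indic.
by rewrite integral_indic// setIC.
Qed.

(** The Markov property of the reversed chain, for functionals of its past. *)
Let path_markov k i (phi : {ffun 'I_k.+1 -> S} -> \bar R) : (forall v, (0 <= phi v)%E) ->
  (\int[PU]_(u in [set u | s k.+1 u = i]) phi (path k u) =
   \sum_(j < N.+1) (q j i)%:E * \int[PU]_(u in [set u | s k u = j]) phi (path k u))%E.
Proof.
move=> phi0.
rewrite integral_path//.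
rewrite [RHS](eq_bigr (fun j => \sum_v (q j i)%:E *
    (phi v * PU (path k @^-1` [set v] `&` [set u | s k u = j])))%E); last first.
  by move=> j _; rewrite integral_path// ge0_sume_distrr// => v _; rewrite mule_ge0.
rewrite exchange_big/=; apply: eq_bigr => v _.
rewrite (bigD1 (along v k))//= big1 ?adde0 => [|j jv].
  rewrite path_step [RHS]muleCA; congr (_ * _)%E; rewrite muleC; congr (_ * _)%E.
  congr (PU _); apply/seteqP; split => u /=; last by case.
  by move=> h; split => //; rewrite -h along_path.
rewrite [X in PU X](_ : _ = set0) ?measure0 ?mule0//.
apply/seteqP; split => // u /= [h1 h2]; move: jv.
by rewrite -h1 along_path// -h2 eqxx.
Qed.

Let noise_ := noise W delta.

(* The mean over the noise along a given trajectory of the chain. *)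
Let psi (h : T -> \bar R) k (x : borelV R n) (v : {ffun 'I_k.+1 -> S}) : \bar R :=
  (\int[P]_w h (backward (along v) (noise_ ^~ w) k x, v ord0 : stateT N))%E.

Let measurable_noise_ k : measurable_fun setT (noise_ k).
Proof. exact: (measurable_noise hW delta_gt0). Qed.

Let psi_path h k x u : psi h x (path k u) =
  (\int[P]_w h (backward (s ^~ u) (noise_ ^~ w) k x, s 0 u))%E.
Proof.
apply: eq_integral => w _; congr (h (_, _)); last by rewrite ffunE.
by apply: backward_ext => l lk; rewrite along_path.
Qed.

Let measurable_backward_past k (v : nat -> S) :
  measurable_fun setT (fun z : borelV R n * past W `[0, k%:R * delta] =>
    backward v (noise_ ^~ z.2) k z.1).
Proof.
apply: (@measurable_backward _ (past W `[0, k%:R * delta]) (fun l _ => v l) noise_) => // l lk.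
exact: (measurable_past_noise (delta := delta) (W := W) delta_gt0 (time_le delta_gt0 lk)).
Qed.

Let measurable_backward_noise k (v : nat -> S) :
  measurable_fun setT (fun z : borelV R n * Omega => backward v (noise_ ^~ z.2) k z.1).
Proof. exact: (@measurable_backward _ Omega (fun l _ => v l) noise_). Qed.

Section backward_mean.
Variable h : T -> \bar R.
Hypothesis mh : measurable_fun setT h.
Hypothesis h0 : forall z, (0 <= h z)%E.

Let psi0 k x (v : {ffun 'I_k.+1 -> S}) : (0 <= psi h x v)%E.
Proof. exact: integral_ge0. Qed.

Let measurable_psi k (v : {ffun 'I_k.+1 -> S}) : measurable_fun setT (fun y => psi h y v).
Proof.
have mhb := measurableT_comp (measurable_slice mh (v ord0)) (measurable_backward_noise k (along v)).
exact: (measurable_fun_fubini_tonelli_F (m2 := P) _ mhb (fun z => h0 _)).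
Qed.

(* The increment of index [k], applied first, is independent of the previous
   ones. *)
Let psi_step k x i (v : {ffun 'I_k.+1 -> S}) :
  (\int[P]_w h (backward (along v) (noise_ ^~ w) k
      (em_step b sigma delta x i (noise_ k w)), v ord0 : stateT N) =
   em_mean P W b sigma delta i (fun y => psi h y v) x)%E.
Proof.
have m1 := measurableT_comp (measurableT_comp (measurable_em_step sigma delta mb i)
  (pair1_measurable x)) (@measurable_snd _ _ (past W `[0, k%:R * delta]) (borelV R m)).
have mphi := measurableT_comp (measurable_slice mh (v ord0))
  (measurableT_comp (measurable_backward_past (k := k) (along v))
    (measurable_fun_pair m1 (@measurable_fst _ _ (past W `[0, k%:R * delta]) (borelV R m)))).
have [_ +] := integral_past_increment hW (time_ge0 delta_gt0 k) (time_lt delta_gt0 k)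
  (time_ge0 delta_gt0 0) (time_lt delta_gt0 0) (time_step delta k) mphi (fun z => h0 _).
exact.
Qed.

(** For a fixed number of steps, the backward iteration along the reversed
stationary chain has the law of the scheme started with the stationary state:
reversing the chain exchanges the roles of its first and last states, and the
increments of the noise are exchangeable. *)
Lemma backward_mean k x i :
  (\int[PU]_(u in [set u | s k u = i])
     \int[P]_w h (backward (s ^~ u) (noise_ ^~ w) k x, s 0 u) =
   (mu i)%:E * iter k K h (x, i : stateT N))%E.
Proof.
elim: k x i => [|k IH] x i /=.
  rewrite (eq_integral (fun=> h (x, i : stateT N))) => [|u /set_mem /= ->]; last first.
    by rewrite integral_cst// [X in (_ * X)%E](probability_setT P) mule1.
  rewrite integral_cst; last exact: measurable_state.
  rewrite muleC; congr (_ * _)%E.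
  have := s_law (fun=> i) 0; rewrite big_ord0 mulr1 => <-; congr (PU _).
  apply/seteqP; split => u /= hu; last exact: hu.
  by move=> l; rewrite leqn0 => /eqP ->.
have [mI I0] := iter_em_op_measurable k mh h0.
transitivity (\int[PU]_(u in [set u | s k.+1 u = i])
    em_mean P W b sigma delta i (fun y => psi h y (path k u)) x)%E.
  apply: eq_integral => u /set_mem /= su; rewrite su -psi_step.
  apply: eq_integral => w _; congr (h (_, _)); last by rewrite ffunE.
  by apply: backward_ext => l lk; rewrite along_path.
rewrite (@path_markov k i (fun v => em_mean P W b sigma delta i (fun y => psi h y v) x)); last first.
  by move=> v; apply: em_mean_ge0 => y; exact: psi0.
have -> : K (iter k K h) (x, i : stateT N) = (\sum_(j < N.+1) (pt delta i j)%:E *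
    em_mean P W b sigma delta i (fun y => iter k K h (y, j : stateT N)) x)%E by [].
rewrite ge0_sume_distrr; last first.
  move=> j _; rewrite mule_ge0 ?lee_fin//; exact: em_mean_ge0.
apply: eq_bigr => j _.
have mj := measurable_state k j.
rewrite (@integral_path k _ (fun v => em_mean P W b sigma delta i (fun y => psi h y v) x))//; last first.
  by move=> v; apply: em_mean_ge0 => y; exact: psi0.
rewrite [RHS]muleA -EFinM -q_mu (EFinM (q j i) (mu j)) -[RHS]muleA; congr (_%:E * _)%E.
rewrite [in RHS]/em_mean -ge0_integralZl//; last 2 first.
- apply: (measurableT_comp (measurable_slice mI j)).
  exact: (measurableT_comp (measurableT_comp (measurable_em_step sigma delta mb i)
    (pair1_measurable x)) (measurable_noise hW delta_gt0 0)).
- by rewrite lee_fin.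
have mstep : measurable_fun setT (fun w => em_step b sigma delta x i (noise W delta 0 w)).
  exact: (measurableT_comp (measurableT_comp (measurable_em_step sigma delta mb i)
    (pair1_measurable x)) (measurable_noise hW delta_gt0 0)).
transitivity (\int[P]_w \sum_v psi h (em_step b sigma delta x i (noise W delta 0 w)) v *
    PU (path k @^-1` [set v] `&` [set u | s k u = j]))%E.
  rewrite ge0_integral_sum//.
  - apply: eq_bigr => v _; rewrite ge0_integralZr//.
    exact: (measurableT_comp (measurable_psi v) mstep).
  - move=> v; apply: emeasurable_funM => //.
    exact: (measurableT_comp (measurable_psi v) mstep).
  - by move=> v w _; rewrite mule_ge0.
apply: eq_integral => w _; rewrite -IH -integral_path//.
by apply: eq_integral => u _; rewrite psi_path.
Qed.

End backward_mean.

(* The Lipschitz constant, for the [p]-th power of the distance, of the backward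
   composition of [k] steps. *)
Let weight k u : R := \prod_(l < k) g (s l.+1 u).

Let weight_ge0 k u : 0 <= weight k u.
Proof. by apply: prodr_ge0. Qed.

Let measurable_weight k : measurable_fun setT (weight k).
Proof.
apply: measurable_prod => l _.
exact: (@measurableT_comp _ _ _ _ (stateT N) _ (fun i => g i) setT (s l.+1)).
Qed.

Let C0 : R := (minI (fun i => xi i 0))^-1.

Let C0_gt0 : 0 < C0. Proof. by rewrite invr_gt0 minI_gt0. Qed.

(** The contraction of the mean weight in reversed time: the relation
[q j i * mu j = mu i * pt delta i j] turns the sum over the later states [j] of the
original chain into the mean of [xi] after one step from [i], which [g_xi]
controls. *)
Let weight_state k i :
  (\int[PU]_(u in [set u | s k u = i]) (weight k u)%:E <=
   (C0 * rho ^+ k * (mu i * xi i 0))%:E)%E.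
Proof.
elim: k i => [|k IH] i.
  rewrite (eq_integral (fun=> 1%E)) => [|u _]; last by rewrite /weight big_ord0.
  rewrite integral_cst; last exact: measurable_state.
  rewrite [X in (_ * X)%E](_ : _ = (mu i)%:E) ?mul1e; last first.
    have := s_law (fun=> i) 0; rewrite big_ord0 mulr1 => <-; congr (PU _).
    apply/seteqP; split => u /= hu; last exact: hu.
    by move=> l; rewrite leqn0 => /eqP ->.
  rewrite lee_fin expr0 mulr1 mulrCA ler_peMr// /C0.
  by rewrite ler_pdivlMl ?mulr1 ?minI_gt0//; exact: (minI_le (fun i => xi i 0)).
pose phi (v : {ffun 'I_k.+1 -> S}) : \bar R := (g i * \prod_(l < k) g (along v l.+1))%:E.
have phi0 v : (0 <= phi v)%E by rewrite lee_fin mulr_ge0// prodr_ge0.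
have phiE u : phi (path k u) = ((g i)%:E * (weight k u)%:E)%E.
  rewrite /phi EFinM; congr (_ * _%:E)%E; apply: eq_bigr => l _.
  by rewrite along_path// ltn_ord.
rewrite (eq_integral (fun u => phi (path k u))); last first.
  move=> u /set_mem /= su; rewrite phiE -EFinM /weight big_ord_recr/= mulrC.
  by rewrite su.
rewrite (path_markov _ phi0).
apply: (@le_trans _ _ (\sum_(j < N.+1) (q j i * (g i * (C0 * rho ^+ k * (mu j * xi j 0))))%:E)%E).
  apply: lee_sum => j _; rewrite (EFinM (q j i)); apply: lee_wpmul2l; first by rewrite lee_fin.
  under eq_integral do rewrite phiE.
  rewrite ge0_integralZl//; last 3 first.
  - by apply/measurable_funTS/measurable_EFinP; exact: measurable_weight.
  - by move=> u _; rewrite lee_fin.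
  - by rewrite lee_fin.
  by rewrite EFinM lee_wpmul2l ?lee_fin// IH.
rewrite sumEFin lee_fin.
have -> : \sum_j q j i * (g i * (C0 * rho ^+ k * (mu j * xi j 0))) =
    C0 * rho ^+ k * mu i * (g i * \sum_j pt delta i j * xi j 0).
  rewrite !mulr_sumr; apply: eq_bigr => j _.
  have := q_mu j i; set a := q j i; set c := pt delta i j => e.
  have -> : C0 * rho ^+ k * mu i * (g i * (c * xi j 0)) =
     C0 * rho ^+ k * (mu i * c) * (g i * xi j 0) by ring.
  by rewrite -e; ring.
rewrite exprSr.
have -> : C0 * (rho ^+ k * rho) * (mu i * xi i 0) = C0 * rho ^+ k * mu i * (rho * xi i 0) by ring.
by rewrite ler_wpM2l// !mulr_ge0 ?exprn_ge0// ltW.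
Qed.

Let weight_decay k : (\int[PU]_u (weight k u)%:E <=
   (C0 * (\sum_i mu i * xi i 0) * rho ^+ k)%:E)%E.
Proof.
rewrite (integral_partition PU (X := fun u => s k u : S)) => [|i||].
- apply: le_trans (lee_sum _ (fun i _ => weight_state k i)) _.
  by rewrite sumEFin lee_fin -mulr_sumr mulrAC.
- exact: measurable_state.
- exact/measurable_EFinP.
- by move=> u; rewrite lee_fin.
Qed.

Let scheme_radius i w := radius (em_step b sigma delta origin i w).

Let measurable_scheme_radius : measurable_fun setT (fun z : borelV R m * stateT N =>
  scheme_radius z.2 z.1).
Proof.
apply: (measurable_slices (f := fun w i => scheme_radius i w)) => i.
apply: (measurableT_comp measurable_radius).
exact: (measurableT_comp (measurable_em_step sigma delta mb i) (pair1_measurable origin)).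
Qed.

Let step_moment i k := (\int[P]_w (scheme_radius i (noise_ k w) `^ p)%:E)%E.

Let step_moment_finite i k : (step_moment i k < +oo)%E.
Proof.
pose c := 1 + \sum_a `|(delta *: b (0 : 'cV[R]_n) i) a 0|.
pose D l := \sum_a `|sigma i a l|.
have D0 l : 0 <= D l by exact: sumr_ge0.
have c0 : 0 <= c by rewrite addr_ge0// sumr_ge0.
have bound w : scheme_radius i w `^ p <= c + \sum_l D l * `|(w : 'cV[R]_m) l 0|.
  apply: (le_trans (powR_le_1D _ p0 p1)); first exact: sumr_ge0.
  rewrite -addrA lerD2l /scheme_radius /radius /em_step.
  have -> : \sum_l D l * `|(w : 'cV[R]_m) l 0| =
      \sum_a \sum_l `|sigma i a l| * `|(w : 'cV[R]_m) l 0|.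
    by rewrite exchange_big; apply: eq_bigr => l _; rewrite mulr_suml.
  rewrite -big_split/=; apply: ler_sum => a _.
  rewrite add0r mxE; apply: le_trans (ler_normD _ _) _; rewrite lerD2l mxE.
  by apply: le_trans (ler_norm_sum _ _ _) _; apply: ler_sum => l _; rewrite normrM.
have mn l : measurable_fun setT (fun w => `|(noise_ k w : 'cV[R]_m) l 0|).
  by apply: measurableT_comp => //; exact: (measurableT_comp (measurable_coord l) (measurable_noise_ k)).
have mDn l : measurable_fun setT (fun w => (D l * `|(noise_ k w : 'cV[R]_m) l 0|)%:E).
  by apply/measurable_EFinP; apply: measurable_funM.
rewrite /step_moment.
apply: (@le_lt_trans _ _ (\int[P]_w (c%:E +
    \sum_(l < m) (D l * `|(noise_ k w : 'cV[R]_m) l 0|)%:E))%E).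
  apply: ge0_le_integral => //.
  - by move=> w _; rewrite lee_fin powR_ge0.
  - apply/measurable_EFinP; apply: (measurableT_comp (measurable_powR p)).
    exact: (measurableT_comp measurable_scheme_radius
      (measurableT_comp (pair2_measurable (i : stateT N)) (measurable_noise_ k))).
  - by apply: emeasurable_funD => //; exact: emeasurable_sum.
  - by move=> w _; rewrite sumEFin -EFinD lee_fin.
rewrite ge0_integralD//; last 2 first.
- by move=> w _; apply: sume_ge0 => l _; rewrite lee_fin mulr_ge0.
- exact: emeasurable_sum.
rewrite integral_cst// [X in (_ * X)%E](probability_setT P) mule1.
rewrite ge0_integral_sum//; last by move=> l w _; rewrite lee_fin mulr_ge0.
rewrite lte_add_pinfty ?ltry//; apply: lte_sum_pinfty => l _.
under eq_integral do rewrite EFinM.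
rewrite ge0_integralZl//; last 2 first.
- exact/measurable_EFinP.
- by rewrite lee_fin.
rewrite lte_mul_pinfty ?lee_fin//.
exact: (increment_abs_moment hW l (time_ge0 delta_gt0 k) (time_lt delta_gt0 k)).
Qed.

(* The bound is uniform in the index of the step because the increments of the
   noise all have the same law. *)
Let step_moment_bound :
  exists2 M : R, 0 <= M & forall i k, (step_moment i k <= M%:E)%E.
Proof.
have s0 i k : (0 <= step_moment i k)%E.
  by apply: integral_ge0 => w _; rewrite lee_fin powR_ge0.
exists (\sum_i fine (step_moment i 0)).
  by apply: sumr_ge0 => i _; exact: fine_ge0.
move=> i k; have -> : step_moment i k = step_moment i 0.
  have mh : measurable_fun setT (fun x => (radius x `^ p)%:E).
    apply/measurable_EFinP; apply: (measurableT_comp (measurable_powR p)).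
    exact: measurable_radius.
  have h0 x : (0 <= (radius x `^ p)%:E)%E by rewrite lee_fin powR_ge0.
  exact: (etrans (em_mean_noise sigma hW delta_gt0 mb i mh h0 k origin)
    (esym (em_mean_noise sigma hW delta_gt0 mb i mh h0 0 origin))).
rewrite -[leLHS]fineK ?ge0_fin_numE// lee_fin (bigD1 i)//= lerDl.
by apply: sumr_ge0 => j _; exact: fine_ge0.
Qed.

(* The displacement of the first point under the step of index [k], contracted
   by the steps that follow it. *)
Let displacement k (z : Omega * U) : R :=
  weight k z.2 * scheme_radius (s k.+1 z.2) (noise_ k z.1) `^ p.

Let displacement_ge0 k z : 0 <= displacement k z.
Proof. by apply: mulr_ge0; [exact: weight_ge0|exact: powR_ge0]. Qed.

Let measurable_displacement k : measurable_fun setT (displacement k).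
Proof.
apply: measurable_funM; first exact: (measurableT_comp (measurable_weight k) measurable_snd).
apply: (measurableT_comp (measurable_powR p)).
apply: (measurableT_comp measurable_scheme_radius (g := fun z : Omega * U =>
   (noise_ k z.1, s k.+1 z.2))).
apply: measurable_fun_pair.
- exact: (measurableT_comp (measurable_noise_ k) measurable_fst).
- exact: (measurableT_comp (ms k.+1) measurable_snd).
Qed.

Let displacement_ae : {ae (P \x PU)%E, forall z, (\sum_(k <oo) (displacement k z)%:E < +oo)%E}.
Proof.
have [M M0 hM] := step_moment_bound.
have C1 : 0 <= C0 * \sum_i mu i * xi i 0.
  by rewrite mulr_ge0 ?(ltW C0_gt0)// sumr_ge0// => i _; rewrite mulr_ge0// ltW.
apply: (@ae_summable _ _ _ (P \x PU)%E (fun k z => (displacement k z)%:E)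
  (C0 * (\sum_i mu i * xi i 0) * M) rho) => //.
- by rewrite mulr_ge0.
- by move=> k; exact/measurable_EFinP.
move=> k; rewrite (fubini_tonelli2 (fun z => (displacement k z)%:E))//; last 2 first.
- exact/measurable_EFinP.
- by move=> z; rewrite lee_fin.
apply: (@le_trans _ _ (\int[PU]_u (weight k u * M)%:E)%E).
  apply: ge0_le_integral => //.
  - by move=> u _; apply: integral_ge0 => w _; rewrite lee_fin.
  - apply: (measurable_fun_fubini_tonelli_G (m1 := P)) => //.
      exact/measurable_EFinP.
    by move=> z; rewrite lee_fin.
  - apply/measurable_EFinP; apply: measurable_funM; [exact: measurable_weight|exact: measurable_cst].
  move=> u _; have w0 : (0 <= (weight k u)%:E)%E by rewrite lee_fin; exact: weight_ge0.
  have -> : fubini_G P (fun z => (displacement k z)%:E) u =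
      ((weight k u)%:E * step_moment (s k.+1 u) k)%E.
    rewrite /step_moment -ge0_integralZl//.
    - apply/measurable_EFinP; apply: (measurableT_comp (measurable_powR p)).
      exact: (measurableT_comp measurable_scheme_radius
        (measurableT_comp (pair2_measurable (s k.+1 u)) (measurable_noise_ k))).
    - by move=> w _; rewrite lee_fin powR_ge0.
  rewrite (EFinM (weight k u) M); apply: lee_wpmul2l => //; exact: (hM (s k.+1 u) k).
rewrite (eq_integral (fun u => (weight k u)%:E * M%:E)%E) => [|u _]; last exact: EFinM.
rewrite ge0_integralZr; [ |exact: measurableT|apply/measurable_EFinP; exact: measurable_weight
  |by move=> u _; rewrite lee_fin; exact: weight_ge0|by rewrite lee_fin].
rewrite -mulrA [M * _]mulrC mulrA EFinM.
by rewrite lee_wpmul2r ?lee_fin//; exact: weight_decay.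
Qed.

Let point k (z : Omega * U) : borelV R n :=
  backward (s ^~ z.2) (noise_ ^~ z.1) k origin.

Let measurable_point k : measurable_fun setT (point k).
Proof.
have mst l (_ : (l <= k)%N) := measurableT_comp (ms l) (@measurable_snd _ _ Omega U).
have mG l (_ : (l < k)%N) := measurableT_comp (measurable_noise_ l) (@measurable_fst _ _ Omega U).
have mb' := measurable_backward mst mG.
exact: (measurableT_comp mb' (pair1_measurable origin)).
Qed.

Let point_displacement k z :
  enorm ((point k.+1 z : 'cV[R]_n) - point k z) `^ p <= displacement k z.
Proof.
have h := backward_contraction (s ^~ z.2) (noise_ ^~ z.1) k
  (em_step b sigma delta origin (s k.+1 z.2) (noise_ k z.1)) origin.
apply: (le_trans h); rewrite {h} /displacement.
apply: ler_wpM2l; first exact: weight_ge0.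
apply: ge0_ler_powR; rewrite ?nnegrE ?enorm_ge0 ?(ltW p0)//.
  exact: sumr_ge0.
by rewrite subr0; exact: enorm_le_sum.
Qed.

Let point_limit : exists2 y : Omega * U -> borelV R n, measurable_fun setT y &
  {ae (P \x PU)%E, forall z, forall l : 'I_n,
    (fun k => (point k z : 'cV[R]_n) l 0) @ \oo --> (y z : 'cV[R]_n) l 0}.
Proof.
apply: (ae_coordinate_limit (P := (P \x PU)%E)) => //.
apply: filterS displacement_ae => z hz l.
exact: (summable_powers_cvg p0 p1 (displacement_ge0^~ z) hz (point_displacement^~ z)).
Qed.

Let mean_from_origin h k := (\sum_(i < N.+1) (mu i)%:E * iter k K h (origin, i : stateT N))%E.

Let point_mean h k : measurable_fun setT h -> (forall z, (0 <= h z)%E) ->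
  (\int[P \x PU]_z h (point k z, s 0 z.2) = mean_from_origin h k)%E.
Proof.
move=> mh h0.
have mhp : measurable_fun setT (fun z : Omega * U => h (point k z, s 0 z.2)).
  apply: (measurableT_comp mh); apply: measurable_fun_pair => //.
  exact: (measurableT_comp (ms 0) (@measurable_snd _ _ Omega U)).
rewrite (fubini_tonelli2 (fun z => h (point k z, s 0 z.2)))//.
rewrite (integral_partition PU (X := fun u => s k u : S))//.
- by apply: eq_bigr => i _; rewrite -(backward_mean mh h0).
- by move=> i; exact: measurable_state.
- exact: (measurable_fun_fubini_tonelli_G (m1 := P) _ mhp (fun z => h0 _)).
- by move=> u; apply: integral_ge0.
Qed.

(** The displacements of the backward iteration are summable almost surely, so
that it converges at almost every sample, and not only in law. The law of its
limit is the limit of the laws of the scheme, along which the transition operator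
acts as a shift. *)
Lemma backward_limit_invariant : exists pi : probability T R,
  em_invariant P b sigma W Lambda delta pi.
Proof.
have [y my hy] := point_limit.
have myz : measurable_fun setT (fun z : Omega * U => (y z, s 0 z.2)).
  apply: measurable_fun_pair => //.
  exact: (measurableT_comp (ms 0) (@measurable_snd _ _ Omega U)).
pose pi : probability T R := law (P \x PU)%E myz.
have lim C h : 0 <= C -> holder C h ->
    mean_from_origin h k @[k --> \oo] --> (\int[pi]_z h z)%E.
  move=> C0' hh; have [mh h01 _] := hh.
  have h0 z : (0 <= h z)%E by have /andP[] := h01 z.
  rewrite integral_law//.
  under eq_fun do rewrite -point_mean//.
  apply: (bounded_convergence (P := (P \x PU)%E)) => //.
  - move=> k; apply: (measurableT_comp mh); apply: measurable_fun_pair => //.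
    exact: (measurableT_comp (ms 0) (@measurable_snd _ _ Omega U)).
  - exact: (measurableT_comp mh myz).
  - apply: filterS hy => z hz.
    exact: (holder_cvg xi0 p0 C0' hh).
exists pi; apply: em_invariant_of_holder => C h l C0' hh.
have hl := iter_em_op_holder l C0' hh.
have Cl : 0 <= C * rho ^+ l by rewrite mulr_ge0// exprn_ge0// ltW.
have /cvg_lim <- // := lim _ _ Cl hl.
have e : mean_from_origin (iter l K h) = fun k => mean_from_origin h (k + l)%N.
  by apply/funext => k; apply: eq_bigr => i _; rewrite iterD.
rewrite e; apply/esym/cvg_lim => //.
by rewrite cvg_shiftn; exact: lim C0' hh.
Qed.

End backward_iteration.

(** The reversed chain is realized on the unit interval, independently of the
noise: the limit lives on the product of the two sample spaces. *)
Lemma em_invariant_exists : (forall i, 0 <= mu i) ->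
  exists pi : probability T R, em_invariant P b sigma W Lambda delta pi.
Proof.
move=> mu0; pose q j i := mu i * pt delta i j / mu j.
have muE j : mu j != 0 by rewrite gt_eqF// stationary_gt0.
have q0 j i : 0 <= q j i := divr_ge0 (mulr_ge0 (mu0 i) (pt0 i j)) (mu0 j).
have q1 j : \sum_i q j i = 1 by rewrite -mulr_suml mu_stat divff.
have [PU [s [ms s_law]]] := markov_chain_existence mu0 mu_sum1 q0 q1.
exact: (backward_limit_invariant mu0 ms s_law).
Qed.

End invariant_measures.

(** * Existence and uniqueness of the invariant measure *)

Theorem theorem3p1 (R : realType) (d : measure_display)
    (Omega : measurableType d) (P : probability Omega R)
    (n m N : nat)
    (W : R -> Omega -> borelV R m)
    (Q : 'M[R]_N.+1) (Lambda : 'I_N.+1 -> R -> Omega -> stateT N)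
    (mu : 'I_N.+1 -> R)
    (b : 'cV[R]_n -> 'I_N.+1 -> 'cV[R]_n)
    (sigma : 'I_N.+1 -> 'M[R]_(n, m))
    (L c0 : R) (beta : 'I_N.+1 -> R) (p0 p : R) (xi : 'cV[R]_N.+1)
    (hW : is_brownian_motion P W)
    (hQ : is_conservative_Qmatrix Q)
    (hQirr : irreducible_Qmatrix Q)
    (hLambda : is_markov_chain P Q Lambda)
    (hindep : forall i, independent_processes P W (Lambda i))
    (hmu : is_stationary_distribution P Lambda mu)
    (hL : 0 < L)
    (hLip : forall i x y, enorm (b x i - b y i) <= L * enorm (x - y))
    (hc0 : 0 < c0)
    (hgrowth : forall i x,
      2 * dotp x (b x i) + hsnorm (sigma i) ^+ 2 <=
      c0 + beta i * enorm x ^+ 2)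
    (hdiss : forall i x y,
      2 * dotp (x - y) (b x i - b y i) <= beta i * enorm (x - y) ^+ 2)
    (hmubeta : \sum_i mu i * beta i < 0)
    (hp0 : 0 < p0)
    (hetap0 : forall q, 0 < q -> q < p0 -> 0 < etap Q beta q)
    (hp : 0 < p) (hpmin : p < Num.min 1 p0)
    (hxi : forall i, 0 < xi i 0)
    (hQxi : Qp Q beta p *m xi = - etap Q beta p *: xi) :
  forall delta : R, 0 < delta -> delta < 1 ->
    delta < Num.min (1 / (16 * L ^+ 2))
                    ((etap Q beta p / alpha Q beta L p xi) `^ (2 / p)) ->
    exists pi : probability (borelV R n * stateT N)%type R,
      em_invariant P b sigma W Lambda delta pi /\
      (forall pi' : probability (borelV R n * stateT N)%type R,
        em_invariant P b sigma W Lambda delta pi' ->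
        forall A, measurable A -> pi' A = pi A).
Proof.
move=> delta delta0 delta1; rewrite lt_min => /andP[dL dA].
move: hpmin; rewrite lt_min => /andP[p1 pp0].
have hpt := chain_semigroup hLambda.
have [rho /andP[rho0 rho1] [g [g0 g_step g_xi]]] :=
  em_step_contraction sigma delta0 hL hp p1 hLip hdiss hQ hxi (hetap0 p hp pp0) hQxi
    delta1 dL dA hpt.
have mb i : measurable_fun setT (b ^~ i : borelV R n -> borelV R n).
  by apply: continuous_measurable_borelV; exact: enorm_lipschitz_continuous (hLip i).
have mu_stat j : \sum_i mu i * trans_prob P Lambda delta i j = mu j.
  exact: (stationary_trans_prob hLambda j hmu (ltW delta0)).
have pt_pos i j : 0 < trans_prob P Lambda delta i j := ts_pos hpt i j hQirr delta0.
have [pi hpi] := em_invariant_exists hW hLambda hindep delta0 mb hxi hp p1 rho0 rho1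
  g0 g_step g_xi (sd_sum1 hmu) mu_stat pt_pos (sd_ge0 hmu).
exists pi; split => // pi' hpi'.
exact: (em_invariant_unique hW hLambda hindep delta0 mb hxi hp p1 rho0 rho1
  g0 g_step g_xi (sd_sum1 hmu) mu_stat pt_pos).
Qed.
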